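(* Let $\{(\mu_t,\nu_t)\}_{t\ge0}$ be a weakly continuous $\rhd_c$-convolution semigroup in $\mathcal{P}(\mathbb{T})\times\mathcal{P}(\mathbb{T})$ with $(\mu_0,\nu_0)=(\delta_1,\delta_1)$. Then there exist analytic functions $B_1,B_2:\mathbb{D}\to\mathbb{C}$ with $\operatorname{Re}B_1\le0$ and $\operatorname{Re}B_2\le0$ such that, for all $t\ge0$ and $z\in\mathbb{D}$, $$\frac{d}{dt}\eta_{\mu_t}(z)=\eta_{\mu_t}(z)\,B_1(\eta_{\nu_t}(z)),\qquad \frac{d}{dt}\eta_{\nu_t}(z)=\eta_{\nu_t}(z)\,B_2(\eta_{\nu_t}(z)).$$ Conversely, given analytic $B_1,B_2:\mathbb{D}\to\mathbb{C}$ with $\operatorname{Re}B_1,\operatorname{Re}B_2\le0$, there exists a weakly continuous $\rhd_c$-convolution semigroup $\{(\mu_t,\nu_t)\}_{t\ge0}$ with $(\mu_0,\nu_0)=(\delta_1,\delta_1)$ satisfying these two differential equations. Moreover, each such $B_j$ ($j=1,2$) can be written as $$B_j(z)=i\gamma_j+\int_{\mathbb{T}}\frac{z+\zeta}{z-\zeta}\,\tau_j(d\zeta),$$ with $\gamma_j\in\mathbb{R}$ and $\tau_j$ a positive finite Borel measure on $\mathbb{T}$.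
   Context: $\mathbb{T}$ is the unit circle, $\mathbb{D}$ the open unit disc, and $\mathcal{P}(\mathbb{T})$ the set of Borel probability measures on $\mathbb{T}$. For $\mu\in\mathcal{P}(\mathbb{T})$ let $\psi_\mu(z)=\int_{\mathbb{T}}\frac{z\zeta}{1-z\zeta}d\mu(\zeta)$ and $\eta_\mu=\psi_\mu/(1+\psi_\mu)$ on $\mathbb{D}$. The function $\eta_\mu$ determines $\mu$, and the analytic functions $\eta:\mathbb{D}\to\mathbb{C}$ of this form are exactly those with $|\eta(z)|\le|z|$. $\delta_1$ is the Dirac mass at $1$. The multiplicative conditionally monotone convolution on $\mathcal{P}(\mathbb{T})\times\mathcal{P}(\mathbb{T})$ is $(\mu_1,\nu_1)\rhd_c(\mu_2,\nu_2)=(\mu,\nu)$, where $$\eta_\nu=\eta_{\nu_1}\circ\eta_{\nu_2},\qquad \eta_\mu(z)=\eta_{\mu_2}(z)\,h_{\mu_1}(\eta_{\nu_2}(z)),\quad h_{\mu_1}(w)=\eta_{\mu_1}(w)/w\ \ (h_{\mu_1}(0)=\eta_{\mu_1}'(0)).$$ The right component is the multiplicative monotone convolution $\nu_1\rhd\nu_2$. A weakly continuous $\rhd_c$-convolution semigroup is a family $\{(\mu_t,\nu_t)\}_{t\ge0}$ in $\mathcal{P}(\mathbb{T})^2$ with $(\mu_{s+t},\nu_{s+t})=(\mu_s,\nu_s)\rhd_c(\mu_t,\nu_t)$ for all $s,t\ge0$, such that $t\mapsto\mu_t$ and $t\mapsto\nu_t$ are weakly continuous. *)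

(* Defs.v *)
(* Complex numbers are R[i]
   (mathcomp-real-closed), viewed as a normed module over itself via R[i]^o
   for complex differentiation.  The unit circle T is the subset
   {(x,y) | x^2 + y^2 = 1} of R * R (whose product sigma-algebra is the Borel
   sigma-algebra of R^2); a Borel probability measure on T is a probability
   measure on R * R giving full mass to this circle. *)
From HB Require Import structures.
From mathcomp Require Import all_boot all_order all_algebra.
From mathcomp Require Import all_classical all_reals all_analysis.
From mathcomp Require Import complex.
Import Order.TTheory GRing.Theory Num.Theory.
Import numFieldNormedType.Exports.

Set Implicit Arguments.
Unset Strict Implicit.
Unset Printing Implicit Defensive.

Local Open Scope ring_scope.
Local Open Scope classical_set_scope.

Section CMC.
Variable R : realType.

Definition unitD (z : R[i]) : Prop := `|z| < 1.

Definition circleT : set (R * R)%type := [set p | p.1 ^+ 2 + p.2 ^+ 2 = 1].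

Definition pt (p : R * R) : R[i] := (p.1 +i* p.2)%C.

Definition cint (m : {measure set (R * R)%type -> \bar R}) (f : R * R -> R[i]) : R[i] :=
  ((Rintegral m circleT (fun p => complex.Re (f p)))%:C
   + 'i * (Rintegral m circleT (fun p => complex.Im (f p)))%:C)%C.

Definition onT (m : set (R * R)%type -> \bar R) : Prop :=
  m (~` circleT) = 0%E.

Definition PT := probability (R * R)%type R.

Definition psi (m : PT) (z : R[i]) : R[i] :=
  cint m (fun p => z * pt p / (1 - z * pt p)).

Definition eta (m : PT) (z : R[i]) : R[i] := psi m z / (1 + psi m z).

Definition hfun (m : PT) (w : R[i]) : R[i] :=
  if w == 0 then 'D_1 (eta m : R[i]^o -> R[i]^o) 0 else eta m w / w.

(* (mu, nu) = (mu1, nu1) |>_c (mu2, nu2), expressed through the eta-transforms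
   that define the convolution (eta determines the measure). *)
Definition cmc_conv (mu1 nu1 mu2 nu2 mu nu : PT) : Prop :=
  forall z, unitD z ->
    eta nu z = eta nu1 (eta nu2 z) /\
    eta mu z = eta mu2 z * hfun mu1 (eta nu2 z).

Definition weakly_continuous (m : R -> PT) : Prop :=
  forall f : R * R -> R, {within circleT, continuous f} ->
    {within [set t : R | 0 <= t],
       continuous (fun t => Rintegral (m t) circleT f)}.

Definition cmc_semigroup (mu nu : R -> PT) : Prop :=
  [/\ forall t, 0 <= t -> onT (mu t) /\ onT (nu t),
      forall s t, 0 <= s -> 0 <= t ->
        cmc_conv (mu s) (nu s) (mu t) (nu t) (mu (s + t)) (nu (s + t)),
      weakly_continuous mu & weakly_continuous nu].

Definition starts_at_delta1 (mu nu : R -> PT) : Prop :=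
  forall A, measurable A ->
    mu 0 A = @dirac _ (R * R)%type ((1 : R), (0 : R)) R A /\
    nu 0 A = @dirac _ (R * R)%type ((1 : R), (0 : R)) R A.

(* derivative of F : [0,+oo) -> C at t >= 0 (one-sided at t = 0) *)
Definition has_deriv_t (F : R -> R[i]) (t : R) (l : R[i]) : Prop :=
  ((fun h : R => ((F (t + h) - F t) / h%:C)%C : R[i]^o)
     @ within [set h : R | 0 <= t + h] (dnbhs (0 : R))) --> (l : R[i]^o).

Definition analytic_nonpos (B : R[i] -> R[i]) : Prop :=
  (forall z, unitD z -> derivable (B : R[i]^o -> R[i]^o) z 1) /\
  (forall z, unitD z -> complex.Re (B z) <= 0).

Definition cmc_ode (mu nu : R -> PT) (B1 B2 : R[i] -> R[i]) : Prop :=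
  forall t z, 0 <= t -> unitD z ->
    has_deriv_t (fun s => eta (mu s) z) t (eta (mu t) z * B1 (eta (nu t) z)) /\
    has_deriv_t (fun s => eta (nu s) z) t (eta (nu t) z * B2 (eta (nu t) z)).

Definition herglotz_rep (B : R[i] -> R[i]) (gamma : R)
    (tau : {finite_measure set (R * R)%type -> \bar R}) : Prop :=
  onT tau /\
  forall z, unitD z ->
    B z = ('i * gamma%:C + cint tau (fun p => (z + pt p) / (z - pt p)))%C.

End CMC.

(* Main.v *)
(* Write [eta_mu(z) = z h_mu(z)] with [h_mu] analytic and [|h_mu| <= 1].  A semigroup is a
   family with [phi_(s+t) = phi_s o phi_t] for [phi_t = eta_(nu_t)], together with the cocycle
   [h_(s+t)(z) = h_t(z) h_s(phi_t(z))].

   From the semigroup to the equation: the quotients [(h_s - 1) / s] have nonpositive real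
   part and are bounded at the origin, so along [s = t0 / n] they subconverge locally
   uniformly to some [B]; telescoping the cocycle over [n] steps gives
   [h_t(z) = exp (int_0^t B(phi_r(z)) dr)].  The right component is the special case
   [mu = nu].

   Conversely, [phi_t(z) = z exp (int_0^t B2(phi_r(z)) dr)] is solved by Picard iteration.
   Every iterate is a self-map of the disc bounded by [|z|], being a limit of Riemann
   products, hence an eta-transform, and so is its limit.  Weak continuity follows from
   that of the eta-transforms by approximating a continuous function on the circle by
   discrete Poisson sums.

   Compactness and the integral representation rest on the Schwarz formula on the [n]-th
   roots of unity, obtained from Goursat's lemma in logarithmic coordinates.  The measures
   are images of the uniform law on [0, 1] under monotone quantile functions [Q], so that
   Helly's selection becomes a pointwise ultrafilter limit of the [Q]s. *)
Require Import Defs.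
From HB Require Import structures.
From mathcomp Require Import all_boot all_order all_algebra.
From mathcomp Require Import all_classical all_reals all_analysis.
From mathcomp Require Import measurable_realfun complex ring lra.
Import Order.TTheory GRing.Theory Num.Theory.
Import numFieldNormedType.Exports.
Local Open Scope ring_scope.
Local Open Scope classical_set_scope.
Import ComplexField.Normc.

Set Implicit Arguments.
Unset Strict Implicit.
Unset Printing Implicit Defensive.

(** * Complex numbers and limits *)

(** The hub is the class [HQ] of functions with a Herglotz representation. Analytic functions with
    nonpositive real part enter it through the Schwarz formula; differentiability, Lipschitz bounds
    on smaller discs, compactness and closure under pointwise limits are all read off the
    representing kernel. The Cayley transform [- (1 + f) / (1 - f)] carries eta-transforms into this
    class, and turns its closure under limits into that of eta-transforms.

    The other lever is that every [phi_t] keeps the disc of radius [|z|] invariant. Along an orbit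
    one Lipschitz constant of the generator serves for all times, and the factors [h_s] and the
    exponentials all have modulus at most 1, so the errors of the telescoped cocycle add up without
    amplification. The comparison is made with a single cluster point [B], the same for all [t] and
    [z]. *)

Section ComplexNorm.
Variable R : realType.
Local Notation C := R[i].
Local Notation cRe := (@complex.Re R).
Local Notation cIm := (@complex.Im R).
Implicit Types (z w : C) (x y : R).

Lemma cReD z w : cRe (z + w) = cRe z + cRe w. Proof. by case: z w => a b [c d]. Qed.
Lemma cImD z w : cIm (z + w) = cIm z + cIm w. Proof. by case: z w => a b [c d]. Qed.
Lemma cReN z : cRe (- z) = - cRe z. Proof. by case: z. Qed.
Lemma cImN z : cIm (- z) = - cIm z. Proof. by case: z. Qed.
Lemma cReM z w : cRe (z * w) = cRe z * cRe w - cIm z * cIm w.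
Proof. by case: z w => a b [c d]. Qed.
Lemma cImM z w : cIm (z * w) = cRe z * cIm w + cIm z * cRe w.
Proof. by case: z w => a b [c d]. Qed.

Definition cReIm := (cReD, cImD, cReN, cImN, cReM, cImM).

Lemma complex_ext z w : cRe z = cRe w -> cIm z = cIm w -> z = w.
Proof. by case: z w => a b [c d] /= -> ->. Qed.

Lemma realCD x y : ((x + y)%:C = x%:C + y%:C)%C. Proof. exact: rmorphD. Qed.
Lemma realCM x y : ((x * y)%:C = x%:C * y%:C)%C. Proof. exact: rmorphM. Qed.
Lemma realCN x : ((- x)%:C = - x%:C)%C. Proof. exact: rmorphN. Qed.
Lemma realCB x y : ((x - y)%:C = x%:C - y%:C)%C. Proof. exact: rmorphB. Qed.
Lemma realC_eq0 x : (x%:C == 0)%C = (x == 0).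
Proof. exact: fmorph_eq0. Qed.

Lemma normc_ge0 z : 0 <= normc z.
Proof. by case: z => a b; exact: sqrtr_ge0. Qed.

Lemma sqr_normcE z : normc z ^+ 2 = cRe z ^+ 2 + cIm z ^+ 2.
Proof. by case: z => a b /=; rewrite sqr_sqrtr// addr_ge0// sqr_ge0. Qed.

Lemma normc_le z x : 0 <= x -> cRe z ^+ 2 + cIm z ^+ 2 <= x ^+ 2 -> normc z <= x.
Proof. by move=> x0; rewrite -sqr_normcE ler_pXn2r// ?nnegrE// normc_ge0. Qed.

Lemma normcD z w : normc (z + w) <= normc z + normc w.
Proof. exact: (@le_normcD R z w). Qed.

Lemma oppc_normc z : normc (- z) = normc z.
Proof. exact: (@normcN R z). Qed.

Lemma normcB z w : normc (z - w) <= normc z + normc w.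
Proof. by rewrite -(oppc_normc w); exact: normcD. Qed.

Lemma distcC z w : normc (z - w) = normc (w - z).
Proof. by rewrite -oppc_normc opprB. Qed.

Lemma distc_tri w z v : normc (z - v) <= normc (z - w) + normc (w - v).
Proof. by rewrite (_ : z - v = (z - w) + (w - v)); [exact: normcD|ring]. Qed.

Lemma normc_real x : normc (x%:C)%C = `|x|.
Proof. by rewrite /= expr0n/= addr0 sqrtr_sqr. Qed.

Lemma normc_eq0 z : (normc z == 0) = (z == 0).
Proof.
apply/eqP/eqP => [/eq0_normc//|->].
by rewrite /= expr0n/= addr0 sqrtr0.
Qed.

Lemma normc0E : normc (0 : C) = 0. Proof. by apply/eqP; rewrite normc_eq0. Qed.
Lemma normc1E : normc (1 : C) = 1. Proof. by rewrite -[1]/((1 : R)%:C)%C normc_real normr1. Qed.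
Lemma normci : normc ('i%C : C) = 1. Proof. by rewrite /= expr0n/= add0r expr1n sqrtr1. Qed.

Lemma normc_gt0 z : (0 < normc z) = (z != 0).
Proof. by rewrite lt_def normc_ge0 andbT normc_eq0. Qed.

Lemma normcX z n : normc (z ^+ n) = normc z ^+ n.
Proof. by elim: n => [|n IH]; rewrite ?expr0 ?normc1E// !exprS normcM IH. Qed.

Lemma Re_le_normc z : `|cRe z| <= normc z.
Proof.
rewrite -(@ler_pXn2r _ 2)// ?nnegrE ?normc_ge0//.
by rewrite sqr_normcE real_normK ?num_real// lerDl sqr_ge0.
Qed.

Lemma Im_le_normc z : `|cIm z| <= normc z.
Proof.
rewrite -(@ler_pXn2r _ 2)// ?nnegrE ?normc_ge0//.
by rewrite sqr_normcE real_normK ?num_real// lerDr sqr_ge0.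
Qed.

Lemma Re_leD_normc z w : cRe z <= cRe w + normc (z - w).
Proof.
have := Re_le_normc (z - w); rewrite !cReIm => h.
by have := le_trans (ler_norm _) h; lra.
Qed.

Lemma normc_le_ReIm z : normc z <= `|cRe z| + `|cIm z|.
Proof.
apply: normc_le; first by rewrite addr_ge0.
rewrite -(real_normK (num_real (cRe z))) -(real_normK (num_real (cIm z))).
have := normr_ge0 (cRe z); have := normr_ge0 (cIm z).
move: `|cRe z| `|cIm z| => a b; nra.
Qed.

Lemma normc_conj z : normc (z^*)%C = normc z.
Proof. by case: z => a b /=; rewrite sqrrN. Qed.

Lemma normc_sum (I : Type) (r : seq I) (P : pred I) (f : I -> C) :
  normc (\sum_(i <- r | P i) f i) <= \sum_(i <- r | P i) normc (f i).
Proof.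
elim/big_ind2: _ => [|a b c d h1 h2|i _]; first by rewrite normc0E.
  by apply: le_trans (normcD _ _) _; exact: lerD.
by [].
Qed.

Lemma Re_sum (I : Type) (r : seq I) (P : pred I) (f : I -> C) :
  cRe (\sum_(i <- r | P i) f i) = \sum_(i <- r | P i) cRe (f i).
Proof. by elim/big_rec2: _ => // i a b _ <-; rewrite cReD. Qed.

Lemma realC_sum (I : Type) (r : seq I) (P : pred I) (f : I -> R) :
  ((\sum_(i <- r | P i) f i)%:C = \sum_(i <- r | P i) (f i)%:C)%C.
Proof. exact: rmorph_sum. Qed.

Lemma unitDE z : unitD z <-> normc z < 1.
Proof. by rewrite /unitD -[1]/((1 : R)%:C)%C -[`|z|]/((normc z)%:C)%C ltcR. Qed.

Lemma subc_neq0 z w : normc z < normc w -> w - z != 0.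
Proof. by move=> h; rewrite subr_eq0; apply: contraTneq h => ->; rewrite ltxx. Qed.

Lemma eq_of_small z w : (forall e, 0 < e -> normc (z - w) <= e) -> z = w.
Proof.
move=> h; apply/eqP; rewrite -subr_eq0 -normc_eq0; apply/eqP/le_anti.
rewrite normc_ge0 andbT; apply/ler_addgt0Pr => e e0; rewrite add0r; exact: h.
Qed.

End ComplexNorm.

(** * Limits along filters, with real tolerances *)

Section Convergence.
Variable R : realType.
Local Notation C := R[i].

(** The norm of [R[i]] takes its values in [R[i]], so the ambient topology has complex radii; here
    tolerances are real. *)
Definition ccvg (T : Type) (F : set_system T) (f : T -> C) (l : C) : Prop :=
  forall e : R, 0 < e -> F (fun x => normc (f x - l) <= e).

Section Rules.
Variables (T : Type) (F : set_system T).
Context {FF : Filter F}.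
Implicit Types f g : T -> C.

Lemma ccvg_cst (c : C) : ccvg F (fun=> c) c.
Proof. by move=> e e0; apply: filterE => x; rewrite subrr normc0E ltW. Qed.

Lemma ccvg_near f g l : F (fun x => f x = g x) -> ccvg F f l -> ccvg F g l.
Proof. by move=> fg fl e /fl; apply: filterS2 fg => x ->. Qed.

Lemma ccvg_ext f g l : (forall x, f x = g x) -> ccvg F f l -> ccvg F g l.
Proof. by move=> fg; apply: ccvg_near; exact: filterE. Qed.

Lemma ccvgD f g l m : ccvg F f l -> ccvg F g m -> ccvg F (fun x => f x + g x) (l + m).
Proof.
move=> fl gm e e0; have e20 : 0 < e / 2 by rewrite divr_gt0.
apply: filterS2 (fl _ e20) (gm _ e20) => x h1 h2.
rewrite (_ : _ - _ = (f x - l) + (g x - m)); last by ring.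
by apply: le_trans (normcD _ _) _; lra.
Qed.

Lemma ccvg_bounded f l : ccvg F f l -> F (fun x => normc (f x) <= normc l + 1).
Proof.
move=> /(_ 1 ltr01); apply: filterS => x h.
by have := normcD (f x - l) l; rewrite subrK; lra.
Qed.

Lemma ccvgM f g l m : ccvg F f l -> ccvg F g m -> ccvg F (fun x => f x * g x) (l * m).
Proof.
move=> fl gm e e0.
pose K := normc l + 1 + normc m.
have K0 : 0 < K by rewrite /K; have := normc_ge0 l; have := normc_ge0 m; lra.
have ek : 0 < e / (2 * K) by rewrite divr_gt0// mulr_gt0.
apply: filterS3 (fl _ ek) (gm _ ek) (ccvg_bounded fl) => x h1 h2 h3.
rewrite (_ : _ - _ = f x * (g x - m) + (f x - l) * m); last by ring.
apply: le_trans (normcD _ _) _; rewrite !normcM.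
have h4 : normc (f x) * normc (g x - m) <= K * (e / (2 * K)).
  apply: ler_pM; rewrite ?normc_ge0//; apply: le_trans h3 _.
  by rewrite /K; have := normc_ge0 m; lra.
have h5 : normc (f x - l) * normc m <= (e / (2 * K)) * K.
  apply: ler_pM; rewrite ?normc_ge0//.
  by rewrite /K; have := normc_ge0 l; lra.
have : K * (e / (2 * K)) = e / 2 by field; lra.
by rewrite mulrC in h5; lra.
Qed.

Lemma ccvgN f l : ccvg F f l -> ccvg F (fun x => - f x) (- l).
Proof. by move=> fl e /fl; apply: filterS => x; rewrite -opprD oppc_normc. Qed.

Lemma ccvgB f g l m : ccvg F f l -> ccvg F g m -> ccvg F (fun x => f x - g x) (l - m).
Proof. by move=> fl gm; apply: ccvgD => //; exact: ccvgN. Qed.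

Lemma ccvg_away f l : ccvg F f l -> l != 0 ->
  F (fun x => normc l / 2 <= normc (f x)).
Proof.
move=> fl l0; have l20 : 0 < normc l / 2 by rewrite divr_gt0// normc_gt0.
apply: filterS (fl _ l20) => x h.
by have := normcB (f x) (f x - l); rewrite (_ : _ - (f x - l) = l); [lra|ring].
Qed.

Lemma ccvgV f l : l != 0 -> ccvg F f l -> ccvg F (fun x => (f x)^-1) l^-1.
Proof.
move=> l0 fl e e0; have l1 : 0 < normc l by rewrite normc_gt0.
have ek : 0 < e * (normc l ^+ 2 / 2) by rewrite mulr_gt0// divr_gt0// exprn_gt0.
apply: filterS2 (fl _ ek) (ccvg_away fl l0) => x h1 h2.
have fx1 : 0 < normc (f x) by lra.
have fx0 : f x != 0 by rewrite -normc_gt0.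
rewrite (_ : _ - _ = (l - f x) / (f x * l)); last by field; rewrite ?fx0 ?l0.
rewrite normcM normcV normcM distcC ler_pdivrMr ?mulr_gt0//.
apply: (le_trans h1); rewrite ler_pM2l//; nra.
Qed.

Lemma ccvg_sum (I : Type) (r : seq I) (f : I -> T -> C) (l : I -> C) :
  (forall i, ccvg F (f i) (l i)) ->
  ccvg F (fun x => \sum_(i <- r) f i x) (\sum_(i <- r) l i).
Proof.
move=> h; elim: r => [|i r IH].
  by rewrite big_nil; apply: ccvg_ext (ccvg_cst 0) => x; rewrite big_nil.
rewrite big_cons; apply: ccvg_ext (ccvgD (h i) IH) => x.
by rewrite big_cons.
Qed.

Lemma ccvg_conj f l : ccvg F f l -> ccvg F (fun x => (f x)^*%C) (l^*)%C.
Proof. by move=> fl e /fl; apply: filterS => x; rewrite -rmorphB normc_conj. Qed.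

Lemma ccvg_ReC f l : ccvg F f l -> ccvg F (fun x => (complex.Re (f x))%:C%C) ((complex.Re l)%:C)%C.
Proof.
move=> fl e /fl; apply: filterS => x h; apply: le_trans h.
by rewrite -realCB normc_real (_ : _ - _ = complex.Re (f x - l)) ?Re_le_normc// !cReIm.
Qed.

End Rules.

Lemma ccvg_unique (T : Type) (F : set_system T) {FF : ProperFilter F} (f : T -> C) l m :
  ccvg F f l -> ccvg F f m -> l = m.
Proof.
move=> fl fm; apply: eq_of_small => e e0; have e20 : 0 < e / 2 by rewrite divr_gt0.
have [x [h1 h2]] := filter_ex (filterI (fl _ e20) (fm _ e20)).
by apply: le_trans (distc_tri (f x) _ _) _; rewrite distcC; lra.
Qed.

Definition cnbhs (z : C) : set_system C :=
  fun A => exists2 d : R, 0 < d & forall w, normc (w - z) < d -> A w.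

#[global] Instance cnbhs_filter z : ProperFilter (cnbhs z).
Proof.
apply: Build_ProperFilter.
  by move=> [d d0 h]; apply: (h z); rewrite subrr normc0E.
split; first by exists 1.
- move=> A B [d d0 hA] [d' d'0 hB]; exists (Num.min d d'); first by rewrite lt_min d0.
  by move=> w; rewrite lt_min => /andP[w1 w2]; split; [exact: hA|exact: hB].
- by move=> A B AB [d d0 hA]; exists d => // w /hA /AB.
Qed.

Lemma ccvg_id z : ccvg (cnbhs z) id z.
Proof. by move=> e e0; exists e => // w /ltW. Qed.

Lemma cnbhs_ltnormc z (r : R) : normc z < r -> cnbhs z (fun w => normc w < r).
Proof.
move=> zr; exists (r - normc z); first by rewrite subr_gt0.
by move=> w; have := normcD (w - z) z; rewrite subrK; lra.
Qed.

Lemma ccvg_comp (T : Type) (F : set_system T) {FF : Filter F} (f : T -> C) z (A : set C) :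
  ccvg F f z -> cnbhs z A -> F (fun x => A (f x)).
Proof.
move=> fz [d d0 hA]; have d20 : 0 < d / 2 by rewrite divr_gt0.
by apply: filterS (fz _ d20) => x h; apply: hA; lra.
Qed.

Lemma ccvg_circ (T : Type) (F : set_system T) {FF : Filter F} (f : T -> C) (g : C -> C) z l :
  ccvg F f z -> ccvg (cnbhs z) g l -> ccvg F (fun x => g (f x)) l.
Proof. by move=> fz gl e /gl; exact: ccvg_comp. Qed.

End Convergence.

(** * Derivatives *)

Section Derivative.
Variable R : realType.
Local Notation C := R[i].

(** Derivative along a filter [F] of a function of a variable in [T], measured
    through an embedding [i] of [T] in the complex plane: [T] is the real line or
    the complex plane itself. *)
Definition gder (T : Type) (i : T -> C) (F : set_system T) (f : T -> C) (x : T) (l : C) :=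
  forall e : R, 0 < e ->
    F (fun y => normc (f y - f x - l * (i y - i x)) <= e * normc (i y - i x)).

Section Rules.
Variables (T : Type) (i : T -> C) (F : set_system T) (x : T).
Context {FF : Filter F}.
Hypothesis icvg : ccvg F i (i x).
Implicit Types f g : T -> C.

(** Caratheodory's form: the increment of [f] is a slope [q] times the increment of the variable,
    with [q] converging to the derivative. The rules for products, inverses and composites then
    become limits of slopes. *)
Lemma gderP f l : gder i F f x l <->
  exists2 q, ccvg F q l & F (fun y => f y - f x = q y * (i y - i x)).
Proof.
split=> [h|[q ql qE] e e0]; last first.
  apply: filterS2 qE (ql _ e0) => y -> h.
  by rewrite -mulrBl normcM ler_wpM2r// normc_ge0.
exists (fun y => if i y == i x then l else (f y - f x) / (i y - i x)).
  move=> e e0; apply: filterS (h _ e0) => y hy; case: eqP => [_|/eqP iyx].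
    by rewrite subrr normc0E ltW.
  have iyx0 : i y - i x != 0 by rewrite subr_eq0.
  rewrite -(ler_pM2r (x := normc (i y - i x))) ?normc_gt0// -normcM.
  by rewrite mulrBl divfK.
apply: filterS (h _ ltr01) => y hy; case: eqP => [E|/eqP iyx].
  move: hy; rewrite E subrr normc0E !mulr0 subr0 => hy.
  by apply/eqP; rewrite -normc_eq0 eq_le hy normc_ge0.
by rewrite divfK// subr_eq0.
Qed.

Lemma gder_cvg f l : gder i F f x l -> ccvg F f (f x).
Proof.
move=> /gderP[q ql qE].
have h : ccvg F (fun y => q y * (i y - i x) + f x) (l * (i x - i x) + f x).
  apply: ccvgD; last exact: ccvg_cst.
  by apply: ccvgM => //; apply: ccvgB => //; exact: ccvg_cst.
move: h; rewrite subrr mulr0 add0r; apply: ccvg_near.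
by apply: filterS qE => y <-; exact: subrK.
Qed.

Lemma gder_ext f g l : f x = g x -> F (fun y => f y = g y) -> gder i F f x l -> gder i F g x l.
Proof. by move=> fgx fg fl e /fl; apply: filterS2 fg => y ->; rewrite fgx. Qed.

Lemma gder_id : gder i F i x 1.
Proof. by move=> e e0; apply: filterE => y; rewrite mul1r subrr normc0E mulr_ge0 ?normc_ge0// ltW. Qed.

Lemma gder_cst c : gder i F (fun=> c) x 0.
Proof.
by move=> e e0; apply: filterE => y; rewrite mul0r !subrr normc0E mulr_ge0 ?normc_ge0// ltW.
Qed.

Lemma gderD f g l m : gder i F f x l -> gder i F g x m ->
  gder i F (fun y => f y + g y) x (l + m).
Proof.
move=> /gderP[q ql qE] /gderP[p pm pE]; apply/gderP.
exists (fun y => q y + p y); first exact: ccvgD.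
by apply: filterS2 qE pE => y h1 h2; rewrite mulrDl -h1 -h2; ring.
Qed.

Lemma gderM f g l m : gder i F f x l -> gder i F g x m ->
  gder i F (fun y => f y * g y) x (l * g x + f x * m).
Proof.
move=> fl gm; have gc := gder_cvg gm.
move: fl gm => /gderP[q ql qE] /gderP[p pm pE]; apply/gderP.
exists (fun y => q y * g y + f x * p y).
  by apply: ccvgD; apply: ccvgM => //; exact: ccvg_cst.
apply: filterS2 qE pE => y h1 h2.
rewrite (_ : _ - _ = (f y - f x) * g y + f x * (g y - g x)); last by ring.
by rewrite h1 h2; ring.
Qed.

Lemma gderZ c f l : gder i F f x l -> gder i F (fun y => c * f y) x (c * l).
Proof.
move=> fl; rewrite (_ : c * l = 0 * f x + c * l); last by rewrite mul0r add0r.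
by apply: gderM => //; exact: gder_cst.
Qed.

Lemma gderN f l : gder i F f x l -> gder i F (fun y => - f y) x (- l).
Proof.
move=> /(gderZ (-1)); rewrite mulN1r; apply: gder_ext; first by rewrite mulN1r.
by apply: filterE => y; rewrite mulN1r.
Qed.

Lemma gderB f g l m : gder i F f x l -> gder i F g x m ->
  gder i F (fun y => f y - g y) x (l - m).
Proof. by move=> fl gm; apply: gderD => //; exact: gderN. Qed.

Lemma gder_sum (I : Type) (r : seq I) (f : I -> T -> C) (l : I -> C) :
  (forall k, gder i F (f k) x (l k)) ->
  gder i F (fun y => \sum_(k <- r) f k y) x (\sum_(k <- r) l k).
Proof.
move=> h; elim: r => [|k r IH].
  rewrite big_nil; apply: gder_ext (gder_cst 0); first by rewrite big_nil.
  by apply: filterE => y; rewrite big_nil.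
rewrite big_cons; apply: gder_ext (gderD (h k) IH); first by rewrite big_cons.
by apply: filterE => y; rewrite big_cons.
Qed.

Lemma gderV f l : f x != 0 -> gder i F f x l ->
  gder i F (fun y => (f y)^-1) x (- l / f x ^+ 2).
Proof.
move=> fx0 fl; have fc := gder_cvg fl.
move: fl => /gderP[q ql qE]; apply/gderP.
exists (fun y => - q y * ((f y)^-1 * (f x)^-1)).
  rewrite expr2 invfM; apply: ccvgM; first exact: ccvgN.
  by apply: ccvgM; [exact: ccvgV|exact: ccvg_cst].
apply: filterS2 qE (ccvg_away fc fx0) => y h1 h2.
have fy0 : f y != 0.
  by rewrite -normc_gt0; apply: lt_le_trans h2; rewrite divr_gt0// normc_gt0.
rewrite (_ : _ - _ = - (f y - f x) * ((f y)^-1 * (f x)^-1)); last first.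
  by field; rewrite ?fx0 ?fy0.
by rewrite h1; ring.
Qed.

Lemma gder_comp (g : C -> C) f l m : gder i F f x l ->
  gder id (cnbhs (f x)) g (f x) m -> gder i F (fun y => g (f y)) x (m * l).
Proof.
move=> fl gm; have fc := gder_cvg fl.
move: fl => /gderP[q ql qE]; apply/gderP.
have [p pm pE] : exists2 p, ccvg (cnbhs (f x)) p m &
    cnbhs (f x) (fun w => g w - g (f x) = p w * (w - f x)).
  have ic : ccvg (cnbhs (f x)) id (f x) by exact: ccvg_id.
  move: gm => h.
  (* Giving the slope of [g] the value [m] at [f x] covers the points [y] with [f y = f x]. *)
  exists (fun w => if w == f x then m else (g w - g (f x)) / (w - f x)).
    move=> e e0; apply: filterS (h _ e0) => y hy; case: eqP => [_|/eqP iyx].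
      by rewrite subrr normc0E ltW.
    have iyx0 : y - f x != 0 by rewrite subr_eq0.
    rewrite -(ler_pM2r (x := normc (y - f x))) ?normc_gt0// -normcM.
    by rewrite mulrBl divfK.
  by apply: filterE => y; case: eqP => [->|/eqP E]; rewrite ?subrr ?mulr0// divfK// subr_eq0.
exists (fun y => p (f y) * q y); first by apply: ccvgM => //; exact: ccvg_circ pm.
apply: filterS2 qE (ccvg_comp fc pE) => y h1 ->.
by rewrite h1 mulrA.
Qed.

End Rules.

Definition rder (f : R -> C) (x : R) (l : C) := gder (real_complex R) (nbhs x) f x l.
Definition cder (f : C -> C) (z l : C) := gder id (cnbhs z) f z l.

Lemma nbhsRP (x : R) (A : set R) :
  nbhs x A <-> exists2 d : R, 0 < d & forall y, `|y - x| < d -> A y.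
Proof.
split=> [/nbhs_ballP[d d0 h]|[d d0 h]].
  by exists d => // y yx; apply: h; rewrite /ball/= distrC.
by apply/nbhs_ballP; exists d => // y; rewrite /ball/= distrC; exact: h.
Qed.

Lemma realC_cvg (x : R) : ccvg (nbhs x) (real_complex R) (x%:C)%C.
Proof.
move=> e e0; apply/nbhsRP; exists e => // y.
by rewrite -realCB normc_real => /ltW.
Qed.

Lemma cvgRP (T : Type) (F : set_system T) {FF : Filter F} (f : T -> R) (l : R) :
  f @ F --> l <-> forall e, 0 < e -> F (fun x => `|f x - l| <= e).
Proof.
rewrite cvgrPdist_le; split=> h e /h; apply: filterS => x; by rewrite distrC.
Qed.

Lemma derivable_eps (K : numFieldType) (f : K^o -> K^o) z : derivable f z 1 ->
  forall e, 0 < e -> \forall h \near 0^', `|(f (h + z) - f z) / h - 'D_1 f z| <= e.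
Proof.
move=> df e e0; have /cvgrPdist_le/(_ _ e0) := df.
apply: filterS => h; rewrite distrC mulrC /= [h *: 1]mulr1; exact.
Qed.

Lemma rder_real (f : R -> R) (x l : R) : is_derive x 1 f l -> rder (fun y => (f y)%:C)%C x (l%:C)%C.
Proof.
move=> dfx e e0; have df := @ex_derive _ _ _ _ _ _ _ dfx.
have := @derivable_eps R f x df e e0.
rewrite (_ : 'D_1 f x = l); last exact: derive_val.
rewrite /dnbhs /within /= => /nbhsRP[d d0 h].
apply/nbhsRP; exists d => // y yx.
suff : `|f y - f x - l * (y - x)| <= e * `|y - x|.
  by rewrite -!normc_real !(realCB, realCM).
have [->|yx0] := eqVneq y x; first by rewrite !subrr mulr0 subrr normr0 mulr0.
have := h (y - x); rewrite subr0 subrK => /(_ yx); rewrite subr_eq0 => /(_ yx0).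
rewrite -(ler_pM2r (x := `|y - x|)) ?normr_gt0 ?subr_eq0// -normrM mulrBl divfK//.
by rewrite subr_eq0.
Qed.

Lemma cder_cvg f z l : cder f z l -> ccvg (cnbhs z) f (f z).
Proof. exact: (gder_cvg (ccvg_id _)). Qed.

Lemma rder_cvg f x l : rder f x l -> ccvg (nbhs x) f (f x).
Proof. exact: (gder_cvg (realC_cvg _)). Qed.

Lemma derivable_cder f z : derivable (f : C^o -> C^o) z 1 ->
  cder f z ('D_1 (f : C^o -> C^o) z).
Proof.
move=> df e e0.
have ec0 : 0 < (e%:C)%C by rewrite ltcR.
have := @derivable_eps _ f z df _ ec0.
rewrite /dnbhs /within /= => /nbhs_ballP[d d0 h].
(* A positive element of [R[i]] has zero imaginary part, so the radius is real. *)
have [dR0 dE] : 0 < complex.Re d /\ d = ((complex.Re d)%:C)%C.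
  move: d0; rewrite /= ltcE /= => /andP[/eqP d1 d2]; split => //.
  by apply: complex_ext.
exists (complex.Re d) => // w wz.
have [->|wz0] := eqVneq w z; first by rewrite !subrr mulr0 subrr normc0E mulr0.
have := h (w - z); rewrite /ball/= sub0r normrN subrK.
rewrite -[`|w - z|]/((normc (w - z))%:C)%C dE ltcR => /(_ wz).
rewrite subr_eq0 => /(_ wz0).
rewrite -[`|_|]/((normc _)%:C)%C lecR.
rewrite -(ler_pM2r (x := normc (w - z))) ?normc_gt0 ?subr_eq0// -normcM mulrBl divfK//.
by rewrite subr_eq0.
Qed.

Lemma cder_derivable f z l : cder f z l ->
  derivable (f : C^o -> C^o) z 1 /\ 'D_1 (f : C^o -> C^o) z = l.
Proof.
move=> dfz.
have cv : h^-1 *: ((f \o shift z) (h *: (1 : C^o)) - f z) @[h --> (0 : C^o)^'] --> (l : C^o).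
  apply: (iffRL (@cvgrPdist_le C C^o _ _ _ _ _)) => e e0.
  have [eR0 eE] : 0 < complex.Re e /\ e = ((complex.Re e)%:C)%C.
    move: e0; rewrite ltcE /= => /andP[/eqP d1 d2]; split => //.
    by apply: complex_ext.
  have [d d0 h] := dfz _ eR0.
  rewrite /dnbhs /within /=; apply/nbhs_ballP; exists (d%:C)%C; first by rewrite /= ltcR.
  move=> w; rewrite /ball/= sub0r normrN.
  rewrite -[`|w|]/((normc w)%:C)%C ltcR => wd w0.
  have := h (w + z); rewrite addrK => /(_ wd).
  rewrite eE -[`|_|]/((normc _)%:C)%C lecR.
  rewrite [w *: 1]mulr1 [_ *: _]mulrC distcC => hw.
  rewrite -(ler_pM2r (x := normc w)) ?normc_gt0// -normcM mulrBl.
  by rewrite divfK// (mulrC l).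
split; first by apply/cvg_ex; exists l.
by apply: (@cvg_lim C^o _ _ _ _ _ l) cv; exact: norm_hausdorff.
Qed.

Lemma rder_id x : rder (real_complex R) x 1. Proof. exact: gder_id. Qed.
Lemma rder_cst c x : rder (fun=> c) x 0. Proof. exact: gder_cst. Qed.
Lemma rderD f g x l m : rder f x l -> rder g x m -> rder (fun y => f y + g y) x (l + m).
Proof. exact: gderD. Qed.
Lemma rderB f g x l m : rder f x l -> rder g x m -> rder (fun y => f y - g y) x (l - m).
Proof. exact: (gderB (realC_cvg _)). Qed.
Lemma rderZ c f x l : rder f x l -> rder (fun y => c * f y) x (c * l).
Proof. exact: (gderZ (realC_cvg _)). Qed.
Lemma rder_comp g f x l m : rder f x l -> cder g (f x) m ->
  rder (fun y => g (f y)) x (m * l).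
Proof. exact: (gder_comp (realC_cvg _)). Qed.

Lemma cder_id z : cder id z 1. Proof. exact: gder_id. Qed.
Lemma cder_cst c z : cder (fun=> c) z 0. Proof. exact: gder_cst. Qed.
Lemma cderD f g z l m : cder f z l -> cder g z m -> cder (fun y => f y + g y) z (l + m).
Proof. exact: gderD. Qed.
Lemma cderB f g z l m : cder f z l -> cder g z m -> cder (fun y => f y - g y) z (l - m).
Proof. exact: (gderB (ccvg_id _)). Qed.
Lemma cderM f g z l m : cder f z l -> cder g z m ->
  cder (fun y => f y * g y) z (l * g z + f z * m).
Proof. exact: (gderM (ccvg_id _)). Qed.
Lemma cderZ c f z l : cder f z l -> cder (fun y => c * f y) z (c * l).
Proof. exact: (gderZ (ccvg_id _)). Qed.
Lemma cderV f z l : f z != 0 -> cder f z l -> cder (fun y => (f y)^-1) z (- l / f z ^+ 2).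
Proof. exact: (gderV (ccvg_id _)). Qed.
Lemma cder_comp g f z l m : cder f z l -> cder g (f z) m ->
  cder (fun y => g (f y)) z (m * l).
Proof. exact: (gder_comp (ccvg_id _)). Qed.
Lemma cder_sum (I : Type) (r : seq I) (f : I -> C -> C) z (l : I -> C) :
  (forall k, cder (f k) z (l k)) ->
  cder (fun y => \sum_(k <- r) f k y) z (\sum_(k <- r) l k).
Proof. exact: gder_sum. Qed.

Definition cdiff (f : C -> C) (z : C) := exists l, cder f z l.

End Derivative.

(** * Compactness and the mean value inequality *)

Section Boxes.
Variable R : realType.
Local Notation C := R[i].

Lemma exists_pow2_gt (M : R) : exists n : nat, M < 2 ^+ n.
Proof.
exists (Num.bound `|M|); apply: (@lt_trans _ _ (Num.bound `|M|)%:R).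
  by apply: le_lt_trans (ler_norm M) _; exact: archi_boundP.
by rewrite -natrX ltr_nat ltn_expl.
Qed.

Lemma halving_lt (D e : R) : 0 < e -> exists n : nat, D / 2 ^+ n < e.
Proof.
move=> e0; have [n hn] := exists_pow2_gt (D / e); exists n.
by rewrite ltr_pdivrMr ?exprn_gt0// mulrC -ltr_pdivrMr.
Qed.

Definition is_box (x0 x1 y0 y1 : R) (s : R * R * (R * R)) :=
  [/\ x0 <= s.1.1, s.1.1 <= s.1.2, s.1.2 <= x1, y0 <= s.2.1 & s.2.1 <= s.2.2 /\ s.2.2 <= y1].

(** Compactness of a rectangle as a bisection principle: if [P] failed on the whole, it would fail
    on a nested sequence of quarters, which shrink to a point where the local hypothesis applies.
    Goursat's lemma, Heine-Cantor, boundedness and the mean value inequality are all instances. *)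
Lemma box_induction (P : R -> R -> R -> R -> Prop) x0 x1 y0 y1 :
  x0 <= x1 -> y0 <= y1 ->
  (forall a b c d, is_box x0 x1 y0 y1 ((a, b), (c, d)) ->
     let m := (a + b) / 2 in let n := (c + d) / 2 in
     P a m c n -> P m b c n -> P a m n d -> P m b n d -> P a b c d) ->
  (forall x y, x0 <= x <= x1 -> y0 <= y <= y1 -> exists2 e, 0 < e &
     forall a b c d, is_box x0 x1 y0 y1 ((a, b), (c, d)) ->
       a <= x <= b -> c <= y <= d -> b - a < e -> d - c < e -> P a b c d) ->
  P x0 x1 y0 y1.
Proof.
move=> x01 y01 comb loc; apply: contrapT => nP.
(* The [good] boxes are those on which [P] fails. *)
pose good (s : R * R * (R * R)) := is_box x0 x1 y0 y1 s /\ ~ P s.1.1 s.1.2 s.2.1 s.2.2.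
pose next (s s' : R * R * (R * R)) := good s ->
  [/\ good s', s.1.1 <= s'.1.1 /\ s'.1.2 <= s.1.2,
      s.2.1 <= s'.2.1 /\ s'.2.2 <= s.2.2,
      s'.1.2 - s'.1.1 = (s.1.2 - s.1.1) / 2 &
      s'.2.2 - s'.2.1 = (s.2.2 - s.2.1) / 2].
have [f hf] : {f & forall s, next s (f s)}.
  apply: choice => -[[a b] [c d]]; rewrite /next.
  have [[bs nPs]|ng] := pselect (good (a, b, (c, d))); last by exists (a, b, (c, d)).
  rewrite /good /is_box /= in bs nPs *; case: bs => h1 h2 h3 h4 [h5 h6].
  have := comb a b c d; rewrite /is_box /= => hc.
  apply: contrapT => /forallNP hn; apply: nPs; apply: hc => //.
  - apply: contrapT => nQ; apply: (hn (a, (a + b) / 2, (c, (c + d) / 2))) => _ /=.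
    by split; do ?split => //; lra.
  - apply: contrapT => nQ; apply: (hn ((a + b) / 2, b, (c, (c + d) / 2))) => _ /=.
    by split; do ?split => //; lra.
  - apply: contrapT => nQ; apply: (hn (a, (a + b) / 2, ((c + d) / 2, d))) => _ /=.
    by split; do ?split => //; lra.
  - apply: contrapT => nQ; apply: (hn ((a + b) / 2, b, ((c + d) / 2, d))) => _ /=.
    by split; do ?split => //; lra.
pose s n := iter n f (x0, x1, (y0, y1)).
have gs n : good (s n).
  elim: n => [|n IH]; last by case: (hf _ IH).
  by split => //=; rewrite /is_box /=.
have ms n : [/\ (s n).1.1 <= (s n.+1).1.1, (s n.+1).1.2 <= (s n).1.2,
               (s n).2.1 <= (s n.+1).2.1 & (s n.+1).2.2 <= (s n).2.2].
  by have [_ [? ?] [? ?] _ _] := hf _ (gs n).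
have w1 n : (s n).1.2 - (s n).1.1 = (x1 - x0) / 2 ^+ n.
  elim: n => [|n IH]; first by rewrite expr0 divr1.
  by have [_ _ _ /= -> _] := hf _ (gs n); rewrite -/(s n) IH exprSr invfM mulrA.
have w2 n : (s n).2.2 - (s n).2.1 = (y1 - y0) / 2 ^+ n.
  elim: n => [|n IH]; first by rewrite expr0 divr1.
  by have [_ _ _ _ /= ->] := hf _ (gs n); rewrite -/(s n) IH exprSr invfM mulrA.
have lim_ex (u v : nat -> R) : (forall n, u n <= u n.+1) -> (forall n, v n.+1 <= v n) ->
    (forall n, u n <= v n) -> exists x, forall n, u n <= x <= v n.
  move=> um vm uv.
  have umon := @homo_leq _ u (fun a b => a <= b) (@lexx _ _) (@le_trans _ _) um.
  have vmon := @homo_leq _ v (fun a b => b <= a) (@lexx _ _) (fun y x z h1 h2 => le_trans h2 h1) vm.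
  have ub n : ubound (range u) (v n).
    move=> _ [m _ <-]; apply: (@le_trans _ _ (u (maxn m n))); first exact/umon/leq_maxl.
    by apply: le_trans (uv _) _; exact/vmon/leq_maxr.
  exists (sup (range u)) => n; apply/andP; split.
    by apply: ub_le_sup; [exists (v 0%N)|exists n].
  by apply: ge_sup => //; exists (u 0%N), 0%N.
have [x hx] : exists x, forall n, (s n).1.1 <= x <= (s n).1.2.
  by apply: lim_ex => n; [case: (ms n)|case: (ms n)|case: (gs n) => -[]].
have [y hy] : exists y, forall n, (s n).2.1 <= y <= (s n).2.2.
  by apply: lim_ex => n; [case: (ms n)|case: (ms n)|case: (gs n) => -[? ? ? ? []]].
have [e e0 he] := loc x y (hx 0%N) (hy 0%N).
have [n hn] := halving_lt ((x1 - x0) + (y1 - y0)) e0.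
have [bs nPs] := gs n; apply: nPs; apply: he => //.
- rewrite w1; apply: le_lt_trans hn; rewrite ler_wpM2r ?invr_ge0 ?exprn_ge0//; lra.
- rewrite w2; apply: le_lt_trans hn; rewrite ler_wpM2r ?invr_ge0 ?exprn_ge0//; lra.
Qed.

Lemma segment_induction (P : R -> R -> Prop) x0 x1 : x0 <= x1 ->
  (forall a b, x0 <= a -> a <= b -> b <= x1 ->
     P a ((a + b) / 2) -> P ((a + b) / 2) b -> P a b) ->
  (forall x, x0 <= x <= x1 -> exists2 e, 0 < e &
     forall a b, x0 <= a -> b <= x1 -> a <= x <= b -> b - a < e -> P a b) ->
  P x0 x1.
Proof.
move=> x01 comb loc.
(* A segment is a rectangle of height zero. *)
apply: (@box_induction (fun a b _ _ => P a b) x0 x1 0 0) => //.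
  by move=> a b c d [/= ? ? ? _ _] ? ? _ _; exact: comb.
move=> x y /loc[e e0 he] _; exists e => // a b c d [/= ? ? ? _ _] ? _ ? _; exact: he.
Qed.

(** There is no Rolle theorem for complex values, so the inequality is bisected: the slack
    [e * (b - a)] is additive over adjacent segments, and near a point [f] and [k] each account for
    half of it. The majorant [k] allows bounds that vary with time, such as the exponential weights
    of the Picard iteration. *)
Lemma mvi (f f' : R -> C) (k k' : R -> R) a b : a <= b ->
  (forall x, a <= x <= b -> rder f x (f' x)) ->
  (forall x, a <= x <= b -> rder (fun y => (k y)%:C)%C x (k' x)%:C%C) ->
  (forall x, a <= x <= b -> normc (f' x) <= k' x) ->
  normc (f b - f a) <= k b - k a.
Proof.
move=> ab df dk fk; apply/ler_addgt0Pr => e0 e00.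
pose e := e0 / (b - a + 1).
have ba1 : 0 < b - a + 1 by lra.
have e1 : 0 < e by rewrite divr_gt0.
suff : normc (f b - f a) <= k b - k a + e * (b - a).
  move=> h; apply: (le_trans h); rewrite lerD2l /e -mulrAC ler_pdivrMr// ler_pM2l//; lra.
apply: (@segment_induction (fun a b => normc (f b - f a) <= k b - k a + e * (b - a))) => //.
  move=> {df dk fk} c d _ _ _ h1 h2; apply: le_trans (distc_tri (f ((c + d) / 2)) _ _) _.
  by move: h1 h2; lra.
move=> x xab; have e2 : 0 < e / 2 by rewrite divr_gt0.
have /nbhsRP[d1 d10 h1] := df x xab _ e2.
have /nbhsRP[d2 d20 h2] := dk x xab _ e2.
exists (Num.min d1 d2); first by rewrite lt_min d10.
move=> c d ac db /andP[cx xd]; rewrite lt_min => /andP[dc1 dc2].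
have hc1 : `|c - x| < d1 by rewrite ltr_norml; lra.
have hc2 : `|c - x| < d2 by rewrite ltr_norml; lra.
have hd1 : `|d - x| < d1 by rewrite ltr_norml; lra.
have hd2 : `|d - x| < d2 by rewrite ltr_norml; lra.
have := h1 c hc1; have := h1 d hd1.
rewrite -!realCB !normc_real (ler0_norm (x := c - x)) ?(ger0_norm (x := d - x)); try lra.
move=> fd fc.
have hf : normc (f d - f c) <= k' x * (d - c) + e / 2 * (d - c).
  rewrite (_ : f d - f c = f' x * (d - c)%:C%C + ((f d - f x - f' x * (d - x)%:C%C)
     - (f c - f x - f' x * (c - x)%:C%C))); last by rewrite !realCB; ring.
  apply: le_trans (normcD _ _) _; apply: lerD.
    rewrite normcM normc_real ger0_norm ?ler_wpM2r ?fk//; lra.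
  apply: le_trans (normcB _ _) _; lra.
have := h2 c hc2; have := h2 d hd2.
rewrite -!(realCB, realCM) !normc_real (ler0_norm (x := c - x)) ?(ger0_norm (x := d - x)); try lra.
rewrite !ler_norml => kd kc; apply: (le_trans hf); lra.
Qed.

Lemma mvi_lip (f f' : R -> C) (M : R) a b : a <= b ->
  (forall x, a <= x <= b -> rder f x (f' x)) ->
  (forall x, a <= x <= b -> normc (f' x) <= M) ->
  normc (f b - f a) <= M * (b - a).
Proof.
move=> ab df fM; rewrite mulrBr; apply: (@mvi f f' (fun x => M * x) (fun=> M)) => // x xab.
have := rderZ (M%:C)%C (rder_id x); rewrite mulr1; apply: gder_ext; first by rewrite realCM.
by apply: filterE => y; rewrite realCM.
Qed.

Lemma rder0_cst (f : R -> C) a b : (forall x, a <= x <= b -> rder f x 0) ->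
  forall x y, a <= x <= b -> a <= y <= b -> f x = f y.
Proof.
move=> df.
have h x y : a <= x -> x <= y -> y <= b -> f x = f y.
  move=> ax xy yb; apply/esym/eqP; rewrite -subr_eq0 -normc_eq0 eq_le normc_ge0 andbT.
  have := @mvi_lip f (fun=> 0) 0 x y xy; rewrite mul0r; apply=> z zxy; last by rewrite normc0E.
  by apply: df; lra.
move=> x y xab yab; have [xy|/ltW yx] := leP x y; first by apply: h; lra.
by apply/esym; apply: h; lra.
Qed.

Lemma heine_cantor (S : R -> R -> Prop) (f : R -> R -> C) M :
  0 <= M -> (forall x y, S x y -> `|x| <= M /\ `|y| <= M) ->
  (forall x y, ~ S x y -> exists2 d, 0 < d &
     forall x' y', `|x' - x| < d -> `|y' - y| < d -> ~ S x' y') ->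
  (forall x y, S x y -> forall e, 0 < e -> exists2 d, 0 < d & forall x' y', S x' y' ->
     `|x' - x| < d -> `|y' - y| < d -> normc (f x' y' - f x y) <= e) ->
  forall e, 0 < e -> exists2 d, 0 < d & forall x y x' y', S x y -> S x' y' ->
     `|x' - x| < d -> `|y' - y| < d -> normc (f x' y' - f x y) <= e.
Proof.
move=> M0 Sb Scl fc e e0.
(* Only the base point is confined to the box; its partner ranges over all of [S]. Gluing four boxes
   therefore only takes the minimum of four distances. *)
pose P a b c d' := exists2 d, 0 < d & forall x y x' y', a <= x <= b -> c <= y <= d' ->
  S x y -> S x' y' -> `|x' - x| < d -> `|y' - y| < d -> normc (f x' y' - f x y) <= e.
suff [d d0 hd] : P (- M) M (- M) M.
  exists d => // x y x' y' Sxy; apply: hd => //; rewrite -ler_norml; by case: (Sb _ _ Sxy).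
apply: box_induction; try lra.
  move=> a b c d _ m n [d1 d10 h1] [d2 d20 h2] [d3 d30 h3] [d4 d40 h4].
  exists (Num.min (Num.min d1 d2) (Num.min d3 d4)); first by rewrite !lt_min d10 d20 d30.
  move=> x y x' y' /andP[ax xb] /andP[cy yd] Sxy Sxy'; rewrite !lt_min.
  move=> /andP[/andP[? ?] /andP[? ?]] /andP[/andP[? ?] /andP[? ?]].
  have [xm|/ltW xm] := leP x m; have [yn|/ltW yn] := leP y n.
  - by apply: h1 => //; apply/andP.
  - by apply: h3 => //; apply/andP.
  - by apply: h2 => //; apply/andP.
  - by apply: h4 => //; apply/andP.
move=> x y _ _; have [Sxy|/Scl[d d0 hd]] := pselect (S x y); last first.
  exists d => // a b c d' _ xab ycd ba dc; exists 1 => // u v u' v' uab vcd Suv _ _ _.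
  by exfalso; apply: (hd u v) => //; rewrite ltr_norml; lra.
have e20 : 0 < e / 2 by rewrite divr_gt0.
have [d d0 hd] := fc _ _ Sxy _ e20.
exists (d / 2); first by rewrite divr_gt0.
move=> a b c d' _ xab ycd ba dc; exists (d / 2); first by rewrite divr_gt0.
move=> u v u' v' uab vcd Suv Suv'; rewrite !ltr_norml => h1 h2.
apply: le_trans (distc_tri (f x y) _ _) _.
have : normc (f u v - f x y) <= e / 2 by apply: hd => //; rewrite ltr_norml; lra.
have : normc (f u' v' - f x y) <= e / 2 by apply: hd => //; rewrite ltr_norml; lra.
rewrite (distcC (f x y)); lra.
Qed.

Lemma unif_continuous_segment (f : R -> C) (a b : R) :
  (forall x : R, a <= x <= b -> ccvg (nbhs x) f (f x)) ->
  forall e, 0 < e -> exists2 d, 0 < d & forall x y, a <= x <= b -> a <= y <= b ->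
    `|y - x| < d -> normc (f y - f x) <= e.
Proof.
move=> fc e e0.
pose S (x y : R) := a <= x <= b /\ y = 0.
have [||x y nS|x y [xab _] e' e'0|d d0 hd] :=
  @heine_cantor S (fun x _ => f x) (`|a| + `|b|) _ _ _ _ e e0.
- by rewrite addr_ge0.
- move=> x y [xab ->]; rewrite normr0 addr_ge0//; split=> //.
  have := ler_norm b; have := ler_norm (- a); rewrite normrN ler_norml.
  by have := normr_ge0 a; have := normr_ge0 b; lra.
- have [y0|y0] := eqVneq y 0; last first.
    exists `|y|; first by rewrite normr_gt0.
    by move=> x' y' _ h [_ E]; move: h; rewrite E sub0r normrN ltxx.
  have [xa|ax] := ltP x a.
    exists (a - x); first by lra.
    by move=> x' y'; rewrite ltr_norml => h _ [h' _]; lra.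
  have [bx|xb] := ltP b x.
    exists (x - b); first by lra.
    by move=> x' y'; rewrite ltr_norml => h _ [h' _]; lra.
  by exfalso; apply: nS; split=> //; apply/andP.
- have /nbhsRP[d d0 hd] := fc x xab _ e'0.
  by exists d => // x' y' _ ? _; exact: hd.
- exists d => // x y xab yab h; apply: (hd x 0 y 0) => //; by rewrite subrr normr0.
Qed.

End Boxes.

(** * Exponential, primitives and Riemann sums *)

Section ComplexExp.
Variable R : realType.
Local Notation C := R[i].

Definition cexp (z : C) : C :=
  (expR (complex.Re z) * cos (complex.Im z) +i* (expR (complex.Re z) * sin (complex.Im z)))%C.

Lemma cexp0 : cexp 0 = 1.
Proof. by rewrite /cexp /= expR0 cos0 sin0 mulr1 mulr0. Qed.

Lemma cexpD z w : cexp (z + w) = cexp z * cexp w.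
Proof.
rewrite /cexp; apply: complex_ext; rewrite !cReIm /= expRD ?cosD ?sinD; ring.
Qed.

Lemma normc_cexp z : normc (cexp z) = expR (complex.Re z).
Proof.
rewrite /cexp /= !exprMn -mulrDr cos2Dsin2 mulr1 sqrtr_sqr ger0_norm//.
Qed.

Lemma cexp_neq0 z : cexp z != 0.
Proof. by rewrite -normc_gt0 normc_cexp expR_gt0. Qed.

Lemma normc_cexp_le1 z : complex.Re z <= 0 -> normc (cexp z) <= 1.
Proof. by move=> h; rewrite normc_cexp -expR0 ler_expR. Qed.

Lemma cder_cexp0 : cder cexp 0 1.
Proof.
(* The four error terms [H1] to [H4] are at most 1, 2, 3 and 2 times [e * n], whence the 8. *)
move=> e0 e00; pose e := Num.min 1 (e0 / 8).
have ee0 : e * 8 <= e0 by rewrite -ler_pdivlMr// /e ge_min lexx orbT.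
have e1 : e <= 1 by rewrite /e ge_min lexx.
have e_gt0 : 0 < e by rewrite /e lt_min ltr01 divr_gt0.
clearbody e.
have real_der (f : R -> R) (l : R) : is_derive (0 : R) 1 f l ->
    exists2 d, 0 < d & forall y, `|y| < d -> `|f y - f 0 - l * y| <= e * `|y|.
  move=> /rder_real/(_ _ e_gt0)/nbhsRP[d d0 hd]; exists d => // y yd.
  have := hd y; rewrite subr0 => /(_ yd).
  by rewrite -!(realCB, realCM) !normc_real subr0.
have [d1 d10 h1] := real_der _ _ (is_derive_expR (0 : R)).
have [d2 d20 h2] := real_der _ _ (is_derive_cos (0 : R)).
have [d3 d30 h3] := real_der _ _ (is_derive_sin (0 : R)).
exists (Num.min (Num.min d1 d2) (Num.min d3 e)).
  by rewrite !lt_min d10 d20 d30 e_gt0.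
move=> z; rewrite !subr0 mul1r !lt_min cexp0 => /andP[/andP[zd1 zd2] /andP[zd3 ze]].
have xz := Re_le_normc z; have yz := Im_le_normc z.
have := h1 (complex.Re z) (le_lt_trans xz zd1).
have := h2 (complex.Im z) (le_lt_trans yz zd2).
have := h3 (complex.Im z) (le_lt_trans yz zd3).
rewrite !expR0 !cos0 !sin0 oppr0 mul0r !subr0 !mul1r ?addr0.
have cmax := cos_max (complex.Im z).
set x := complex.Re z in xz *; set y := complex.Im z in yz cmax *.
set n := normc z in xz yz ze *.
set E := expR x; set c := cos y in cmax *; set s := sin y => hs hc hE.
have -> : cexp z - 1 - z =
    Complex ((E - 1 - x) * c + (1 + x) * (c - 1)) (E * (s - y) + (E - 1) * y) :> C.
  by apply: complex_ext; rewrite !cReIm /= -/x -/y -/E -/c -/s; ring.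
have n0 : 0 <= n by exact: normc_ge0.
apply: le_trans (normc_le_ReIm _) _ => /=.
have H1 : `|(E - 1 - x) * c| <= e * n.
  rewrite normrM -[leRHS]mulr1; apply: ler_pM => //.
  by apply: le_trans hE _; rewrite ler_pM2l.
have H2 : `|(1 + x) * (c - 1)| <= 2 * (e * n).
  rewrite normrM; apply: ler_pM => //.
    by apply: le_trans (ler_normD _ _) _; rewrite normr1; lra.
  by apply: le_trans hc _; rewrite ler_pM2l.
have HE : `|E - 1| <= 2 * n.
  have := ler_normD (E - 1 - x) x; rewrite subrK => h; apply: le_trans h _.
  have : e * `|x| <= 1 * n by apply: ler_pM => //; exact: ltW.
  lra.
have H3 : `|E * (s - y)| <= 3 * (e * n).
  rewrite normrM; apply: ler_pM => //.
    have := ler_normD (E - 1) 1; rewrite subrK normr1 => h; apply: le_trans h _; lra.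
  by apply: le_trans hs _; rewrite ler_pM2l.
have H4 : `|(E - 1) * y| <= 2 * (e * n).
  rewrite normrM mulrA; apply: ler_pM => //.
  by apply: (le_trans HE); lra.
have := ler_normD ((E - 1 - x) * c) ((1 + x) * (c - 1)).
have := ler_normD (E * (s - y)) ((E - 1) * y).
have : e * 8 * n <= e0 * n by rewrite ler_wpM2r.
lra.
Qed.

Lemma cder_cexp z : cder cexp z (cexp z).
Proof.
have h : cder (fun w => cexp z * cexp (w - z)) z (cexp z * (1 * (1 - 0))).
  apply: cderZ; apply: (cder_comp (g := cexp)).
    by apply: cderB; [exact: cder_id|exact: cder_cst].
  by rewrite subrr; exact: cder_cexp0.
move: h; rewrite subr0 !mulr1; apply: gder_ext.
  by rewrite -cexpD addrC subrK.
by apply: filterE => w; rewrite -cexpD addrC subrK.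
Qed.

Lemma rder_line (a b : C) x : rder (fun y => a + y%:C%C * b) x b.
Proof.
have h : rder (fun y => a + b * y%:C%C) x (0 + b * 1).
  by apply: rderD; [exact: rder_cst|apply: rderZ; exact: rder_id].
move: h; rewrite add0r mulr1; apply: gder_ext; first by rewrite mulrC.
by apply: filterE => y; rewrite mulrC.
Qed.

(** The left half-plane is convex and the derivative [cexp] has modulus at most 1 on it, so
    integration along the segment gives constant 1. This makes the Picard estimates independent of
    the size of the exponents. *)
Lemma cexp_lip a b : complex.Re a <= 0 -> complex.Re b <= 0 ->
  normc (cexp a - cexp b) <= normc (a - b).
Proof.
move=> a0 b0.
pose L (t : R) := b + t%:C%C * (a - b).
have L1 : L 1 = a by rewrite /L rmorph1; ring.
have L0 : L 0 = b by rewrite /L rmorph0; ring.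
suff : normc (cexp (L 1) - cexp (L 0)) <= normc (a - b) * (1 - 0).
  by rewrite L1 L0 subr0 mulr1.
apply: (@mvi_lip _ (cexp \o L) (fun t => cexp (L t) * (a - b))) => //.
  move=> x _; apply: (rder_comp (f := L)); first exact: rder_line.
  exact: cder_cexp.
move=> t t01; rewrite normcM -[leRHS]mul1r ler_wpM2r ?normc_ge0//.
apply: normc_cexp_le1; rewrite !cReIm /=; nra.
Qed.

Lemma cexp_taylor2 a : complex.Re a <= 0 -> normc (cexp a - 1 - a) <= normc a ^+ 2.
Proof.
move=> a0.
pose L (t : R) := 0 + t%:C%C * a.
have L1 : L 1 = a by rewrite /L rmorph1; ring.
have L0 : L 0 = 0 by rewrite /L rmorph0; ring.
suff : normc ((cexp (L 1) - L 1) - (cexp (L 0) - L 0)) <= normc a ^+ 2 * (1 - 0).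
  rewrite L1 L0 cexp0 !subr0 mulr1.
  by rewrite (_ : cexp a - a - 1 = cexp a - 1 - a); [|ring].
apply: (@mvi_lip _ (fun t => cexp (L t) - L t) (fun t => cexp (L t) * a - a)) => //.
  move=> x _; apply: rderB; last exact: rder_line.
  by apply: (rder_comp (f := L)); [exact: rder_line|exact: cder_cexp].
move=> t t01; rewrite -{2}[a]mul1r -mulrBl normcM expr2 ler_wpM2r ?normc_ge0//.
rewrite -cexp0; apply: le_trans (@cexp_lip _ _ _ _) _ => //.
  by rewrite /L !cReIm /=; nra.
rewrite subr0 /L add0r normcM normc_real -[leRHS]mul1r ler_wpM2r ?normc_ge0// ger0_norm; lra.
Qed.

Definition cis (y : R) : C := (cos y +i* sin y)%C.

Lemma cexp_im (y : R) : cexp ('i%C * y%:C%C) = cis y.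
Proof.
rewrite (_ : 'i%C * _ = Complex 0 y); last by apply: complex_ext; rewrite !cReIm /=; ring.
by rewrite /cexp /cis /= expR0 !mul1r.
Qed.

Lemma cisD x y : cis (x + y) = cis x * cis y.
Proof. by rewrite -!cexp_im realCD mulrDr cexpD. Qed.

Lemma cis0 : cis 0 = 1. Proof. by rewrite /cis cos0 sin0. Qed.

Lemma cis2pi : cis (pi *+ 2) = 1. Proof. by rewrite /cis cos2pi sin2pi. Qed.

Lemma normc_cis y : normc (cis y) = 1.
Proof. by rewrite /cis /= cos2Dsin2 sqrtr1. Qed.

Lemma cis_neq0 y : cis y != 0.
Proof. by rewrite -normc_gt0 normc_cis. Qed.

Lemma cis_lip x y : normc (cis x - cis y) <= `|x - y|.
Proof.
have h (t : R) : complex.Re ('i%C * t%:C%C : C) <= 0 by rewrite !cReIm /=; lra.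
rewrite -!cexp_im; apply: le_trans (cexp_lip (h x) (h y)) _.
by rewrite -mulrBr -realCB normcM normci mul1r normc_real.
Qed.

Lemma cexpE (x y : R) : cexp (x +i* y)%C = (expR x)%:C%C * cis y.
Proof. by apply: complex_ext; rewrite /cexp /cis !cReIm /=; ring. Qed.

Lemma cisX y n : cis y ^+ n = cis (n%:R * y).
Proof.
elim: n => [|n IH]; first by rewrite mul0r cis0.
by rewrite exprS IH -cisD -natr1 mulrDl mul1r addrC.
Qed.

End ComplexExp.

(** * Primitives on the real line and their Riemann sums *)

Section Primitive.
Variable R : realType.
Local Notation C := R[i].
Local Notation mu := (@lebesgue_measure R).

Lemma real_primitive_window (g : R -> R) (n : R) : continuous g -> exists G : R -> R,
  forall x, - n <= x <= n -> rder (fun y => (G y)%:C)%C x (g x)%:C%C.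
Proof.
(* Starting at [- n - 1] and stopping at [n + 1] puts all of [[- n, n]] in the interior, where the
   derivative is two-sided. *)
move=> cg; exists (fun x => \int[mu]_(t in `[- n - 1, x]) g t) => x xn.
have [] := @continuous_FTC1_closed R g (- n - 1) x (n + 1).
- lra.
- apply: continuous_compact_integrable; first exact: segment_compact.
  exact: continuous_subspaceT.
- lra.
- exact: cg.
move=> dF F'; apply: rder_real.
split; first exact: dF.
exact: etrans (esym (derive1E _ _)) F'.
Qed.

Lemma primitive_window (g : R -> C) (n : R) : (forall x, ccvg (nbhs x) g (g x)) ->
  exists G : R -> C, forall x, - n <= x <= n -> rder G x (g x).
Proof.
move=> cg.
have [G1 h1] : exists G : R -> R, forall x, - n <= x <= n ->
    rder (fun y => (G y)%:C)%C x (complex.Re (g x))%:C%C.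
  apply: (@real_primitive_window (fun x => complex.Re (g x))) => x.
  apply/cvgRP => e /(cg x); apply: filterS => y; apply: le_trans.
  by have := Re_le_normc (g y - g x); rewrite !cReIm.
have [G2 h2] : exists G : R -> R, forall x, - n <= x <= n ->
    rder (fun y => (G y)%:C)%C x (complex.Im (g x))%:C%C.
  apply: (@real_primitive_window (fun x => complex.Im (g x))) => x.
  apply/cvgRP => e /(cg x); apply: filterS => y; apply: le_trans.
  by have := Im_le_normc (g y - g x); rewrite !cReIm.
exists (fun x => (G1 x)%:C%C + 'i%C * (G2 x)%:C%C) => x xn.
by rewrite [g x]complexE; apply: rderD; [exact: h1|apply: rderZ; exact: h2].
Qed.

(** Primitives on two windows differ by a constant, so subtracting the value at 0 makes them
    coherent and lets them be glued. Continuity is assumed under the existential quantifier so that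
    [prim] is a total function. *)
Lemma primitive_exists (g : R -> C) : exists G : R -> C,
  (forall x, ccvg (nbhs x) g (g x)) -> forall x, rder G x (g x).
Proof.
have [cg|ncg] := pselect (forall x, ccvg (nbhs x) g (g x)); last by exists (fun=> 0) => /ncg.
have [H hH] := choice (fun n : nat => primitive_window n%:R cg).
have coh (n m : nat) (y : R) : `|y| <= n%:R -> `|y| <= m%:R -> H n y - H n 0 = H m y - H m 0.
  rewrite !ler_norml => yn ym.
  suff E : H n y - H m y = H n 0 - H m 0.
    by move/eqP: E; rewrite subr_eq => /eqP ->; ring.
  apply: (@rder0_cst _ (fun y => H n y - H m y) (- `|y|) `|y|); last first.
  - by rewrite oppr_le0 normr_ge0.
  - by rewrite -ler_norml.
  move=> x; rewrite -ler_norml => xy; rewrite -(subrr (g x)).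
  have yn' : `|y| <= n%:R by rewrite ler_norml.
  have ym' : `|y| <= m%:R by rewrite ler_norml.
  by apply: rderB; apply: hH; rewrite -ler_norml; exact: le_trans xy _.
exists (fun y => H (Num.bound `|y|) y - H (Num.bound `|y|) 0) => _ x.
pose m := (Num.bound `|x|).+1.
have xm : `|x| + 1 <= m%:R by rewrite /m -natr1 lerD2r ltW// archi_boundP.
have bm (y : R) : `|y| <= (Num.bound `|y|)%:R by rewrite ltW// archi_boundP.
apply: (@gder_ext _ _ _ _ _ _ (fun y => H m y - H m 0)).
- by apply: coh => //; lra.
- apply/nbhsRP; exists 1 => // y yx; apply: coh => //.
  by have := ler_normD (y - x) x; rewrite subrK; lra.
rewrite -[g x]subr0; apply: rderB; last exact: rder_cst.
by apply: hH; rewrite -ler_norml; lra.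
Qed.

Definition prim (g : R -> C) : R -> C := projT1 (cid (primitive_exists g)).

Lemma rder_prim (g : R -> C) : (forall x : R, ccvg (nbhs x) g (g x)) -> forall x, rder (prim g) x (g x).
Proof. by rewrite /prim; case: cid. Qed.

(** On a subinterval of length [h], [G] minus the line of slope [g (X i)] has derivative at most [e]
    by uniform continuity, so it varies by at most [e * h]; these errors add up to [e * (b - a)]. *)
Lemma riemann_sum (G g : R -> C) (a b : R) : a <= b ->
  (forall x, a <= x <= b -> rder G x (g x)) ->
  (forall x : R, a <= x <= b -> ccvg (nbhs x) g (g x)) ->
  ccvg \oo (fun n => \sum_(i < n.+1)
     ((b - a) / n.+1%:R)%:C%C * g (a + i%:R * ((b - a) / n.+1%:R))) (G b - G a).
Proof.
move=> ab dG cg e0 e00; pose e := e0 / (b - a + 1).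
have ba1 : 0 < b - a + 1 by lra.
have e_gt0 : 0 < e by rewrite divr_gt0.
have [d d0 hd] := unif_continuous_segment cg e_gt0.
exists (Num.bound ((b - a) / d)) => // n /= Nn.
set h := (b - a) / n.+1%:R.
have h0 : 0 <= h by rewrite divr_ge0//; lra.
have hE : n.+1%:R * h = b - a by rewrite mulrC divfK// pnatr_eq0.
have hd' : h < d.
  rewrite /h ltr_pdivrMr// mulrC -ltr_pdivrMr//.
  apply: (@lt_le_trans _ _ (Num.bound ((b - a) / d))%:R).
    by rewrite archi_boundP// divr_ge0 ?subr_ge0// ltW.
  by rewrite ler_nat ltnW.
pose X (i : nat) := a + i%:R * h.
have Xab i : (i <= n.+1)%N -> a <= X i <= b.
  move=> ii; have : i%:R * h <= n.+1%:R * h by rewrite ler_wpM2r// ler_nat.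
  have : 0 <= i%:R * h by rewrite mulr_ge0.
  by rewrite /X; lra.
have -> : G b - G a = \sum_(i < n.+1) (G (X i.+1) - G (X i)).
  rewrite -(big_mkord xpredT (fun i => G (X i.+1) - G (X i))) telescope_sumr//.
  by rewrite /X hE mul0r addr0 (addrC a) subrK.
rewrite -sumrB; apply: le_trans (normc_sum _ _ _) _.
apply: (@le_trans _ _ (\sum_(i < n.+1) e * h)); last first.
  rewrite sumr_const card_ord -[_ *+ _]mulr_natl mulrCA hE /e mulrAC ler_pdivrMr//.
  by rewrite ler_pM2l//; lra.
apply: ler_sum => i _; rewrite distcC.
have Xi : X i.+1 = X i + h by rewrite /X -natr1; ring.
have Xi1 := Xab i (ltnW (ltn_ord i)); have Xi2 := Xab i.+1 (ltn_ord i).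
have := @mvi_lip _ (fun x => G x - (0 + x%:C%C * g (X i)))
  (fun x => g x - g (X i)) e (X i) (X i.+1).
rewrite -/(X i) Xi (_ : X i + h - X i = h); last by ring.
rewrite (_ : G (X i + h) - _ - (G (X i) - _) = G (X i + h) - G (X i) - h%:C%C * g (X i));
  last by rewrite realCD; ring.
apply; first by lra.
  move=> x xi; apply: rderB; last exact: rder_line.
  by apply: dG; lra.
move=> x xi; apply: hd => //; first by lra.
by rewrite ltr_norml; lra.
Qed.

End Primitive.

(** * Goursat and circle means *)

Section Goursat.
Variable R : realType.
Local Notation C := R[i].
Implicit Types (G : R -> R -> C).

(** The counterclockwise contour integral over the boundary of the rectangle, each side being
    integrated through a primitive in its real parameter. *)
Definition bdry G a b c d : C :=
  (prim (G^~ c) b - prim (G^~ c) a) + 'i%C * (prim (G b) d - prim (G b) c)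
  - (prim (G^~ d) b - prim (G^~ d) a) - 'i%C * (prim (G a) d - prim (G a) c).

(** The expansion is asked only for [x' <= x1], because the function to which the lemma is applied
    is frozen beyond the outer radius and not holomorphic across it. *)
Lemma goursat G x0 x1 y0 y1 : x0 <= x1 -> y0 <= y1 ->
  (forall x y : R, ccvg (nbhs x) (G^~ y) (G x y)) ->
  (forall x y : R, ccvg (nbhs y) (G x) (G x y)) ->
  (forall x y, x0 <= x <= x1 -> y0 <= y <= y1 -> exists l, forall e, 0 < e ->
     exists2 d, 0 < d & forall x' y', `|x' - x| < d -> `|y' - y| < d ->
       x' <= x1 ->
       normc (G x' y' - G x y - l * Complex (x' - x) (y' - y))
         <= e * (`|x' - x| + `|y' - y|)) ->
  bdry G x0 x1 y0 y1 = 0.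
Proof.
move=> x01 y01 cx cy dG.
have dH y x : rder (prim (G^~ y)) x (G x y) by apply: (rder_prim (g := G^~ y)).
have dV x y : rder (prim (G x)) y (G x y) by exact: rder_prim.
suff H e : 0 < e -> normc (bdry G x0 x1 y0 y1) <= e * ((x1 - x0) + (y1 - y0)) ^+ 2.
  apply: eq_of_small => e e0; rewrite subr0.
  pose s := ((x1 - x0) + (y1 - y0)) ^+ 2.
  have s0 : 0 <= s by rewrite sqr_ge0.
  have s1 : 0 < s + 1 by lra.
  apply: (le_trans (H (e / (s + 1)) (divr_gt0 e0 s1))).
  by rewrite -/s mulrAC ler_pdivrMr// ler_pM2l//; lra.
move=> e0.
(* This bound is exactly additive: halving both sides divides the squared half-perimeter by four. *)
apply: (@box_induction _ (fun a b c d => normc (bdry G a b c d) <= e * ((b - a) + (d - c)) ^+ 2))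
  => // [a b c d _ m n h1 h2 h3 h4|x y xx yy].
  have -> : bdry G a b c d = bdry G a m c n + bdry G m b c n + bdry G a m n d + bdry G m b n d.
    by rewrite /bdry; ring.
  apply: le_trans (normcD _ _) _.
  apply: le_trans (lerD (normcD _ _) (lexx _)) _.
  apply: le_trans (lerD (lerD (normcD _ _) (lexx _)) (lexx _)) _.
  have -> : e * ((b - a) + (d - c)) ^+ 2 = e * ((m - a) + (n - c)) ^+ 2 +
    e * ((b - m) + (n - c)) ^+ 2 + e * ((m - a) + (d - n)) ^+ 2 + e * ((b - m) + (d - n)) ^+ 2.
    by rewrite /m /n; field.
  lra.
have [l hl] := dG x y xx yy.
have e20 : 0 < e / 2 by rewrite divr_gt0.
have [d d0 hd] := hl _ e20.
exists d => // a b c d' [/= ax0 ab bx1 cy0 [cd dy1]] xab ycd bad dcd.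
pose s := (b - a) + (d' - c).
pose w0 : C := Complex x y.
(* A complex primitive of the affine part of [G] at [(x, y)]. Its increments around the boundary
   cancel, so only the remainder, of size [e / 2 * s], is integrated. *)
pose Phi (w : C) := G x y * w + l / 2 * ((w - w0) * (w - w0)).
have dPhi w : cder Phi w (G x y + l * (w - w0)).
  have h : cder Phi w (G x y * 1 + l / 2 * ((1 - 0) * (w - w0) + (w - w0) * (1 - 0))).
    apply: cderD; first by apply: cderZ; exact: cder_id.
    apply: cderZ; apply: cderM; apply: cderB; [exact: cder_id|exact: cder_cst|exact: cder_id|exact: cder_cst].
  rewrite (_ : G x y + l * (w - w0) =
    G x y * 1 + l / 2 * ((1 - 0) * (w - w0) + (w - w0) * (1 - 0))); [exact: h|by field].
have close x' y' : a <= x' <= b -> c <= y' <= d' ->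
    normc (G x' y' - (G x y + l * (Complex x' y' - w0))) <= e / 2 * s.
  move=> hx' hy'; rewrite opprD addrA.
  have -> : Complex x' y' - w0 = Complex (x' - x) (y' - y) by [].
  apply: le_trans (hd x' y' _ _ _) _; try (rewrite ?ltr_norml; move: hx' hy' xab ycd bad dcd ax0 bx1 cy0 dy1; clear; lra).
  rewrite ler_pM2l//; apply: lerD; rewrite ler_norml /s; move: hx' hy' xab ycd; clear; lra.
have horiz y' : c <= y' <= d' ->
    normc ((prim (G^~ y') b - prim (G^~ y') a) - (Phi (Complex b y') - Phi (Complex a y')))
      <= e / 2 * s * (b - a).
  move=> hy'.
  have Cl t : Complex t y' = 'i%C * y'%:C%C + t%:C%C * 1 :> C.
    by apply: complex_ext; rewrite !cReIm /=; ring.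
  rewrite (_ : _ - _ - _ = (prim (G^~ y') b - Phi (Complex b y')) -
    (prim (G^~ y') a - Phi (Complex a y'))); last by ring.
  apply: (@mvi_lip _ (fun t => prim (G^~ y') t - Phi (Complex t y'))
    (fun t => G t y' - (G x y + l * (Complex t y' - w0)))) => // t tab; last exact: close.
  apply: rderB; first exact: dH.
  rewrite -[X in rder _ _ X]mulr1.
  apply: (@gder_ext _ _ _ _ _ _ (fun t => Phi ('i%C * y'%:C%C + t%:C%C * 1))).
  - by rewrite -Cl.
  - by apply: filterE => u; rewrite -Cl.
  apply: (rder_comp (f := fun t => 'i%C * y'%:C%C + t%:C%C * 1)); first exact: rder_line.
  by rewrite Cl; exact: dPhi.
have vert x' : a <= x' <= b ->
    normc ('i%C * (prim (G x') d' - prim (G x') c) - (Phi (Complex x' d') - Phi (Complex x' c)))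
      <= e / 2 * s * (d' - c).
  move=> hx'.
  have Cl t : Complex x' t = x'%:C%C + t%:C%C * 'i%C :> C.
    by apply: complex_ext; rewrite !cReIm /=; ring.
  rewrite (_ : _ - _ = ('i%C * prim (G x') d' - Phi (Complex x' d')) -
    ('i%C * prim (G x') c - Phi (Complex x' c))); last by ring.
  apply: (@mvi_lip _ (fun t => 'i%C * prim (G x') t - Phi (Complex x' t))
    (fun t => 'i%C * G x' t - (G x y + l * (Complex x' t - w0)) * 'i%C)) => // t tab; last first.
    by rewrite mulrC -mulrBl normcM normci mulr1; exact: close.
  apply: rderB; first by apply: rderZ; exact: dV.
  apply: (@gder_ext _ _ _ _ _ _ (fun t => Phi (x'%:C%C + t%:C%C * 'i%C))).
  - by rewrite -Cl.
  - by apply: filterE => u; rewrite -Cl.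
  apply: (rder_comp (f := fun t => x'%:C%C + t%:C%C * 'i%C)); first exact: rder_line.
  by rewrite Cl; exact: dPhi.
have aab : a <= a <= b by rewrite lexx.
have bab : a <= b <= b by rewrite lexx andbT.
have ccd : c <= c <= d' by rewrite lexx.
have dcd' : c <= d' <= d' by rewrite lexx andbT.
have := vert _ aab; have := vert _ bab; have := horiz _ ccd; have := horiz _ dcd'.
set A1 := _ - (Phi _ - _); set A2 := _ - (Phi _ - _); set A3 := _ - (Phi _ - _).
set A4 := _ - (Phi _ - _) => h1 h2 h3 h4.
have -> : bdry G a b c d' = A2 + A3 - A1 - A4 by rewrite /bdry /A1 /A2 /A3 /A4; ring.
apply: le_trans (normcB _ _) _.
apply: le_trans (lerD (normcB _ _) (lexx _)) _.
apply: le_trans (lerD (lerD (normcD _ _) (lexx _)) (lexx _)) _.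
have -> : e * ((b - a) + (d' - c)) ^+ 2 = 2 * (e / 2 * s * (b - a)) + 2 * (e / 2 * s * (d' - c)).
  by rewrite /s; field.
lra.
Qed.

End Goursat.

(** * Means over circles as limits of means over roots of unity *)

Section MeanValue.
Variable R : realType.
Local Notation C := R[i].

Definition omega (n j : nat) : C := cis (j%:R * (pi *+ 2 / n.+1%:R)).

Definition cavg (r : R) (g : C -> C) (n : nat) : C :=
  (n.+1%:R^-1)%:C%C * \sum_(j < n.+1) g (r%:C%C * omega n j).

Lemma normc_omega n j : normc (omega n j) = 1. Proof. exact: normc_cis. Qed.

Lemma cvg_minr (X x : R) : forall y : R, `|Num.min y X - Num.min x X| <= `|y - x|.
Proof.
move=> y; rewrite !minElt; case: ltP => h1; case: ltP => h2; rewrite ?subrr ?normr0 ?normr_ge0//.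
  by rewrite !ler0_norm; lra.
by rewrite !ger0_norm; lra.
Qed.

(* In logarithmic coordinates the mean over the circle of radius [expR x] is
   constant in [x] by Goursat's theorem on rectangles; continuity of the mean
   carries it across the exceptional circle, and its limit at [-oo] is [g 0]. *)
Lemma circle_mean (g : C -> C) (r ra : R) : 0 < r ->
  (forall w, normc w <= r -> ccvg (cnbhs w) g (g w)) ->
  (forall w, normc w <= r -> normc w != ra -> w != 0 -> cdiff g w) ->
  ccvg \oo (cavg r g) (g 0).
Proof.
move=> r0 cg dg.
pose X := ln r.
have eX : expR X = r by rewrite /X lnK// posrE.
pose P : R := pi *+ 2.
have P0 : 0 < P by rewrite /P pmulrn_rgt0// pi_gt0.
(* Clipping the logarithmic radius at [X] makes [G] continuous on the whole plane, as [prim]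
   requires. *)
pose G x y := g (cexp (Complex (Num.min x X) y)).
have Gle x y : normc (cexp (Complex (Num.min x X) y)) <= r.
  by rewrite normc_cexp /= -eX ler_expR ge_min lexx orbT.
have Gc (x y e : R) : 0 < e -> exists2 d, 0 < d & forall x' y', `|x' - x| < d ->
    `|y' - y| < d -> normc (G x' y' - G x y) <= e.
  move=> e0.
  have [d d0 hd] := ccvg_circ (cder_cvg (cder_cexp (Complex (Num.min x X) y))) (cg _ (Gle x y)) e0.
  exists (d / 2); first by rewrite divr_gt0.
  move=> x' y' hx hy; apply: hd; apply: le_lt_trans (normc_le_ReIm _) _.
  have := cvg_minr X x x'; rewrite /= => h; lra.
have cx (x y : R) : ccvg (nbhs x) (G^~ y) (G x y).
  move=> e /(Gc x y)[d d0 hd]; apply/nbhsRP; exists d => // x' hx.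
  by apply: hd => //; rewrite subrr normr0.
have cy (x y : R) : ccvg (nbhs y) (G x) (G x y).
  move=> e /(Gc x y)[d d0 hd]; apply/nbhsRP; exists d => // y' hy.
  by apply: hd => //; rewrite subrr normr0.
have dV x y : rder (prim (G x)) y (G x y) by exact: rder_prim.
pose V x := prim (G x) P - prim (G x) 0.
have Vconst x0 x1 : x0 <= x1 -> x1 <= X -> (forall x, x0 <= x <= x1 -> expR x != ra) ->
    V x0 = V x1.
  move=> x01 x1X nra.
  have : bdry G x0 x1 0 P = 0.
    apply: goursat => //; first exact: ltW.
    move=> x y xx yy.
    have xX : Num.min x X = x by apply/min_idPl; lra.
    have [l dl] : cdiff (fun w => g (cexp w)) (Complex x y).
      have [|||l hl] := dg (cexp (Complex x y)).
      - by have := Gle x y; rewrite xX.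
      - by rewrite normc_cexp /= nra.
      - exact: cexp_neq0.
      exists (l * cexp (Complex x y)).
      by apply: cder_comp => //; exact: cder_cexp.
    exists l => e e0; have [d d0 hd] := dl _ e0; exists (d / 2); first by rewrite divr_gt0.
    move=> x' y' hx hy x'1.
    have x'X : Num.min x' X = x' by apply/min_idPl; lra.
    have := hd (Complex x' y').
    have -> : Complex x' y' - Complex x y = Complex (x' - x) (y' - y) :> C by [].
    have hn := normc_le_ReIm (Complex (x' - x) (y' - y)).
    have hlt : normc (Complex (x' - x) (y' - y)) < d.
      by apply: le_lt_trans hn _; move=> /=; lra.
    move=> /(_ hlt); rewrite /G xX x'X => h; apply: (le_trans h).
    by rewrite ler_pM2l.
  rewrite /bdry.
  (* Periodicity in the angle cancels the two horizontal sides; what remains is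
     ['i * (V x1 - V x0)]. *)
  have -> : G^~ P = G^~ 0.
    apply/funext => x; rewrite /G /cexp /=; congr g.
    by rewrite /P cos2pi sin2pi cos0 sin0.
  rewrite -/(V x1) -/(V x0) => h.
  have : 'i%C * (V x1 - V x0) = 0 :> C by rewrite -h; ring.
  move/eqP; rewrite mulf_eq0 -normc_eq0 normci oner_eq0 /= subr_eq0.
  by move/eqP.
have Vcont x e : 0 < e -> exists2 d, 0 < d & forall x', `|x' - x| < d -> normc (V x' - V x) <= e.
  move=> e0; have eP : 0 < e / P by rewrite divr_gt0.
  pose S (a b : R) := `|a - x| <= 1 /\ 0 <= b <= P.
  have [||a b nS|a b _ e' e'0|d d0 hd] := @heine_cantor _ S G (`|x| + 1 + P) _ _ _ _ _ eP.
  - by have := normr_ge0 x; lra.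
  - move=> a b [h1 h2]; split.
      by have := ler_normD (a - x) x; rewrite subrK; lra.
    by have := normr_ge0 x; rewrite (ger0_norm (x := b)); lra.
  - have [h1|h1] := ltP 1 `|a - x|.
      exists (`|a - x| - 1); first by lra.
      move=> x' y' h2 _ [h3 _].
      by have := ler_normD (a - x') (x' - x); rewrite addrA subrK (distrC a x'); lra.
    have [h2|h2] := ltP b 0.
      exists (- b); first by lra.
      by move=> x' y' _; rewrite ltr_norml => h3 [_ h4]; lra.
    have [h3|h3] := ltP P b.
      exists (b - P); first by lra.
      by move=> x' y' _; rewrite ltr_norml => h4 [_ h5]; lra.
    by exfalso; apply: nS; split => //; apply/andP.
  - have [d d0 hd] := Gc a b e' e'0; exists d => // x' y' _; exact: hd.
  - exists (Num.min d 1); first by rewrite lt_min d0 ltr01.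
    move=> x'; rewrite lt_min => /andP[h1 h2].
    rewrite (_ : V x' - V x = (prim (G x') P - prim (G x) P) - (prim (G x') 0 - prim (G x) 0));
      last by rewrite /V; ring.
    rewrite (_ : e = e / P * (P - 0)); last by rewrite subr0 divfK// gt_eqF.
    apply: (@mvi_lip _ (fun t => prim (G x') t - prim (G x) t) (fun t => G x' t - G x t)).
    + exact: ltW.
    + by move=> t _; apply: rderB; exact: dV.
    + move=> t tP; apply: hd; rewrite ?subrr ?normr0//; split=> //; last exact: ltW.
      by rewrite subrr normr0.
have Vall x : x <= X -> V x = V X.
  move=> xX; have [ra0|ra0] := leP ra 0.
    by apply: Vconst => // t _; rewrite gt_eqF// (le_lt_trans ra0)// expR_gt0.
  pose xa := ln ra; have exa : expR xa = ra by rewrite /xa lnK// posrE.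
  have [xaX|Xxa] := leP xa X; last first.
    by apply: Vconst => // t tX; rewrite -exa lt_eqF// ltr_expR; lra.
  suff H y : y <= X -> V y = V xa by rewrite (H x xX) (H X (lexx X)).
  move=> yX; have [yxa|yxa|->//] := ltgtP y xa.
    apply: eq_of_small => e e0; have [d d0 hd] := Vcont xa e e0.
    pose t := Num.max y (xa - d / 2).
    have yt : y <= t by rewrite /t le_max lexx.
    have txa : t < xa by rewrite /t gt_max yxa/=; lra.
    have dt : xa - d / 2 <= t by rewrite /t le_max lexx orbT.
    rewrite (Vconst y t) //; first by apply: hd; rewrite ltr_norml; lra.
      by lra.
    by move=> u ut; rewrite -exa lt_eqF// ltr_expR; lra.
  apply: eq_of_small => e e0; have [d d0 hd] := Vcont xa e e0.
  pose t := Num.min y (xa + d / 2).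
  have yt : t <= y by rewrite /t ge_min lexx.
  have txa : xa < t by rewrite /t lt_min yxa/=; lra.
  have dt : t <= xa + d / 2 by rewrite /t ge_min lexx orbT.
  rewrite -(Vconst t y) //; first by apply: hd; rewrite ltr_norml; lra.
  by move=> u ut; rewrite -exa gt_eqF// ltr_expR; lra.
have VX : V X = P%:C%C * g 0.
  apply: eq_of_small => e e0; have eP : 0 < e / P by rewrite divr_gt0.
  have g0 : normc (0 : C) <= r by rewrite normc0E ltW.
  have [d d0 hd] := cg _ g0 _ eP.
  pose x := Num.min X (ln (d / 2)).
  have xX : x <= X by rewrite /x ge_min lexx.
  have ex : expR x < d.
    apply: (@le_lt_trans _ _ (d / 2)); last by lra.
    rewrite -[leRHS]lnK ?posrE ?divr_gt0// ler_expR /x ge_min lexx orbT//.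
  rewrite -(Vall x)// (_ : V x - _ = (prim (G x) P - (0 + P%:C%C * g 0)) -
    (prim (G x) 0 - (0 + 0%:C%C * g 0))); last by rewrite /V rmorph0; ring.
  rewrite (_ : e = e / P * (P - 0)); last by rewrite subr0 divfK// gt_eqF.
  apply: (@mvi_lip _ (fun t => prim (G x) t - (0 + t%:C%C * g 0)) (fun t => G x t - g 0)).
  - exact: ltW.
  - by move=> t _; apply: rderB; [exact: dV|exact: rder_line].
  - move=> t _; apply: hd; rewrite subr0 normc_cexp /=.
    by rewrite (min_idPl xX).
have GX y : G X y = g (r%:C%C * cis y) by rewrite /G minxx cexpE eX.
have h : ccvg \oo (fun n => (P^-1)%:C%C * \sum_(i < n.+1)
     ((P - 0) / n.+1%:R)%:C%C * G X (0 + i%:R * ((P - 0) / n.+1%:R))) ((P^-1)%:C%C * V X).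
  apply: ccvgM; first exact: ccvg_cst.
  by apply: (@riemann_sum _ (prim (G X)) (G X)) => //; exact: ltW.
move: h; rewrite VX mulrA -realCM mulVf ?gt_eqF// rmorph1 mul1r; apply: ccvg_ext => n.
rewrite subr0 /cavg -mulr_sumr mulrA -realCM mulrA mulVf ?gt_eqF// mul1r; congr (_ * _).
by apply: eq_bigr => i _; rewrite add0r GX.
Qed.

Lemma circle_mean_diff (g : C -> C) (r : R) : 0 < r ->
  (forall w, normc w <= r -> cdiff g w) -> ccvg \oo (cavg r g) (g 0).
Proof.
move=> r0 dg; apply: (@circle_mean _ _ 0) => // w /dg => -[l hl].
  exact: cder_cvg hl.
by exists l.
Qed.

End MeanValue.
Arguments omega {R}.

(** * The discrete Schwarz formula *)

Section Schwarz.
Variable R : realType.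
Local Notation C := R[i].

Lemma conjc_unit (z : C) : normc z = 1 -> (z^*)%C = z^-1.
Proof.
move=> z1; have z0 : z != 0 by rewrite -normc_gt0 z1.
apply: (mulIf z0); rewrite mulVf//; have := sqr_normcE z; rewrite z1 expr1n.
by case: z {z1 z0} => x y /= h; apply: complex_ext; rewrite /= ?h; ring.
Qed.

(** The Schwarz integral of [w |-> B (r w)], discretised at roots of unity. The signs are such that
    the weights [- Re B] are nonnegative and the kernel is that of the Herglotz representation. *)
Definition schwarz_sum (B : C -> C) (r : R) (n : nat) (z : C) : C :=
  'i%C * (complex.Im (B 0))%:C%C + (n.+1%:R^-1)%:C%C *
    \sum_(j < n.+1) (- complex.Re (B (r%:C%C * omega n j)))%:C%C *
      ((z + omega n j) / (z - omega n j)).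

(** At a node [o], with [b = B (r o)] and [a = r z], the summand equals
    [(b + conj b) * o / (o - z) - Re b]. Here [b * o / (o - z)] is [w q(w)] at [w = r o] plus
    [B a * o / (o - z)], where [q] is the divided difference of [B] at [a], and [o / (o - z)] is the
    conjugate of [1 / (1 - conj z * o)]. Each piece is thus a holomorphic function or the conjugate
    of one, and its mean tends to its value at 0. These values add up to [B a]. *)
Lemma schwarz_formula (B : C -> C) (r : R) (z : C) : 0 < r < 1 -> normc z < 1 ->
  (forall w, normc w < 1 -> cdiff B w) ->
  ccvg \oo (schwarz_sum B r ^~ z) (B (r%:C%C * z)).
Proof.
move=> /andP[r0 r1] z1 dB.
have rC0 : r%:C%C != 0 :> C by rewrite realC_eq0 gt_eqF.
pose a := r%:C%C * z.
have ar : normc a < r by rewrite /a normcM normc_real gtr0_norm// gtr_pMr.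
have a1 : normc a < 1 by apply: lt_trans r1.
have [l hl] := dB a a1.
pose q w := if w == a then l else (B w - B a) / (w - a).
have qE w : B w - B a = q w * (w - a).
  by rewrite /q; case: eqP => [->|/eqP wa]; rewrite ?subrr ?mulr0// divfK// subr_eq0.
have qd w : normc w <= r -> w != a -> cdiff q w.
  move=> wr wa; have [m hm] := dB w (le_lt_trans wr r1).
  have wa0 : w - a != 0 by rewrite subr_eq0.
  exists ((m - 0) * (w - a)^-1 + (B w - B a) * (- (1 - 0) / (w - a) ^+ 2)).
  have h : cder (fun v => (B v - B a) * (v - a)^-1) w
      ((m - 0) * (w - a)^-1 + (B w - B a) * (- (1 - 0) / (w - a) ^+ 2)).
    apply: (cderM (f := fun v => B v - B a) (g := fun v => (v - a)^-1)).
      by apply: cderB => //; exact: cder_cst.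
    apply: (cderV (f := fun v => v - a)) => //.
    by apply: cderB; [exact: cder_id|exact: cder_cst].
  apply: gder_ext h; first by rewrite /q (negbTE wa).
  exists (normc (w - a)); first by rewrite normc_gt0.
  move=> v vw; rewrite /q; case: eqP => // va; move: vw.
  by rewrite va distcC ltxx.
have qc w : normc w <= r -> ccvg (cnbhs w) q (q w).
  move=> wr; have [->|wa] := eqVneq w a; last by have [m /cder_cvg] := qd w wr wa.
  have -> : q a = l by rewrite /q eqxx.
  move=> e e0; apply: filterS (hl _ e0) => v hv; rewrite /q; case: eqP => [_|/eqP va].
    by rewrite subrr normc0E ltW.
  have va0 : v - a != 0 by rewrite subr_eq0.
  rewrite -(ler_pM2r (x := normc (v - a))) ?normc_gt0// -normcM.
  by rewrite mulrBl divfK.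
(* At [a] the divided difference is only known to be continuous; [|a|] is the exceptional radius
   that [circle_mean] admits. *)
have h1 : ccvg \oo (cavg r (fun w => w * q w)) (0 * q 0).
  apply: (@circle_mean _ (fun w => w * q w) _ (normc a)) => // w wr.
    by apply: ccvgM; [exact: ccvg_id|exact: qc].
  move=> wa _; have [|m hm] := qd w wr; first by apply: contraNneq wa => ->.
  by exists (1 * q w + w * m); apply: (cderM (f := id)) => //; exact: cder_id.
have dlin (c w : C) : 1 - c * w != 0 -> cdiff (fun v => (1 - c * v)^-1) w.
  move=> cw; exists (- (0 - c * 1) / (1 - c * w) ^+ 2).
  apply: (cderV (f := fun v => 1 - c * v)) => //.
  by apply: cderB; [exact: cder_cst|apply: cderZ; exact: cder_id].
have zc1 : normc (z^*)%C < 1 by rewrite normc_conj.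
have nz w : normc w <= 1 -> 1 - (z^*)%C * w != 0.
  move=> w1; apply: subc_neq0; rewrite normcM normc1E.
  apply: (@le_lt_trans _ _ (normc (z^*)%C)); last by [].
  by rewrite -[leRHS]mulr1 ler_wpM2l ?normc_ge0.
have h0 : ccvg \oo (cavg 1 (fun w => (1 - (z^*)%C * w)^-1)) (1 - (z^*)%C * 0)^-1.
  by apply: circle_mean_diff => // w w1; apply: dlin; exact: nz.
have h2 : ccvg \oo (cavg r (fun w => B w * (1 - (z^*)%C / r%:C%C * w)^-1))
    (B 0 * (1 - (z^*)%C / r%:C%C * 0)^-1).
  apply: circle_mean_diff => // w wr.
  have [m hm] := dB w (le_lt_trans wr r1).
  have [|k hk] := dlin ((z^*)%C / r%:C%C) w.
    rewrite -mulrA; apply: nz; rewrite mulrC normcM normcV normc_real gtr0_norm//.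
    by rewrite ler_pdivrMr// mul1r.
  by eexists; apply: cderM; [exact: hm|exact: hk].
have h3 : ccvg \oo (cavg r B) (B 0).
  by apply: circle_mean_diff => // w wr; apply: dB; exact: le_lt_trans r1.
have H : ccvg \oo (fun n => 'i%C * (complex.Im (B 0))%:C%C +
    (cavg r (fun w => w * q w) n + B a * ((cavg 1 (fun w => (1 - (z^*)%C * w)^-1) n)^*)%C
     + ((cavg r (fun w => B w * (1 - (z^*)%C / r%:C%C * w)^-1) n)^*)%C
     - (complex.Re (cavg r B n))%:C%C))
   ('i%C * (complex.Im (B 0))%:C%C + (0 * q 0 + B a * (((1 - (z^*)%C * 0)^-1)^*)%C
     + ((B 0 * (1 - (z^*)%C / r%:C%C * 0)^-1)^*)%C - (complex.Re (B 0))%:C%C)).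
  apply: ccvgD; first exact: ccvg_cst.
  apply: ccvgB; last exact: ccvg_ReC.
  apply: ccvgD; last exact: ccvg_conj.
  apply: ccvgD => //; apply: ccvgM; first exact: ccvg_cst.
  exact: ccvg_conj.
move: H; rewrite !mulr0 !subr0 !invr1 !mulr1 rmorph1 mul0r add0r mulr1 -/a.
rewrite (_ : 'i%C * _ + _ = B a); last first.
  by apply: complex_ext; rewrite !cReIm /=; case: (B 0) => x y /=; ring.
apply: ccvg_ext => n; rewrite /schwarz_sum; congr (_ + _).
have cRe_real (x : R) w : complex.Re (x%:C%C * w) = x * complex.Re w by rewrite cReM /= mul0r subr0.
have conj_real (x : R) (w : C) : ((x%:C%C * w)^*)%C = x%:C%C * (w^*)%C.
  by rewrite rmorphM; congr (_ * _); exact: conjc_real.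
rewrite /cavg cRe_real !conj_real realCM Re_sum realC_sum !rmorph_sum /=.
rewrite mulrCA -!mulrDr -mulrBr; congr (_ * _).
rewrite mulr_sumr -!big_split /= -sumrB; apply: eq_bigr => j _.
set o : C := omega n j; have o1 : normc o = 1 by exact: normc_omega.
clearbody o; have o0 : o != 0 by rewrite -normc_gt0 o1.
have oz : o - z != 0 by apply: subc_neq0; rewrite o1.
have zo : z - o != 0 by rewrite -opprB oppr_eq0.
set W := r%:C%C * o; set b := B W.
have -> : W * q W = o * (b - B a) / (o - z).
  have Wa : W != a by apply/eqP => /(mulfI rC0) E; move: oz; rewrite E subrr eqxx.
  rewrite /q (negbTE Wa) /W /a -/b -mulrBr; field.
  by rewrite oz rC0.
have oc := conjc_unit o1.
have rp : (((1 - (z^*)%C * (1%:C%C * o))^-1)^*)%C = o / (o - z).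
  rewrite rmorph1 mul1r fmorphV rmorphB rmorphM rmorph1 /= conjcK oc.
  by field; rewrite ?oz ?o0.
rewrite rp.
have -> : ((b * (1 - (z^*)%C / r%:C%C * W)^-1)^*)%C = (b^*)%C * (o / (o - z)).
  rewrite rmorphM /= -rp rmorph1 mul1r /W mulrA divfK//.
have -> : (- complex.Re b)%:C%C = - ((b + (b^*)%C) / 2) :> C by rewrite realCN ReJ_add.
rewrite ReJ_add; field.
by rewrite zo oz.
Qed.

End Schwarz.

(** * Integration over the circle *)

Section CircleIntegral.
Variable R : realType.
Local Notation C := R[i].
Local Notation T2 := (R * R)%type.
Local Notation circ := (@circleT R).

Lemma circleP (p : T2) : circ p <-> normc (pt p) = 1.
Proof.
rewrite /circleT /pt /=; split=> [->|/(congr1 (fun x => x ^+ 2))]; first exact: sqrtr1.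
by rewrite sqr_sqrtr ?expr1n// addr_ge0// sqr_ge0.
Qed.

Lemma cis_circle (y : R) : circ (cos y, sin y).
Proof. exact: cos2Dsin2. Qed.

Lemma pt_cis (y : R) : pt (cos y, sin y) = cis y. Proof. by []. Qed.

Definition tnbhs (p : T2) : set_system T2 := fun A => exists2 d : R, 0 < d &
  forall q, circ q -> `|q.1 - p.1| < d -> `|q.2 - p.2| < d -> A q.

#[global] Instance tnbhs_filter p : Filter (tnbhs p).
Proof.
split; first by exists 1.
- move=> A B [d d0 hA] [d' d'0 hB]; exists (Num.min d d'); first by rewrite lt_min d0.
  move=> q cq; rewrite !lt_min => /andP[? ?] /andP[? ?].
  by split; [exact: hA|exact: hB].
- by move=> A B AB [d d0 hA]; exists d => // q cq h1 h2; apply/AB/hA.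
Qed.

Definition contT (f : T2 -> C) := forall p, circ p -> ccvg (tnbhs p) f (f p).

Lemma contT_pt : contT (@pt R).
Proof.
move=> p _ e e0; exists (e / 2); first by rewrite divr_gt0.
move=> q _ h1 h2; apply: le_trans (normc_le_ReIm _) _.
by rewrite !cReIm /=; lra.
Qed.

Lemma contT_cst c : contT (fun=> c). Proof. by move=> p _; exact: ccvg_cst. Qed.
Lemma contTD f g : contT f -> contT g -> contT (fun p => f p + g p).
Proof. by move=> cf cg p cp; apply: ccvgD; [exact: cf|exact: cg]. Qed.
Lemma contTB f g : contT f -> contT g -> contT (fun p => f p - g p).
Proof. by move=> cf cg p cp; apply: ccvgB; [exact: cf|exact: cg]. Qed.
Lemma contTM f g : contT f -> contT g -> contT (fun p => f p * g p).
Proof. by move=> cf cg p cp; apply: ccvgM; [exact: cf|exact: cg]. Qed.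
Lemma contTV f : (forall p, circ p -> f p != 0) -> contT f -> contT (fun p => (f p)^-1).
Proof. by move=> f0 cf p cp; apply: ccvgV; [exact: f0|exact: cf]. Qed.
Lemma contT_conj f : contT f -> contT (fun p => (f p)^*%C).
Proof. by move=> cf p cp; apply: ccvg_conj; exact: cf. Qed.
Lemma contT_ReC f : contT f -> contT (fun p => (complex.Re (f p))%:C%C).
Proof. by move=> cf p cp; apply: ccvg_ReC; exact: cf. Qed.
Lemma contT_sum (I : Type) (r : seq I) (f : I -> T2 -> C) :
  (forall i, contT (f i)) -> contT (fun p => \sum_(i <- r) f i p).
Proof. by move=> cf p cp; apply: ccvg_sum => i; exact: cf. Qed.
Lemma contT_ext f g : (forall p, circ p -> f p = g p) -> contT f -> contT g.
Proof.
move=> fg cf p cp e e0; have [d d0 hd] := cf p cp e e0.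
by exists d => // q cq h1 h2; rewrite -!fg//; exact: hd.
Qed.

Lemma circ_le1 (p : T2) : circ p -> `|p.1| <= 1 /\ `|p.2| <= 1.
Proof.
move=> /circleP p1; have := Re_le_normc (pt p); have := Im_le_normc (pt p).
by rewrite p1.
Qed.

Lemma circ_closed (x y : R) : ~ circ (x, y) -> exists2 d, 0 < d &
  forall x' y', `|x' - x| < d -> `|y' - y| < d -> ~ circ (x', y').
Proof.
move=> nc; pose n := normc (Complex x y).
have n1 : n != 1 by apply/eqP => h; apply: nc; apply/circleP.
exists (`|n - 1| / 2); first by rewrite divr_gt0// normr_gt0 subr_eq0.
move=> x' y' hx hy /circleP; rewrite /pt /= -/(normc (Complex x' y')) => h.
have h1 : normc (Complex x' y' - Complex x y) <= `|x' - x| + `|y' - y| := normc_le_ReIm _.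
have := normcD (Complex x' y' - Complex x y) (Complex x y).
have := normcB (Complex x' y') (Complex x' y' - Complex x y).
rewrite (_ : Complex x' y' - (Complex x' y' - Complex x y) = Complex x y); last by ring.
rewrite subrK -/n h => h2 h3.
have : `|n - 1| <= `|x' - x| + `|y' - y| by rewrite ler_norml; lra.
lra.
Qed.

Lemma contT_unif f : contT f -> forall e, 0 < e -> exists2 d, 0 < d & forall p q,
  circ p -> circ q -> `|q.1 - p.1| < d -> `|q.2 - p.2| < d -> normc (f q - f p) <= e.
Proof.
move=> cf e e0.
have [|x y /circ_le1//|x y /circ_closed//|x y cxy e' e'0|d d0 hd] :=
  @heine_cantor R (fun x y => circ (x, y)) (fun x y => f (x, y)) 1 _ _ _ _ e e0 => //.
  have [d d0 hd] := cf _ cxy e' e'0; exists d => // x' y' c' h1 h2.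
  exact: (hd (x', y')).
by exists d => // -[x y] [x' y'] cp cq /= h1 h2; exact: hd.
Qed.

Lemma contT_bounded f : contT f -> exists M, forall p, circ p -> normc (f p) <= M.
Proof.
move=> cf.
pose P a b c d := exists M, forall p, a <= p.1 <= b -> c <= p.2 <= d ->
    circ p -> normc (f p) <= M.
have [M hM] : P (-1) 1 (-1) 1.
  apply: box_induction; try lra.
    move=> a b c d _ m n [M1 h1] [M2 h2] [M3 h3] [M4 h4].
    exists (Num.max (Num.max M1 M2) (Num.max M3 M4)) => p /andP[ap pb] /andP[cp pd] pc.
    rewrite !le_max.
    have [xm|/ltW xm] := leP p.1 m; have [yn|/ltW yn] := leP p.2 n.
    - by rewrite h1 ?ap ?cp.
    - by rewrite h3 ?ap ?yn ?orbT.
    - by rewrite h2 ?xm ?cp ?orbT.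
    - by rewrite h4 ?xm ?yn ?orbT.
  move=> x y _ _; have [cxy|/circ_closed[d d0 hd]] := pselect (circ (x, y)); last first.
    exists d => // a b c d' _ xab ycd ba dc; exists 0 => -[u v] /= uab vcd cuv.
    by exfalso; apply: (hd u v) => //; rewrite ltr_norml; lra.
  have [d d0 hd] := cf _ cxy 1 ltr01.
  exists d => // a b c d' _ xab ycd ba dc; exists (1 + normc (f (x, y))) => -[u v] /= uab vcd cuv.
  have := normcD (f (u, v) - f (x, y)) (f (x, y)); rewrite subrK => h.
  apply: (le_trans h); rewrite lerD2r; apply: hd => //=; rewrite ltr_norml; lra.
exists M => p cp; have [h1 h2] := circ_le1 cp.
by apply: hM => //; rewrite -ler_norml.
Qed.

Lemma measurable_circle : measurable circ.
Proof.
have mf : measurable_fun [set: T2] (fun p : T2 => p.1 ^+ 2 + p.2 ^+ 2).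
  by apply: measurable_funD; apply: measurable_funX; [exact: measurable_fst|exact: measurable_snd].
have -> : circ = [set: T2] `&` (fun p : T2 => p.1 ^+ 2 + p.2 ^+ 2) @^-1` [set 1].
  by rewrite setTI.
by apply: mf => //; exact: measurable_set1.
Qed.

Definition rat_box (i : rat * rat * nat) : set T2 :=
  [set q | `|q.1 - ratr i.1.1| < i.2.+1%:R^-1 /\ `|q.2 - ratr i.1.2| < i.2.+1%:R^-1].

Lemma measurable_rat_box i : measurable (rat_box i).
Proof.
have -> : rat_box i = ball (ratr i.1.1 : R) (i.2.+1%:R^-1) `*` ball (ratr i.1.2 : R) (i.2.+1%:R^-1).
  by apply/seteqP; split=> -[x y] [] /=; rewrite /ball/= distrC (distrC _ y).
by apply: measurableX; exact: measurable_ball.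
Qed.

(** The preimage of an open ray is the trace on the circle of a countable union: the rational boxes
    whose points on the circle all have value above [a]. *)
Lemma contT_measurable (f : T2 -> R) : contT (fun p => (f p)%:C%C) -> measurable_fun circ f.
Proof.
move=> cf; apply: (measurability (@RGenOInfty.G R)) => [|/= _ [_] [a] -> <-].
  exact: RGenOInfty.measurableE.
pose F i := if pselect (forall q, circ q -> rat_box i q -> a < f q) then rat_box i else set0.
have -> : circ `&` f @^-1` `]a, +oo[%classic = circ `&` \bigcup_i F i.
  apply/seteqP; split=> [p [cp]|p [cp [i _]]]; last first.
    rewrite /F; case: pselect => // h pi; split=> //=; rewrite in_itv/= andbT.
    by have := h p cp pi.
  rewrite /= in_itv/= andbT => afp; split=> //.
  have e0 : 0 < (f p - a) / 2 by lra.
  have [d d0 hd] := cf p cp _ e0.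
  (* Boxes of radius below [d / 2], so that two points of one box differ by less than [d] in each
     coordinate. *)
  pose n := Num.bound (2 / d).
  have n0 : 0 < n.+1%:R^-1 :> R by rewrite invr_gt0.
  have nd : n.+1%:R^-1 < d / 2.
    rewrite -[ltRHS]invrK ltf_pV2 ?posrE ?invr_gt0 ?divr_gt0//.
    rewrite invf_div; apply: (@lt_trans _ _ n%:R); last by rewrite ltr_nat.
    by apply: archi_boundP; rewrite divr_ge0// ltW.
  have ratx (t x : R) : 0 < t -> exists q : rat, `|x - ratr q| < t.
    move=> t0; have [|q] := @rat_in_itvoo R (x - t) (x + t); first by lra.
    by rewrite in_itv/= => /andP[? ?]; exists q; rewrite ltr_norml; lra.
  have [q1 h1] := ratx _ p.1 n0; have [q2 h2] := ratx _ p.2 n0.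
  exists ((q1, q2), n) => //; rewrite /F; case: pselect => [h|nh]; first by split.
  exfalso; apply: nh => q cq [/= h3 h4].
  move: (n.+1%:R^-1) nd h1 h2 h3 h4 => t nd h1 h2 h3 h4.
  have h5 : `|q.1 - p.1| < d by move: h1 h3; rewrite !ltr_norml; lra.
  have h6 : `|q.2 - p.2| < d by move: h2 h4; rewrite !ltr_norml; lra.
  have := hd q cq h5 h6; rewrite -realCB normc_real ler_norml; lra.
apply: measurableI; first exact: measurable_circle.
apply: countable_bigcupT_measurable; first exact: countableP.
by move=> i; rewrite /F; case: pselect => h /=; [exact: measurable_rat_box|exact: measurable0].
Qed.

Section Measure.
Variable m : {measure set T2 -> \bar R}.
Hypothesis mfin : (m circ < +oo)%E.

Lemma contT_integrable (f : T2 -> R) : contT (fun p => (f p)%:C%C) ->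
  m.-integrable circ (EFin \o f).
Proof.
move=> cf; have [M hM] := contT_bounded cf.
apply: measurable_bounded_integrable => //; first exact: measurable_circle.
  exact: contT_measurable.
exists M; split; first exact: num_real.
move=> x Mx p cp /=; apply: le_trans (ltW Mx).
by have := hM p cp; rewrite normc_real.
Qed.

Lemma contT_Re f : contT f -> contT (fun p => (complex.Re (f p))%:C%C).
Proof. exact: contT_ReC. Qed.

Lemma contT_Im f : contT f -> contT (fun p => (complex.Im (f p))%:C%C).
Proof.
move=> cf; apply: (@contT_ext (fun p => (complex.Re (- 'i%C * f p))%:C%C)).
  by move=> p _; congr (_%:C%C); rewrite !cReIm /=; ring.
by apply: contT_ReC; apply: contTM => //; exact: contT_cst.
Qed.

Lemma Re_cint f : complex.Re (cint m f) = Rintegral m circ (fun p => complex.Re (f p)).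
Proof. by rewrite /cint !cReIm /=; ring. Qed.

Lemma Im_cint f : complex.Im (cint m f) = Rintegral m circ (fun p => complex.Im (f p)).
Proof. by rewrite /cint !cReIm /=; ring. Qed.

Lemma eq_cint f g : (forall p, circ p -> f p = g p) -> cint m f = cint m g.
Proof.
move=> fg; apply: complex_ext; rewrite ?Re_cint ?Im_cint; apply: eq_Rintegral => p;
  by rewrite inE => /fg ->.
Qed.

Lemma cintD f g : contT f -> contT g -> cint m (fun p => f p + g p) = cint m f + cint m g.
Proof.
move=> cf cg; apply: complex_ext.
  rewrite Re_cint (cReD (cint m f)) !Re_cint.
  rewrite -RintegralD; [|exact: measurable_circle|exact/contT_integrable/contT_Re|exact/contT_integrable/contT_Re].
  by apply: eq_Rintegral => p _; rewrite cReD.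
rewrite Im_cint (cImD (cint m f)) !Im_cint.
rewrite -RintegralD; [|exact: measurable_circle|exact/contT_integrable/contT_Im|exact/contT_integrable/contT_Im].
by apply: eq_Rintegral => p _; rewrite cImD.
Qed.

Lemma cintZ c f : contT f -> cint m (fun p => c * f p) = c * cint m f.
Proof.
move=> cf.
have iRe := contT_integrable (contT_Re cf); have iIm := contT_integrable (contT_Im cf).
have mc := measurable_circle.
have iZ (r : R) (g : T2 -> R) : contT (fun p => (g p)%:C%C) -> contT (fun p => (r * g p)%:C%C).
  move=> cg; apply: (@contT_ext (fun p => r%:C%C * (g p)%:C%C)); first by move=> p _; rewrite realCM.
  by apply: contTM => //; exact: contT_cst.
apply: complex_ext.
  rewrite Re_cint (cReM c (cint m f)) Re_cint Im_cint -!RintegralZl//.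
  rewrite -RintegralB//; [|exact/contT_integrable/iZ/contT_Re|exact/contT_integrable/iZ/contT_Im].
  by apply: eq_Rintegral => p _; rewrite cReM.
rewrite Im_cint (cImM c (cint m f)) Re_cint Im_cint -!RintegralZl//.
rewrite -RintegralD//; [|exact/contT_integrable/iZ/contT_Im|exact/contT_integrable/iZ/contT_Re].
by apply: eq_Rintegral => p _; rewrite cImM.
Qed.

Lemma cintB f g : contT f -> contT g -> cint m (fun p => f p - g p) = cint m f - cint m g.
Proof.
move=> cf cg.
rewrite -[X in _ + X]mulN1r -cintZ// -cintD//; last by apply: contTM => //; exact: contT_cst.
by apply: eq_cint => p _; rewrite mulN1r.
Qed.

Lemma cint_cst c : cint m (fun=> c) = (fine (m circ))%:C%C * c.
Proof.
have mc := measurable_circle.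
by apply: complex_ext; rewrite ?Re_cint ?Im_cint Rintegral_cst// !cReIm /=; ring.
Qed.

Lemma cint_sum (I : Type) (r : seq I) (f : I -> T2 -> C) : (forall i, contT (f i)) ->
  cint m (fun p => \sum_(i <- r) f i p) = \sum_(i <- r) cint m (f i).
Proof.
move=> cf; elim: r => [|i r IH].
  rewrite big_nil -[RHS](mulr0 (fine (m circ))%:C%C) -cint_cst.
  by apply: eq_cint => p _; rewrite big_nil.
rewrite big_cons -IH -cintD//; last exact: contT_sum.
by apply: eq_cint => p _; rewrite big_cons.
Qed.

Lemma cint_conj f : contT f -> cint m (fun p => (f p)^*%C) = ((cint m f)^*)%C.
Proof.
move=> cf.
have ReJ (z : C) : complex.Re (z^*)%C = complex.Re z by case: z.
have ImJ (z : C) : complex.Im (z^*)%C = - complex.Im z by case: z.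
apply: complex_ext; rewrite ?ReJ ?ImJ ?Re_cint ?Im_cint.
  by apply: eq_Rintegral => p _; rewrite ReJ.
rewrite -mulN1r -RintegralZl//; first by apply: eq_Rintegral => p _; rewrite ImJ mulN1r.
  exact: measurable_circle.
exact/contT_integrable/contT_Im.
Qed.

Lemma Re_cint_ge0 f : (forall p, circ p -> 0 <= complex.Re (f p)) -> 0 <= complex.Re (cint m f).
Proof. by move=> f0; rewrite Re_cint; exact: Rintegral_ge0. Qed.

Lemma Rint_le (f : T2 -> R) M : contT (fun p => (f p)%:C%C) ->
  (forall p, circ p -> `|f p| <= M) -> `|Rintegral m circ f| <= M * fine (m circ).
Proof.
move=> cf fM; have mc := measurable_circle.
have i1 := contT_integrable cf.
apply: le_trans (le_normr_Rintegral mc i1) _.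
rewrite -Rintegral_cst//; apply: le_Rintegral => //.
- exact: integrable_norm.
- by apply: (contT_integrable (f := fun=> M)); exact: (contT_cst (M%:C)%C).
Qed.

(** The factor 2 comes from bounding real and imaginary parts separately. Where the sharp constant
    matters, for [|eta z| <= |z|], [jensen] is used instead. *)
Lemma cint_norm f M : contT f -> (forall p, circ p -> normc (f p) <= M) ->
  normc (cint m f) <= 2 * (M * fine (m circ)).
Proof.
move=> cf fM; apply: le_trans (normc_le_ReIm _) _; rewrite Re_cint Im_cint.
have := @Rint_le (fun p => complex.Re (f p)) M (contT_Re cf).
have := @Rint_le (fun p => complex.Im (f p)) M (contT_Im cf).
move=> h1 h2.
have {}h1 := h1 (fun p cp => le_trans (Im_le_normc _) (fM p cp)).
have {}h2 := h2 (fun p cp => le_trans (Re_le_normc _) (fM p cp)).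
lra.
Qed.

(** Differentiation under the integral with an explicit remainder: the integrand deviates from its
    linear part by [c a^2 (w - z)^2 / ((1 - w a) (1 - z a)^2)], and each denominator is at least
    [s]. *)
Lemma cder_cauchy (c a : T2 -> C) z : contT c -> contT a ->
  (forall p, circ p -> normc (a p) = 1) -> normc z < 1 ->
  cder (fun w => cint m (fun p => c p * (1 - w * a p)^-1)) z
    (cint m (fun p => c p * (a p * ((1 - z * a p)^-1 * (1 - z * a p)^-1)))).
Proof.
move=> cc ca a1 z1.
have nz w p : normc w < 1 -> circ p -> 1 - w * a p != 0.
  by move=> w1 cp; apply: subc_neq0; rewrite normcM a1// mulr1 normc1E.
have ck w : normc w < 1 -> contT (fun p => (1 - w * a p)^-1).
  move=> w1; apply: contTV => [p cp|]; first exact: nz.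
  by apply: contTB; [exact: contT_cst|apply: contTM => //; exact: contT_cst].
have [Mc hMc] := contT_bounded cc.
have Mc0 : 0 <= Mc by apply: le_trans (hMc _ (cis_circle 0)); exact: normc_ge0.
(* Half the distance from [z] to the unit circle, so that nearby [w] satisfy [|w| < 1 - s] too. *)
pose s := (1 - normc z) / 2; have s0 : 0 < s by rewrite divr_gt0// subr_gt0.
have low w p : normc w < 1 - s -> circ p -> normc (1 - w * a p)^-1 <= s^-1.
  move=> ws cp; rewrite normcV lef_pV2 ?posrE//; last first.
    by rewrite normc_gt0 nz// ; lra.
  have := normcD (1 - w * a p) (w * a p); rewrite subrK normc1E normcM a1// mulr1; lra.
have m0 : 0 <= fine (m circ) by rewrite fine_ge0.
pose K := 2 * (Mc * s^-1 ^+ 3 * fine (m circ)).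
have K0 : 0 <= K by rewrite /K mulr_ge0// mulr_ge0// mulr_ge0// exprn_ge0// invr_ge0 ltW.
have zs : normc z < 1 - s by rewrite /s; lra.
move=> e e0; exists (Num.min s (e / (K + 1))).
  by rewrite lt_min s0 divr_gt0// ltr_wpDl.
move=> w; rewrite lt_min => /andP[ws we].
have w1s : normc w < 1 - s.
  by have := normcD (w - z) z; rewrite subrK /s; rewrite /s in ws; lra.
have w1 : normc w < 1 by lra.
have cG : contT (fun p => c p * (a p * ((1 - z * a p)^-1 * (1 - z * a p)^-1))).
  by apply: contTM => //; apply: contTM => //; apply: contTM; exact: ck.
have cw : contT (fun p => c p * (1 - w * a p)^-1) by apply: contTM => //; exact: ck.
have cz : contT (fun p => c p * (1 - z * a p)^-1) by apply: contTM => //; exact: ck.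
rewrite mulrC -cintZ// -cintB// -cintB//; first last.
- by apply: contTM => //; exact: contT_cst.
- exact: contTB.
apply: (@le_trans _ _ (K * normc (w - z) ^+ 2)); last first.
  rewrite expr2 mulrA ler_wpM2r ?normc_ge0//.
  have : (K + 1) * normc (w - z) <= e by rewrite mulrC -ler_pdivlMr ?ltr_wpDl// ltW.
  have := normc_ge0 (w - z); nra.
rewrite (_ : K * _ = 2 * ((Mc * s^-1 ^+ 3 * normc (w - z) ^+ 2) * fine (m circ)));
  last by rewrite /K; ring.
apply: cint_norm.
  by apply: contTB; [exact: contTB|apply: contTM => //; exact: contT_cst].
move=> p cp; have h1 := nz _ _ z1 cp; have h2 := nz _ _ w1 cp.
rewrite (_ : _ - _ = c p * ((1 - z * a p)^-1 * ((1 - z * a p)^-1 * (1 - w * a p)^-1)) *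
   (a p * a p) * ((w - z) * (w - z))); last by field; rewrite h1 h2.
rewrite !normcM a1// !mulr1 -expr2; apply: ler_pM; rewrite ?sqr_ge0 ?mulr_ge0 ?normc_ge0//.
apply: ler_pM; rewrite ?mulr_ge0 ?normc_ge0 ?hMc//.
rewrite exprS; apply: ler_pM; rewrite ?mulr_ge0 ?normc_ge0 ?low//.
by rewrite expr2; apply: ler_pM; rewrite ?normc_ge0 ?low.
Qed.

End Measure.
End CircleIntegral.

(** * The transforms of a probability measure *)

Section Transforms.
Variable R : realType.
Local Notation C := R[i].
Local Notation T2 := (R * R)%type.
Local Notation circ := (@circleT R).
Local Notation eta := (@Defs.eta R).

Lemma prob_circle (m : PT R) : onT m -> m circ = 1%E.
Proof.
move=> mT; have h := probability_setC m (@measurable_circle R).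
have : (1 - m circ)%E = 0%E by rewrite -h.
have : m circ \is a fin_num by rewrite fin_num_measure//; exact: measurable_circle.
case: (m circ) => // r _ /eqP; rewrite -EFinB eqe subr_eq0 => /eqP E.
by rewrite -E.
Qed.

Lemma prob_circle_fin (m : PT R) : (m circ < +oo)%E.
Proof.
have : m circ \is a fin_num by rewrite fin_num_measure//; exact: measurable_circle.
by case: (m circ) => // r _; rewrite ltry.
Qed.

Lemma circ_norm1 (p : T2) : circ p -> normc (pt p) = 1. Proof. by move/circleP. Qed.

Lemma kernel_neq0 (z : C) p : normc z < 1 -> circ p -> 1 - z * pt p != 0.
Proof. by move=> z1 cp; apply: subc_neq0; rewrite normcM circ_norm1// mulr1 normc1E. Qed.

Lemma contT_kernel (z : C) : normc z < 1 -> contT (fun p => (1 - z * pt p)^-1).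
Proof.
move=> z1; apply: contTV => [p cp|]; first exact: kernel_neq0.
by apply: contTB; [exact: contT_cst|apply: contTM; [exact: contT_cst|exact: contT_pt]].
Qed.

(* With [v = 1 / (1 - z zeta)]: [kint = 1 + psi], [z chi = psi] and [chi / kint]
   is the function [h] of the convolution. *)
Definition kint (m : PT R) (z : C) : C := cint m (fun p => (1 - z * pt p)^-1).
Definition chi (m : PT R) (z : C) : C := cint m (fun p => pt p * (1 - z * pt p)^-1).

Section Prob.
Variable m : PT R.
Hypothesis mT : onT m.
Let mfin := prob_circle_fin m.

Lemma cint1 c : cint m (fun=> c) = c.
Proof.
rewrite cint_cst -[RHS]mul1r -[1 in RHS]/((1 : R)%:C)%C; congr (_%:C%C * _).
exact: (congr1 fine (prob_circle mT)).
Qed.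

Lemma psi_kint z : normc z < 1 -> psi m z = kint m z - 1.
Proof.
move=> z1; rewrite -[X in _ = _ - X](cint1 1) -(cintB mfin); [|exact: contT_kernel|exact: contT_cst].
apply: eq_cint => p cp; have := kernel_neq0 z1 cp => h.
by field.
Qed.

Lemma psi_chi z : normc z < 1 -> psi m z = z * chi m z.
Proof.
move=> z1; rewrite -(cintZ mfin); last by apply: contTM; [exact: contT_pt|exact: contT_kernel].
by apply: eq_cint => p cp; rewrite mulrA.
Qed.

Lemma normc_sqr_conj (v : C) : (normc v ^+ 2)%:C%C = v * (v^*)%C.
Proof. by rewrite sqr_normcE; apply: complex_ext; case: v => x y /=; ring. Qed.

(** The variance, the integral of [|v - cint m v|^2], is nonnegative. *)
Lemma jensen v : contT v ->
  normc (cint m v) ^+ 2 <= complex.Re (cint m (fun p => v p * (v p)^*%C)).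
Proof.
move=> cv; set a := cint m v.
have cvj := contT_conj cv.
have := @Re_cint_ge0 _ m (fun p => (v p - a) * ((v p - a)^*)%C).
have -> : cint m (fun p => (v p - a) * ((v p - a)^*)%C) =
    cint m (fun p => v p * (v p)^*%C) - (normc a ^+ 2)%:C%C.
  rewrite normc_sqr_conj.
  have -> : cint m (fun p => (v p - a) * ((v p - a)^*)%C) =
      cint m (fun p => v p * (v p)^*%C - ((a^*)%C * v p + a * (v p)^*%C - a * (a^*)%C)).
    by apply: eq_cint => p _; rewrite rmorphB /=; ring.
  rewrite (cintB mfin); last 2 first.
  - exact: contTM.
  - apply: contTB; last exact: contT_cst.
    by apply: contTD; apply: contTM => //; exact: contT_cst.
  rewrite (cintB mfin); last 2 first.
  - by apply: contTD; apply: contTM => //; exact: contT_cst.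
  - exact: contT_cst.
  rewrite (cintD mfin); last 2 first.
  - by apply: contTM => //; exact: contT_cst.
  - by apply: contTM => //; exact: contT_cst.
  by rewrite (cintZ mfin (a^*)%C cv) (cintZ mfin a cvj) (cint_conj mfin cv) cint1 -/a; ring.
rewrite (cReD (cint m _)) cReN /= => h; rewrite -subr_ge0; apply: h => p _.
by rewrite -normc_sqr_conj /= sqr_ge0.
Qed.

(** The map [w |-> 1 / (1 - w)] sends the disc into the half-plane [Re > 1/2]. *)
Lemma Re_kint z : normc z < 1 -> 1 / 2 <= complex.Re (kint m z).
Proof.
move=> z1; rewrite -subr_ge0.
have -> : complex.Re (kint m z) - 1 / 2 = complex.Re (kint m z - (1 / 2)%:C%C).
  by rewrite (cReD (kint m z)) cReN.
rewrite -(cint1 (1 / 2)%:C%C) -(cintB mfin); [|exact: contT_kernel|exact: contT_cst].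
apply: Re_cint_ge0 => p cp; have h := kernel_neq0 z1 cp.
have n0 : 0 < normc (1 - z * pt p) by rewrite normc_gt0.
have z2 : normc (z * pt p) ^+ 2 < 1.
  by rewrite normcM circ_norm1// mulr1 expr_lt1// normc_ge0.
have hV (u : C) : u != 0 -> complex.Re u^-1 = complex.Re u / normc u ^+ 2.
  by move=> u0; rewrite sqr_normcE; case: u u0 => x y _ /=.
rewrite cReD cReN hV//= subr_ge0 ler_pdivlMr ?exprn_gt0//.
move: z2; rewrite !sqr_normcE !cReD !cImD !cReN !cImN /=; nra.
Qed.

Lemma kint_neq0 z : normc z < 1 -> kint m z != 0.
Proof.
move=> /Re_kint h; apply: contraTneq h => -> /=; rewrite -ltNge; lra.
Qed.

(** This is [|eta z| <= |z|]. With [v = 1 / (1 - z zeta)], mean [a] and [r = |z|], pointwise algebra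
    gives [(1 - r^2) |v|^2 = v + conj v - 1]. Integrating and applying [jensen] yields
    [(1 - r^2) |a|^2 <= 2 Re a - 1], that is [|a - 1| <= r |a|], where [a - 1 = z chi]. At the
    origin [z] cannot be divided out, and [chi] is the first moment. *)
Lemma chi_le_kint z : normc z < 1 -> normc (chi m z) <= normc (kint m z).
Proof.
move=> z1; have [->|z0] := eqVneq z 0.
  have -> : kint m 0 = 1.
    by rewrite -[RHS]cint1; apply: eq_cint => p _; rewrite mul0r subr0 invr1.
  have -> : chi m 0 = cint m (@pt R).
    by apply: eq_cint => p _; rewrite mul0r subr0 invr1 mulr1.
  rewrite normc1E -(@ler_pXn2r _ 2)// ?nnegrE ?normc_ge0// expr1n.
  apply: le_trans (jensen (@contT_pt R)) _.
  rewrite (@eq_cint _ _ _ (fun=> 1)) ?cint1//.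
  by move=> p cp; rewrite -normc_sqr_conj circ_norm1// expr1n.
have zn0 : 0 < normc z by rewrite normc_gt0.
rewrite -(ler_pM2l zn0) -!normcM -psi_chi// psi_kint//.
set a := kint m z; set r := normc z.
have ck := contT_kernel z1.
have hj := jensen ck; rewrite -/(kint m z) -/a in hj.
have E : (1 - r ^+ 2)%:C%C * cint m (fun p => (1 - z * pt p)^-1 * ((1 - z * pt p)^-1)^*%C) =
    a + (a^*)%C - 1.
  rewrite -(cintZ mfin); last by apply: contTM => //; exact: contT_conj.
  rewrite -(cint_conj mfin)// -(cintD mfin)//; last exact: contT_conj.
  rewrite -[X in _ = _ - X](cint1 1) -(cintB mfin); last 2 first.
  - by apply: contTD => //; exact: contT_conj.
  - exact: contT_cst.
  apply: eq_cint => p cp; have h := kernel_neq0 z1 cp.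
  have pp : pt p * ((pt p)^*)%C = 1 by rewrite -normc_sqr_conj circ_norm1// expr1n.
  have hc : 1 - (z^*)%C * (pt p)^*%C != 0.
    by apply: contraNneq h => E; rewrite -conjc_eq0 rmorphB rmorphM rmorph1 E.
  rewrite realCB rmorph1 /r normc_sqr_conj fmorphV rmorphB rmorphM rmorph1 /=.
  rewrite -[(p.1 -i* p.2)%C]/((pt p)^*)%C.
  have -> : z * (z^*)%C = (z * pt p) * ((z^*)%C * (pt p)^*%C) by rewrite mulrACA pp mulr1.
  by field; rewrite h hc.
have r1 : r ^+ 2 < 1 by rewrite expr_lt1// normc_ge0.
rewrite -(@ler_pXn2r _ 2)// ?nnegrE ?normc_ge0//.
rewrite !normcM exprMn -/r (sqr_normcE (a - 1)).
move: (cint m _) hj E => A hj E; clearbody a.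
have E' : (1 - r ^+ 2) * complex.Re A = 2 * complex.Re a - 1.
  have -> : (1 - r ^+ 2) * complex.Re A = complex.Re ((1 - r ^+ 2)%:C%C * A).
    by rewrite cReM /= mul0r subr0.
  by rewrite E !cReD; case: (a) => x y /=; ring.
have h2 : (1 - r ^+ 2) * normc a ^+ 2 <= 2 * complex.Re a - 1.
  by rewrite -E' ler_wpM2l//; lra.
rewrite !cReD !cImD !cReN !cImN /=.
move: h2; rewrite (sqr_normcE a); nra.
Qed.

Lemma cder_kint z : normc z < 1 -> cdiff (kint m) z.
Proof.
move=> z1.
have h := @cder_cauchy _ m mfin (fun=> 1) (@pt R) z (contT_cst 1) (@contT_pt R) circ_norm1 z1.
eexists; apply: gder_ext h => /=.
  by apply: eq_cint => p _; rewrite mul1r.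
by apply: filterE => w; apply: eq_cint => p _; rewrite mul1r.
Qed.

Lemma cder_chi z : normc z < 1 -> cdiff (chi m) z.
Proof.
move=> z1.
by eexists; exact: (@cder_cauchy _ m mfin (@pt R) (@pt R) z (@contT_pt R) (@contT_pt R) circ_norm1 z1).
Qed.

Definition hh z := chi m z / kint m z.

Lemma cdiff_hh z : normc z < 1 -> cdiff hh z.
Proof.
move=> z1; have [a ha] := cder_chi z1; have [b hb] := cder_kint z1.
eexists; apply: cderM; first exact: ha.
by apply: cderV; [exact: kint_neq0|exact: hb].
Qed.

Lemma normc_hh z : normc z < 1 -> normc (hh z) <= 1.
Proof.
move=> z1; rewrite normcM normcV ler_pdivrMr ?mul1r ?chi_le_kint//.
by rewrite normc_gt0 kint_neq0.
Qed.

Lemma eta_hh z : normc z < 1 -> eta m z = z * hh z.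
Proof.
move=> z1; rewrite /Defs.eta {2}psi_kint// psi_chi// /hh (addrC 1) subrK.
by rewrite mulrA.
Qed.

Lemma normc_eta z : normc z < 1 -> normc (eta m z) <= normc z.
Proof.
by move=> z1; rewrite eta_hh// normcM -[leRHS]mulr1 ler_wpM2l ?normc_ge0 ?normc_hh.
Qed.

Lemma cdiff_eta z : normc z < 1 -> cdiff (eta m) z.
Proof.
move=> z1; have [l hl] := cdiff_hh z1.
exists (1 * hh z + z * l).
have h : cder (fun w => w * hh w) z (1 * hh z + z * l).
  by apply: (cderM (f := id)) => //; exact: cder_id.
apply: gder_ext h; first by rewrite eta_hh.
by apply: filterS (cnbhs_ltnormc z1) => w w1; rewrite eta_hh.
Qed.

Lemma hfunE z : normc z < 1 -> hfun m z = hh z.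
Proof.
move=> z1; rewrite /hfun; case: eqP => [->|/eqP z0]; last first.
  by rewrite eta_hh// mulrC mulKf.
have O1 : normc (0 : C) < 1 by rewrite normc0E.
have [l hl] := cdiff_hh O1.
have h : cder (fun w => w * hh w) 0 (1 * hh 0 + 0 * l).
  by apply: (cderM (f := id)) => //; exact: cder_id.
have h2 : cder (eta m) 0 (hh 0).
  move: h; rewrite mul1r mul0r addr0; apply: gder_ext; first by rewrite eta_hh.
  by apply: filterS (cnbhs_ltnormc O1) => w w1; rewrite eta_hh.
by have [_ ->] := cder_derivable h2.
Qed.

End Prob.
End Transforms.

(** * Quantile functions *)

Section Quantile.
Variable R : realType.
Local Notation C := R[i].
Local Notation T2 := (R * R)%type.
Local Notation circ := (@circleT R).
Local Notation P0 := (uniform_prob (@ltr01 R)).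

Definition qI (g : R -> R) : R := Rintegral P0 setT g.

Lemma uniform_ray (s : R) : 0 <= s <= 1 -> P0 `[s, +oo[%classic = (1 - s)%:E.
Proof.
move=> s01; rewrite /uniform_prob integral_uniform_pdf.
have -> : `[s, +oo[%classic `&` `[0, 1]%classic = `[s, 1]%classic :> set R.
  apply/seteqP; split=> x /=; rewrite !in_itv/= ?andbT; first by move=> [h1 h2]; lra.
  by move=> h; split; lra.
rewrite (eq_integral (fun=> 1%:E)); last first.
  move=> x; rewrite inE/= in_itv/= /uniform_pdf => h.
  by rewrite ifT; [rewrite subr0 invr1|lra].
rewrite integral_cst//= mul1e lebesgue_measure_itv/= lte_fin.
case: ltP => [_|h]; first by rewrite -EFinB.
have s1 : s = 1 by lra.
by rewrite s1 subrr.
Qed.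

Lemma qI_integrable (g : R -> R) M : measurable_fun setT g -> (forall u, `|g u| <= M) ->
  P0.-integrable setT (EFin \o g).
Proof.
move=> mg gM; apply: measurable_bounded_integrable => //.
  by rewrite -ge0_fin_numE ?fin_num_measure.
exists M; split; first exact: num_real.
by move=> x Mx u _ /=; apply: le_trans (ltW Mx).
Qed.

(** For increasing thresholds [s] this is the step function with successive values [h 0], ...,
    [h n]. Written as cumulated jumps, it has measurability, bounds and integral by induction on
    [n]. *)
Definition step (s h : nat -> R) (n : nat) (u : R) : R :=
  h 0%N + \sum_(i < n) (h i.+1 - h i) * (s i <= u)%R%:R.

Lemma step_rec s h n u : step s h n.+1 u = step s h n u + (h n.+1 - h n) * (s n <= u)%R%:R.
Proof. by rewrite /step big_ord_recr addrA. Qed.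

Lemma measurable_step s h n : measurable_fun setT (step s h n).
Proof.
elim: n => [|n IH].
  rewrite (_ : step s h 0 = cst (h 0%N)); first exact: measurable_cst.
  by apply/funext => u; rewrite /step big_ord0 addr0.
rewrite (_ : step s h n.+1 = (step s h n) \+ (fun u => (h n.+1 - h n) * \1_(`[s n, +oo[%classic) u)).
  apply: measurable_funD => //; apply: measurable_funM => //; exact: measurable_indic.
by apply/funext => u; rewrite step_rec /= indicE mem_setE in_itv/= andbT.
Qed.

Lemma step_bounded s h n : exists M, forall u, `|step s h n u| <= M.
Proof.
elim: n => [|n [M hM]].
  by exists `|h 0%N| => u; rewrite /step big_ord0 addr0.
exists (M + `|h n.+1 - h n|) => u; rewrite step_rec.
apply: le_trans (ler_normD _ _) _; apply: lerD => //.
by case: (s n <= u); rewrite /= ?mulr1n ?mulr0n ?mulr1 ?mulr0 ?normr0.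
Qed.

Lemma qI_step s h n : (forall i, (i < n)%N -> 0 <= s i <= 1) ->
  qI (step s h n) = h 0%N + \sum_(i < n) (h i.+1 - h i) * (1 - s i).
Proof.
elim: n => [|n IH] s01.
  rewrite big_ord0 addr0 /qI (@eq_Rintegral _ _ _ _ _ (cst (h 0%N))).
    by rewrite Rintegral_cst//= probability_setT mulr1.
  by move=> u _; rewrite /step big_ord0 addr0.
rewrite big_ord_recr addrA -IH; last by move=> i ni; apply: s01; exact: ltnW.
have -> : step s h n.+1 = (fun u => step s h n u + (h n.+1 - h n) * \1_(`[s n, +oo[%classic) u).
  by apply/funext => u; rewrite step_rec /= indicE mem_setE in_itv/= andbT.
have mi : measurable_fun setT (\1_(`[s n, +oo[%classic) : R -> R) by exact: measurable_indic.
have ii : P0.-integrable setT (EFin \o (\1_(`[s n, +oo[%classic) : R -> R)).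
  apply: (@qI_integrable _ 1) => // u; rewrite indicE; by case: (_ \in _); rewrite ?normr1 ?normr0.
have [M hM] := step_bounded s h n.
rewrite /qI RintegralD//=; last 2 first.
- exact: qI_integrable (measurable_step s h n) hM.
- apply: (@qI_integrable _ `|h n.+1 - h n|).
    by apply: measurable_funM.
  by move=> u; rewrite normrM indicE; case: (_ \in _); rewrite ?normr1 ?normr0 ?mulr1 ?mulr0.
congr (_ + _); rewrite RintegralZl//; congr (_ * _).
rewrite /Rintegral integral_indic// setIT.
exact: (congr1 fine (uniform_ray (s01 n (ltnSn n)))).
Qed.

Lemma step_eval s h n k u : (k <= n)%N -> (forall i, (i < k)%N -> s i <= u) ->
  (forall i, (k <= i < n)%N -> u < s i) -> step s h n u = h k.
Proof.
move=> kn lo hi; rewrite /step.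
rewrite -(big_mkord xpredT (fun i => (h i.+1 - h i) * (s i <= u)%R%:R)).
rewrite (big_cat_nat (n := k))//=.
have -> : \sum_(k <= i < n) (h i.+1 - h i) * (s i <= u)%R%:R = 0.
  by rewrite big_nat_cond big1// => i /andP[/hi hu _]; rewrite leNgt hu mulr0.
rewrite addr0.
rewrite (eq_big_nat _ _ (F2 := fun i => h i.+1 - h i)); last first.
  by move=> i /andP[_ ik]; rewrite lo// mulr1.
by rewrite telescope_sumr// addrC subrK.
Qed.

Lemma step_index (s : nat -> R) n (u : R) : (forall i j, (i <= j < n)%N -> s i <= s j) ->
  exists k, [/\ (k <= n)%N, (forall i, (i < k)%N -> s i <= u) &
               (forall i, (k <= i < n)%N -> u < s i)].
Proof.
elim: n => [|n IH] ms.
  by exists 0%N; split=> // i; rewrite ltn0 andbF.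
have [|k [kn lo hi]] := IH.
  by move=> i j /andP[ij jn]; apply: ms; rewrite ij ltnW.
have [ksn|ksn] := boolP (k == n); last first.
  have kltn : (k < n)%N by rewrite ltn_neqAle ksn.
  exists k; split=> //; first exact: ltnW.
  move=> i /andP[ki]; rewrite ltnS leq_eqVlt => /orP[/eqP->|iln]; last by apply: hi; rewrite ki.
  apply: (@lt_le_trans _ _ (s k)); first by apply: hi; rewrite leqnn.
  by apply: ms; rewrite ltnW//=.
move/eqP: ksn => ksn; have [snu|usn] := leP (s n) u.
  exists n.+1; split=> // i; last by case: (ltnP i n.+1) => h; rewrite ?andbF// leqNgt ltnS -ltnS h.
  by rewrite ltnS leq_eqVlt => /orP[/eqP->//|iln]; apply: lo; rewrite ksn.
exists n; split=> // i.
  by move=> iln; apply: lo; rewrite ksn.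
by rewrite ltnS -eqn_leq => /eqP <-.
Qed.

Lemma abel_sum (h S : nat -> R) n : S 0%N = 0 ->
  h 0%N + \sum_(i < n) (h i.+1 - h i) * (1 - S i.+1) =
  \sum_(i < n) h i * (S i.+1 - S i) + h n * (1 - S n).
Proof.
move=> S0; elim: n => [|n IH]; first by rewrite !big_ord0 S0 subr0 mulr1 addr0 add0r.
by rewrite !big_ord_recr /= addrA IH; ring.
Qed.

(** Quantile functions of angles in [[0, 2 pi]]. Prescribing the values outside [[0, 1)] keeps the
    class closed under pointwise limits and fixes the value at the last node of every grid. *)
Definition qfun (Q : R -> R) := [/\ nondecreasing_fun Q, forall u, u < 0 -> Q u = 0 &
  forall u, 1 <= u -> Q u = pi *+ 2].

Lemma qfun_bound Q : qfun Q -> forall u, 0 <= Q u <= pi *+ 2.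
Proof.
move=> [mQ Q0 Q1] u; apply/andP; split.
  have [v v0 vu] : exists2 v : R, v < 0 & v <= u.
    by exists (- (`|u| + 1)); have := ler_norm (- u); rewrite normrN; have := normr_ge0 u; lra.
  by rewrite -(Q0 v v0); exact: mQ.
rewrite -(Q1 (Num.max u 1)); last by rewrite le_max lexx orbT.
by apply: mQ; rewrite le_max lexx.
Qed.

Lemma lip_measurable (F : R -> R) L : (forall x y, `|F x - F y| <= L * `|x - y|) ->
  measurable_fun setT F.
Proof.
move=> FL; apply: continuous_measurable_fun => x.
have L1 : 0 < `|L| + 1 by rewrite ltr_wpDl.
apply/cvgRP => e e0; apply/nbhsRP; exists (e / (`|L| + 1)); first by rewrite divr_gt0.
move=> y yx; apply: le_trans (FL _ _) _.
have : L * `|y - x| <= (`|L| + 1) * `|y - x|.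
  by apply: ler_wpM2r => //; have := ler_norm L; lra.
by move: yx; rewrite ltr_pdivlMr// mulrC => /ltW h1 /le_trans; apply.
Qed.

Lemma qfun_comp_measurable Q (F : R -> R) L : qfun Q ->
  (forall x y, `|F x - F y| <= L * `|x - y|) -> measurable_fun setT (fun u => F (Q u)).
Proof.
move=> [mQ _ _] FL; apply: (measurableT_comp (f := F)); first exact: lip_measurable FL.
exact: nondecreasing_measurable.
Qed.

Lemma qfun_comp_integrable Q (F : R -> R) L : 0 <= L -> qfun Q ->
  (forall x y, `|F x - F y| <= L * `|x - y|) -> P0.-integrable setT (EFin \o (fun u => F (Q u))).
Proof.
move=> L0 qQ FL; apply: (@qI_integrable _ (`|F 0| + L * (pi *+ 2))).
  exact: qfun_comp_measurable FL.
move=> u; have := ler_normD (F (Q u) - F 0) (F 0); rewrite subrK => h.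
apply: (le_trans h); rewrite addrC lerD2l; apply: le_trans (FL _ _) _.
rewrite subr0 ler_wpM2l//; have := qfun_bound qQ u => /andP[h1 h2].
by rewrite ger0_norm.
Qed.

(* The difference of two distribution-like functions is controlled by their
   values on a grid, because both are monotone. *)
Lemma qfun_grid_bound Q1 Q2 N d u : qfun Q1 -> qfun Q2 -> 0 <= d ->
  (forall i, (i <= N.+1)%N -> `|Q1 (i%:R / N.+1%:R) - Q2 (i%:R / N.+1%:R)| <= d) ->
  `|Q1 u - Q2 u| <= step (fun i => i.+1%:R / N.+1%:R)
     (fun i => 2 * d + (Q2 (i.+1%:R / N.+1%:R) - Q2 (i%:R / N.+1%:R))) N u.
Proof.
move=> q1 q2 d0 hd.
have N0 : 0 < N.+1%:R :> R by rewrite ltr0n.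
have [|k [kN lo hi]] := @step_index (fun i => i.+1%:R / N.+1%:R) N u.
  by move=> i j /andP[ij _]; rewrite ler_pM2r ?invr_gt0// ler_nat.
rewrite (step_eval _ kN lo hi).
have [m1 z1 o1] := q1; have [m2 z2 o2] := q2.
have hk := hd k (leqW kN); have hk1 := hd k.+1; rewrite ltnS in hk1; have {}hk1 := hk1 kN.
have mk : Q2 (k%:R / N.+1%:R) <= Q2 (k.+1%:R / N.+1%:R).
  by apply: m2; rewrite ler_pM2r ?invr_gt0// ler_nat.
have [u0|u0] := ltP u 0; first by rewrite z1// z2// subrr normr0; lra.
have [u1|u1] := leP 1 u; first by rewrite o1// o2// subrr normr0; lra.
have ku : k%:R / N.+1%:R <= u.
  by case: k kN lo hi {hk hk1 mk} => [|k] kN lo hi; [rewrite mul0r|exact: lo].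
have uk : u <= k.+1%:R / N.+1%:R.
  have [kltN|] := ltnP k N; first by apply/ltW/hi; rewrite leqnn.
  move=> Nk; have -> : k = N by apply/eqP; rewrite eqn_leq kN.
  by rewrite divff ?gt_eqF// ltW.
have a1 := m1 _ _ ku; have a2 := m1 _ _ uk; have b1 := m2 _ _ ku; have b2 := m2 _ _ uk.
move: hk hk1; rewrite !ler_norml; lra.
Qed.

(** Integrating the bound of [qfun_grid_bound] gives [2 d] plus the increments of [Q2] over the
    grid, which telescope to at most [2 pi / N.+1]. Closeness at finitely many nodes thus controls
    the integrals of all [L]-Lipschitz functions at once. *)
Lemma qI_dist (F : R -> R) L Q1 Q2 N d : 0 <= L -> qfun Q1 -> qfun Q2 -> 0 <= d ->
  (forall x y, `|F x - F y| <= L * `|x - y|) ->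
  (forall i, (i <= N.+1)%N -> `|Q1 (i%:R / N.+1%:R) - Q2 (i%:R / N.+1%:R)| <= d) ->
  `|qI (fun u => F (Q1 u)) - qI (fun u => F (Q2 u))| <= L * (2 * d + pi *+ 2 / N.+1%:R).
Proof.
move=> L0 q1 q2 d0 FL hd.
have i1 := qfun_comp_integrable L0 q1 FL; have i2 := qfun_comp_integrable L0 q2 FL.
pose s (i : nat) : R := i.+1%:R / N.+1%:R.
pose h (i : nat) : R := 2 * d + (Q2 (i.+1%:R / N.+1%:R) - Q2 (i%:R / N.+1%:R)).
have [M hM] := step_bounded s h N.
have i3 := qI_integrable (measurable_step s h N) hM.
rewrite /qI -RintegralB//.
apply: le_trans (le_normr_Rintegral _ _) _ => //.
  have := integrableB measurableT i1 i2; exact.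
apply: (@le_trans _ _ (Rintegral P0 setT (fun u => L * step s h N u))).
  apply: le_Rintegral => //.
  - apply: integrable_norm; have := integrableB measurableT i1 i2; exact.
  - have := integrableZl measurableT L i3; exact.
  - move=> u _; apply: le_trans (FL _ _) _; rewrite ler_wpM2l//.
    exact: qfun_grid_bound.
rewrite RintegralZl// -/(qI _) qI_step; last first.
  move=> i iN; rewrite /s divr_ge0//= ler_pdivrMr// mul1r ler_nat.
  exact: leqW.
rewrite ler_wpM2l// (@abel_sum h (fun i => i%:R / N.+1%:R)) ?mul0r//.
have N0 : N.+1%:R != 0 :> R by rewrite pnatr_eq0.
have dS (i : nat) : i.+1%:R / N.+1%:R - i%:R / N.+1%:R = N.+1%:R^-1 :> R.
  by rewrite -mulrBl -natr1 addrC addKr mul1r.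
have dN := dS N; rewrite (divff N0) in dN; rewrite dN.
under eq_bigr do rewrite dS.
rewrite -(big_ord_recr N (fun i => h i * N.+1%:R^-1))/= -mulr_suml.
rewrite /h big_split /= sumr_const card_ord.
rewrite -(big_mkord xpredT (fun i => Q2 (i.+1%:R / N.+1%:R) - Q2 (i%:R / N.+1%:R))).
rewrite telescope_sumr// divff// mul0r mulrDl -(mulr_natr (2 * d)) mulfK// lerD2l.
have [_ _ o2] := q2; rewrite o2// ler_wpM2r ?invr_ge0//.
by have /andP[h0 _] := qfun_bound q2 0; lra.
Qed.

Lemma image_measure (X : R -> T2) : measurable_fun setT X -> (forall u, circ (X u)) ->
  exists2 m : PT R, onT m & forall f : T2 -> R, contT (fun p => (f p)%:C%C) ->
    Rintegral m circ f = qI (fun u => f (X u)).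
Proof.
move=> mX cX.
have mX2 : measurable_fun (setT : set (measurableTypeR R)) X by exact: mX.
pose X' : {mfun (measurableTypeR R) >-> T2} :=
  HB.pack X (isMeasurableFun.Build _ _ (measurableTypeR R) T2 X mX2).
exists (distribution P0 X' : probability T2 R).
  have E : X @^-1` (~` circ) = set0 by apply/seteqP; split=> // u /=; apply; exact: cX.
  by change (P0 (X @^-1` (~` circ)) = 0%E); rewrite E; exact: measure0.
move=> f cf.
have mc := @measurable_circle R.
have mf : measurable_fun setT (f \_ circ).
  exact: (iffLR (measurable_restrictT f mc) (contT_measurable cf)).
have [M hM] := contT_bounded cf.
rewrite Rintegral_mkcond /qI /Rintegral; congr fine.
transitivity (\int[P0]_u ((EFin \o (f \_ circ)) \o X') u)%E; last first.
  apply: eq_integral => u _ /=; rewrite patchE ifT//; apply/mem_set; exact: cX.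
apply: (@integral_distribution _ _ _ _ _ _ X' (EFin \o (f \_ circ))).
  exact/measurable_EFinP.
have mfX : measurable_fun setT ((f \_ circ) \o X) by exact: measurableT_comp.
apply: (@qI_integrable ((f \_ circ) \o X) M) => // u.
rewrite /= patchE ifT; last by apply/mem_set; exact: cX.
by have := hM _ (cX u); rewrite normc_real.
Qed.

Lemma measurable_cis (Q : R -> R) (s : R) : nondecreasing_fun Q ->
  measurable_fun setT (fun u => (cos (s * Q u), sin (s * Q u))).
Proof.
move=> mQ; have mQ' : measurable_fun setT (fun u => s * Q u).
  by apply: measurable_funM => //; exact: nondecreasing_measurable.
apply: measurable_fun_pair.
  by apply: (measurableT_comp (f := cos)) => //; apply: continuous_measurable_fun; exact: continuous_cos.
by apply: (measurableT_comp (f := sin)) => //; apply: continuous_measurable_fun; exact: continuous_sin.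
Qed.

(** One ultrafilter gives limits to all bounded sequences simultaneously, so a limit of functions
    can be taken at every point without diagonal extraction. *)
Lemma ultra_limits : exists U : set_system nat, [/\ ProperFilter U, \oo `<=` U &
  forall (x : nat -> R) (M : R), (forall n, `|x n| <= M) ->
    exists l, forall e, 0 < e -> U (fun n => `|x n - l| <= e)].
Proof.
have [U [UU sU]] := ultraFilterLemma (eventually_filter).
exists U; split=> // [|x M hx]; first exact: ultra_proper.
have UP : ProperFilter U by exact: ultra_proper.
have Fx : (x @ U) `[- M, M]%classic.
  by rewrite /fmap /=; apply: filterE => n /=; rewrite in_itv/= -ler_norml.
have [l [_ cl]] := segment_compact (fmap_proper_filter x UP) Fx.
exists l => e e0.
have [//|h] := in_ultra_setVsetC (fun n => `|x n - l| <= e) UU.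
have [y [[n /= h1 h2] h3]] : (x @` (fun n => ~ (`|x n - l| <= e))) `&` ball l e !=set0.
  apply: cl; last exact: nbhsx_ballx.
  by rewrite /fmap /=; apply: filterS h => n hn; exists n.
exfalso; apply: h1; rewrite h2 distrC ltW//.
Qed.

End Quantile.

(** * Herglotz functions *)

Section HerglotzClass.
Variable R : realType.
Local Notation C := R[i].
Local Notation T2 := (R * R)%type.
Local Notation circ := (@circleT R).

Definition hker (w : C) (q : R) : C := (w + cis q) / (w - cis q).

Definition qintc (g : R -> C) : C :=
  Complex (qI (fun u => complex.Re (g u))) (qI (fun u => complex.Im (g u))).

Lemma hker_den (w : C) (r q : R) : normc w <= r -> r < 1 -> 1 - r <= normc (w - cis q).
Proof.
move=> wr r1; have := normcB w (w - cis q).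
by rewrite (_ : w - (w - cis q) = cis q) ?normc_cis; [lra|ring].
Qed.

Lemma hker_neq0 (w : C) q : normc w < 1 -> w - cis q != 0.
Proof. by move=> w1; rewrite -normc_gt0; have := @hker_den w _ q (lexx _) w1; lra. Qed.

Lemma hker_lip (w : C) r q q' : normc w <= r -> r < 1 ->
  normc (hker w q - hker w q') <= 2 / (1 - r) ^+ 2 * `|q - q'|.
Proof.
move=> wr r1; have w1 := le_lt_trans wr r1.
have h1 := hker_neq0 q w1; have h2 := hker_neq0 q' w1.
rewrite /hker (_ : _ - _ = 2 * (w * (cis q - cis q')) / ((w - cis q) * (w - cis q')));
  last by field; rewrite h1 h2.
have r10 : 0 < 1 - r by lra.
rewrite normcM normcV normcM normcM (_ : normc 2 = 2); last first.
  by rewrite -(rmorph_nat (real_complex R)) normc_real ger0_norm.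
rewrite normcM ler_pdivrMr ?mulr_gt0 ?normc_gt0//.
have d1 := hker_den q wr r1; have d2 := hker_den q' wr r1.
have a1 : normc w * normc (cis q - cis q') <= 1 * `|q - q'|.
  apply: ler_pM; rewrite ?normc_ge0 ?cis_lip//; lra.
have a2 : (1 - r) ^+ 2 <= normc (w - cis q) * normc (w - cis q').
  by rewrite expr2; apply: ler_pM => //; exact: ltW.
apply: (@le_trans _ _ (2 * `|q - q'|)).
  by rewrite ler_pM2l//; move: a1; rewrite mul1r.
have r20 : 0 < (1 - r) ^+ 2 by rewrite exprn_gt0.
move: a2; set P := normc _ * normc _ => a2.
rewrite (_ : 2 / _ * _ * P = 2 * `|q - q'| * (P / (1 - r) ^+ 2)); last first.
  by field; rewrite ?gt_eqF.
by rewrite -[leLHS]mulr1 ler_wpM2l ?mulr_ge0// ler_pdivlMr// mul1r.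
Qed.

Lemma hker_norm (w : C) r q : normc w <= r -> r < 1 -> normc (hker w q) <= 2 / (1 - r).
Proof.
move=> wr r1; have w1 := le_lt_trans wr r1.
rewrite /hker normcM normcV ler_pdivrMr ?normc_gt0 ?hker_neq0//.
have d1 := hker_den q wr r1.
have r10 : 0 < 1 - r by lra.
apply: (@le_trans _ _ 2); first by apply: le_trans (normcD _ _) _; rewrite normc_cis; lra.
by rewrite mulrAC ler_pdivlMr// ler_pM2l.
Qed.

Lemma qI_cst (c : R) : qI (fun=> c) = c.
Proof.
transitivity (qI (step (fun=> 0) (fun=> c) 0)); last by rewrite qI_step// big_ord0 addr0.
by congr qI; apply/funext => u; rewrite /step big_ord0 addr0.
Qed.

Lemma qI_norm (F : R -> R) L Q M : 0 <= L -> qfun Q ->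
  (forall x y, `|F x - F y| <= L * `|x - y|) -> (forall x, `|F x| <= M) ->
  `|qI (fun u => F (Q u))| <= M.
Proof.
move=> L0 qQ FL FM; have i1 := qfun_comp_integrable L0 qQ FL.
apply: le_trans (le_normr_Rintegral _ _) _ => //.
rewrite -[leRHS]qI_cst; apply: le_Rintegral => //.
- exact: integrable_norm.
- by apply: (@qI_integrable _ _ `|M|); [exact: measurable_cst|move=> u].
Qed.

Lemma Re_lip (g : R -> C) L : (forall x y, normc (g x - g y) <= L * `|x - y|) ->
  forall x y, `|complex.Re (g x) - complex.Re (g y)| <= L * `|x - y|.
Proof.
by move=> h x y; apply: le_trans (h x y); have := Re_le_normc (g x - g y); rewrite !cReIm.
Qed.

Lemma Im_lip (g : R -> C) L : (forall x y, normc (g x - g y) <= L * `|x - y|) ->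
  forall x y, `|complex.Im (g x) - complex.Im (g y)| <= L * `|x - y|.
Proof.
by move=> h x y; apply: le_trans (h x y); have := Im_le_normc (g x - g y); rewrite !cReIm.
Qed.

Lemma qintc_norm (w : C) r Q : normc w <= r -> r < 1 -> qfun Q ->
  normc (qintc (fun u => hker w (Q u))) <= 2 * (2 / (1 - r)).
Proof.
move=> wr r1 qQ.
have L0 : 0 <= 2 / (1 - r) ^+ 2 by rewrite divr_ge0// exprn_ge0//; lra.
have hl q q' := hker_lip q q' wr r1.
apply: le_trans (normc_le_ReIm _) _ => /=.
have h1 := @qI_norm (fun q => complex.Re (hker w q)) _ Q (2 / (1 - r)) L0 qQ (Re_lip hl).
have h2 := @qI_norm (fun q => complex.Im (hker w q)) _ Q (2 / (1 - r)) L0 qQ (Im_lip hl).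
have {}h1 := h1 (fun x => le_trans (Re_le_normc _) (hker_norm x wr r1)).
have {}h2 := h2 (fun x => le_trans (Im_le_normc _) (hker_norm x wr r1)).
lra.
Qed.

Lemma qintc_dist (w : C) r Q1 Q2 N d : normc w <= r -> r < 1 -> qfun Q1 -> qfun Q2 -> 0 <= d ->
  (forall i, (i <= N.+1)%N -> `|Q1 (i%:R / N.+1%:R) - Q2 (i%:R / N.+1%:R)| <= d) ->
  normc (qintc (fun u => hker w (Q1 u)) - qintc (fun u => hker w (Q2 u))) <=
    2 * (2 / (1 - r) ^+ 2 * (2 * d + pi *+ 2 / N.+1%:R)).
Proof.
move=> wr r1 q1 q2 d0 hd.
have L0 : 0 <= 2 / (1 - r) ^+ 2 by rewrite divr_ge0// exprn_ge0//; lra.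
have hl q q' := hker_lip q q' wr r1.
apply: le_trans (normc_le_ReIm _) _; rewrite !cReIm /=.
have h1 := @qI_dist _ (fun q => complex.Re (hker w q)) _ Q1 Q2 N d L0 q1 q2 d0 (Re_lip hl) hd.
have h2 := @qI_dist _ (fun q => complex.Im (hker w q)) _ Q1 Q2 N d L0 q1 q2 d0 (Im_lip hl) hd.
by move: h1 h2; set X := _ * (2 * d + _); lra.
Qed.

(* Herglotz representations whose measure is presented by a quantile function. *)
Definition HQ (B : C -> C) := exists x : R * R * (R -> R), [/\ 0 <= x.1.2, qfun x.2 &
  forall w, normc w < 1 -> B w = 'i%C * x.1.1%:C%C + x.1.2%:C%C * qintc (fun u => hker w (x.2 u))].

Lemma qintc0 Q : qintc (fun u => hker 0 (Q u)) = -1.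
Proof.
have h q : hker 0 q = -1 by rewrite /hker add0r sub0r invrN mulrN divff// cis_neq0.
have -> : (fun u => hker 0 (Q u)) = (fun=> -1) by apply/funext => u; exact: h.
by apply: complex_ext; rewrite /= ?oppr0 qI_cst ?oppr0.
Qed.

(** The kernel is [-1] at the origin, so mass and rotation are read off [B 0]; a bound on [B 0]
    bounds both. *)
Lemma HQ0 (B : C -> C) g m Q :
  (forall w, normc w < 1 -> B w = 'i%C * g%:C%C + m%:C%C * qintc (fun u => hker w (Q u))) ->
  complex.Re (B 0) = - m /\ complex.Im (B 0) = g.
Proof.
move=> h; rewrite h ?normc0E// qintc0 !cReIm /=; split; ring.
Qed.

(** Mass, rotation and quantile function converge along the ultrafilter. Closeness is measured on a
    grid independent of [w], hence uniformity on [|w| <= r]. The limit is taken along an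
    ultrafilter, so arbitrarily late indices take the place of a subsequence. *)
Lemma HQ_compact (B : nat -> C -> C) (K : R) : (forall n, HQ (B n)) ->
  (forall n, normc (B n 0) <= K) ->
  exists2 B', HQ B' & forall (r e : R) N, r < 1 -> 0 < e -> exists2 n, (N <= n)%N &
    forall w, normc w <= r -> normc (B n w - B' w) <= e.
Proof.
move=> hB hK; have [x hx] := choice hB.
have [U [UP sU ul]] := ultra_limits R.
have bm n : `|(x n).1.2| <= K.
  have [_ _ /HQ0[h1 _]] := hx n.
  by rewrite -[(x n).1.2]opprK -h1 normrN; apply: le_trans (Re_le_normc _) (hK n).
have bg n : `|(x n).1.1| <= K.
  have [_ _ /HQ0[_ h1]] := hx n.
  by rewrite -h1; apply: le_trans (Im_le_normc _) (hK n).
have bQ u n : `|(x n).2 u| <= pi *+ 2.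
  by have [_ /qfun_bound/(_ u)/andP[h1 h2] _] := hx n; rewrite ger0_norm.
have [m hm] := ul _ _ bm; have [g hg] := ul _ _ bg.
have [Q hQ] := choice (fun u => ul _ _ (bQ u)).
have ge_lim (y z : nat -> R) a b : (forall n, y n <= z n) ->
    (forall e, 0 < e -> U (fun n => `|y n - a| <= e)) ->
    (forall e, 0 < e -> U (fun n => `|z n - b| <= e)) -> a <= b.
  move=> yz ya zb; apply/ler_addgt0Pr => e e0; have e2 : 0 < e / 2 by rewrite divr_gt0.
  have [n [h1 h2]] := filter_ex (filterI (ya _ e2) (zb _ e2)).
  by move: h1 h2 (yz n); rewrite !ler_norml; lra.
have cst_lim (c : R) : forall e, 0 < e -> U (fun n : nat => `|c - c| <= e).
  by move=> e e0; apply: filterE => n; rewrite subrr normr0 ltW.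
have m0 : 0 <= m.
  apply: (ge_lim (fun=> 0) (fun n => (x n).1.2) 0 m) => //; last exact: cst_lim.
  by move=> n; have [] := hx n.
have eq_lim (y : nat -> R) a c : (forall n, y n = c) ->
    (forall e, 0 < e -> U (fun n => `|y n - a| <= e)) -> a = c.
  move=> yc ya; apply/le_anti/andP; split.
    by apply: (ge_lim y (fun=> c) a c) => //; [move=> n; rewrite yc|exact: cst_lim].
  by apply: (ge_lim (fun=> c) y c a) => //; [move=> n; rewrite yc|exact: cst_lim].
have qQ : qfun Q.
  split.
  - move=> u v uv; apply: (ge_lim _ _ _ _ _ (hQ u) (hQ v)) => n.
    by have [_ [mQ _ _] _] := hx n; exact: mQ.
  - by move=> u u0; apply: (eq_lim _ _ _ _ (hQ u)) => n; have [_ [_ h _] _] := hx n; exact: h.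
  - by move=> u u1; apply: (eq_lim _ _ _ _ (hQ u)) => n; have [_ [_ _ h] _] := hx n; exact: h.
exists (fun w => 'i%C * g%:C%C + m%:C%C * qintc (fun u => hker w (Q u))).
  by exists (g, m, Q).
move=> r e N r1 e0.
have [r0|r0] := ltP r 0.
  by exists N => // w wr; exfalso; have := normc_ge0 w; lra.
pose A := 2 * (2 / (1 - r)); pose L := 2 / (1 - r) ^+ 2.
have A0 : 0 <= A by rewrite /A mulr_ge0// divr_ge0//; lra.
have L0 : 0 <= L by rewrite /L divr_ge0// exprn_ge0//; lra.
(* The three errors below sum to at most [d * (1 + A + 6 * m * L)], which this choice keeps below
   [e]. *)
pose d := e / (4 * (1 + A + 4 * m * L)).
have mL0 : 0 <= m * L := mulr_ge0 m0 L0.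
have den0 : 0 < 1 + A + 4 * m * L.
  by rewrite -[4 * m * L]mulrA ltr_wpDr ?(mulr_ge0 (ler0n R 4) mL0)// ltr_pwDl.
have d0 : 0 < d by rewrite /d divr_gt0// mulr_gt0.
pose Ng := Num.bound (pi *+ 2 / d : R).
have Ngd : pi *+ 2 / Ng.+1%:R <= d.
  rewrite ler_pdivrMr// mulrC -ler_pdivrMr//; apply: ltW.
  apply: (@lt_trans _ _ Ng%:R); last by rewrite ltr_nat.
  by apply: archi_boundP; apply: divr_ge0; [rewrite mulrn_wge0// pi_ge0|exact: ltW].
have grid k : U (fun n => forall i, (i <= k)%N ->
    `|(x n).2 (i%:R / Ng.+1%:R) - Q (i%:R / Ng.+1%:R)| <= d).
  elim: k => [|k IH].
    by apply: filterS (hQ (0%:R / Ng.+1%:R) _ d0) => n h i; rewrite leqn0 => /eqP ->.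
  apply: filterS2 IH (hQ (k.+1%:R / Ng.+1%:R) _ d0) => n h1 h2 i.
  by rewrite leq_eqVlt => /orP[/eqP->//|]; exact: h1.
have UN : U (fun n => (N <= n)%N) by apply: sU; exists N.
have [n [Nn [h1 [h2 h3]]]] := filter_ex (filterI UN (filterI (hm _ d0)
  (filterI (hg _ d0) (grid Ng.+1)))).
exists n => // w wr.
have [m'0 qn hn] := hx n.
rewrite hn ?(le_lt_trans wr)//.
have dq := qintc_dist wr r1 qn qQ (ltW d0) h3.
have nq := qintc_norm wr r1 qn.
move: dq nq; set q1 := qintc _; set q2 := qintc _ => dq nq.
rewrite (_ : _ - _ = 'i%C * ((x n).1.1 - g)%:C%C + (((x n).1.2 - m)%:C%C * q1 + m%:C%C * (q1 - q2)));
  last by rewrite !realCB; ring.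
apply: le_trans (normcD _ _) _; rewrite normcM normci mul1r normc_real.
apply: le_trans (lerD h2 (normcD _ _)) _; rewrite !normcM !normc_real (ger0_norm m0).
have t1 : `|(x n).1.2 - m| * normc q1 <= d * A by apply: ler_pM; rewrite ?normc_ge0.
have t2 : m * normc (q1 - q2) <= m * (2 * (L * (2 * d + d))).
  rewrite ler_wpM2l//; apply: le_trans dq _; rewrite ler_pM2l// ler_wpM2l// lerD2l.
  exact: Ngd.
have Ed : d * (4 * (1 + A + 4 * m * L)) = e by rewrite /d divfK// gt_eqF// mulr_gt0.
have mL : 0 <= d * (m * L) := mulr_ge0 (ltW d0) mL0.
have dA : 0 <= d * A := mulr_ge0 (ltW d0) A0.
move: (A) (L) (d) (m) t1 t2 Ed mL dA d0 => A' L' d' m' t1 t2 Ed mL dA d0'; nra.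
Qed.

(** Pointwise convergence suffices: a limit supplied by [HQ_compact] must agree with [g] at every
    point. Skipping the first [N0] terms bounds the values at the origin. *)
Lemma HQ_lim (f : nat -> C -> C) (g : C -> C) : (forall n, HQ (f n)) ->
  (forall w, normc w < 1 -> ccvg \oo (fun n => f n w) (g w)) -> HQ g.
Proof.
move=> hf fg.
have O1 : normc (0 : C) < 1 by rewrite normc0E.
have [N0 _ hN0] := ccvg_bounded (fg 0 O1).
have [||B' [x [x0 qx hx]] hB'] := @HQ_compact (fun n => f (N0 + n)%N) (normc (g 0) + 1).
- by move=> n; exact: hf.
- by move=> n; apply: hN0; exact: leq_addr.
exists x; split=> // w w1; rewrite -hx//.
apply: eq_of_small => e e0; have e2 : 0 < e / 2 by rewrite divr_gt0.
have [N _ hN] := fg w w1 _ e2.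
have [n Nn hn] := hB' _ _ N w1 e2.
apply: le_trans (distc_tri (f (N0 + n)%N w) _ _) _.
have := hn w (lexx _); have := hN (N0 + n)%N; rewrite /= distcC => h1 h2.
have := h1 (leq_trans Nn (leq_addl _ _)); lra.
Qed.

Lemma HQ_ext (f g : C -> C) : (forall w, normc w < 1 -> f w = g w) -> HQ f -> HQ g.
Proof. by move=> fg [x [x0 qx hx]]; exists x; split=> // w w1; rewrite -fg// hx. Qed.

Lemma qfun_jump : qfun (fun u : R => (1 <= u)%R%:R * (pi *+ 2)).
Proof.
have p0 : 0 <= pi *+ 2 :> R by rewrite mulrn_wge0// pi_ge0.
split.
- move=> u v uv; rewrite ler_wpM2r// ler_nat; case: (leP 1 u) => // u1.
  by rewrite (le_trans u1 uv).
- by move=> u u0; rewrite leNgt (lt_trans u0 ltr01) mul0r.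
- by move=> u ->; rewrite mul1r.
Qed.

(** Point masses at roots of unity have a quantile function with steps: it climbs by one node
    spacing [t] each time [u] passes a cumulated normalised weight. *)
Lemma HQ_discrete n (p : nat -> R) (g : R) : (forall j, (j <= n)%N -> 0 <= p j) ->
  HQ (fun z => 'i%C * g%:C%C + \sum_(j < n.+1) (p j)%:C%C * ((z + omega n j) / (z - omega n j))).
Proof.
move=> p0; pose S0 (k : nat) := \sum_(j < k) p j; pose m := S0 n.+1.
have pj0 (j : 'I_n.+1) : 0 <= p j by apply: p0; rewrite -ltnS.
have m0 : 0 <= m by apply: sumr_ge0 => j _; exact: pj0.
(* Zero mass cannot be normalised, and then any quantile function serves. *)
have [mE|mN] := eqVneq m 0.
  exists (g, 0, (fun u : R => (1 <= u)%R%:R * (pi *+ 2))); split=> //=; first exact: qfun_jump.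
  move=> w w1; rewrite mul0r; congr (_ + _); apply: big1 => j _.
  have -> : p j = 0 by apply/eqP; move/eqP: mE; rewrite psumr_eq0// => /allP/(_ j); apply; rewrite mem_index_enum.
  by rewrite mul0r.
have mgt : 0 < m by rewrite lt_def mN.
pose S (k : nat) := S0 k / m.
have S0m i j : (i <= j <= n.+1)%N -> S0 i <= S0 j.
  move=> /andP[ij jn]; rewrite /S0 -!(big_mkord xpredT p) [leRHS](big_cat_nat (n := i))//= lerDl.
  by rewrite big_nat_cond; apply: sumr_ge0 => k /andP[/andP[_ kj] _]; apply: p0; rewrite -ltnS (leq_trans kj).
have Sm i j : (i <= j <= n.+1)%N -> S i <= S j by move=> h; rewrite ler_pM2r ?invr_gt0// S0m.
have S_0 : S 0%N = 0 by rewrite /S /S0 big_ord0 mul0r.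
have S_1 : S n.+1 = 1 by rewrite /S divff.
have S01 i : (i <= n.+1)%N -> 0 <= S i <= 1.
  by move=> h; rewrite -{1}S_0 -S_1 !Sm// h leqnn.
pose t : R := pi *+ 2 / n.+1%:R.
have t0 : 0 <= t by rewrite divr_ge0// mulrn_wge0// pi_ge0.
pose h (i : nat) : R := i%:R * t.
(* Node [i] occupies [[S i, S i.+1)], so the passage to the next node occurs at [S i.+1]. The last
   jump, at [S n.+1 = 1], has no mass behind it but gives [Q] the value [2 pi] required by
   [qfun]. *)
pose s (i : nat) := S i.+1.
pose Q u := step s h n.+1 u.
have idx u : exists k, [/\ (k <= n.+1)%N, (forall i, (i < k)%N -> s i <= u) &
               (forall i, (k <= i < n.+1)%N -> u < s i)].
  by apply: step_index => i j /andP[ij jn]; apply: Sm; rewrite ltnS ij.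
have FQ (F : R -> R) u : F (Q u) = step s (F \o h) n.+1 u.
  have [k [kn lo hi]] := idx u.
  by rewrite /Q (step_eval _ kn lo hi) (step_eval _ kn lo hi).
have hm i : h i.+1 - h i = t by rewrite /h -natr1; ring.
have qQ : qfun Q.
  split.
  - move=> u v uv; rewrite /Q /step lerD2l; apply: ler_sum => i _; rewrite hm ler_wpM2l// ler_nat.
    by case: (leP (s i) u) => // h1; rewrite (le_trans h1 uv).
  - move=> u u0; rewrite /Q (@step_eval _ s h n.+1 0)//; first by rewrite /h mul0r.
    move=> i /= ni; apply: (lt_le_trans u0); by have /andP[] := S01 i.+1 ni.
  - move=> u u1; rewrite /Q (@step_eval _ s h n.+1 n.+1)//.
    + by rewrite /h /t mulrC divfK// pnatr_eq0.
    + by move=> i ni; apply: le_trans u1; have /andP[] := S01 i.+1 ni.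
    + by move=> i /andP[h1 h2]; move: h2; rewrite ltnNge h1.
have qF (F : R -> R) : qI (fun u => F (Q u)) = \sum_(i < n.+1) F (h i) * (p i / m).
  have -> : (fun u => F (Q u)) = step s (F \o h) n.+1 by apply/funext => u; exact: FQ.
  rewrite qI_step; last by move=> i ni; exact: S01.
  rewrite (@abel_sum _ (F \o h) S)// S_1 subrr mulr0 addr0; apply: eq_bigr => i _ /=.
  rewrite /S -mulrBl; congr (_ * (_ / _)).
  by rewrite /S0 -!(big_mkord xpredT p) big_nat_recr//= [LHS]addrC addKr.
exists (g, m, Q); split=> //= w w1; congr (_ + _).
have -> : qintc (fun u => hker w (Q u)) = \sum_(i < n.+1) hker w (h i) * (p i / m)%:C%C.
  rewrite /qintc (qF (fun q => complex.Re (hker w q))) (qF (fun q => complex.Im (hker w q))).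
  apply: complex_ext => /=.
    by rewrite Re_sum; apply: eq_bigr => i _; rewrite cReM /= mulr0 subr0.
  have Im_sum (I : Type) (r : seq I) (f : I -> C) :
      complex.Im (\sum_(i <- r) f i) = \sum_(i <- r) complex.Im (f i).
    by elim/big_rec2: _ => // i a b _ <-; rewrite cImD.
  by rewrite Im_sum; apply: eq_bigr => i _; rewrite cImM /= mulr0 add0r.
rewrite mulr_sumr; apply: eq_bigr => i _.
by rewrite [RHS]mulrCA -realCM (mulrC m) divfK// [RHS]mulrC.
Qed.

(** Two successive limits inside [HQ]: Schwarz sums with more and more nodes give [w |-> B (r w)]
    for fixed [r < 1], then [r] tends to 1. *)
Lemma nonpos_HQ (B : C -> C) : (forall w, normc w < 1 -> cdiff B w) ->
  (forall w, normc w < 1 -> complex.Re (B w) <= 0) -> HQ B.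
Proof.
move=> dB B0.
have step1 (r : R) : 0 < r < 1 -> HQ (fun w => B (r%:C%C * w)).
  move=> r01; apply: (@HQ_lim (fun n => schwarz_sum B r n)); last first.
    by move=> w w1; exact: schwarz_formula.
  move=> n; pose p j := n.+1%:R^-1 * - complex.Re (B (r%:C%C * omega n j)).
  apply: HQ_ext (@HQ_discrete n p (complex.Im (B 0)) _) => [w w1|j jn].
    rewrite /schwarz_sum mulr_sumr; congr (_ + _); apply: eq_bigr => j _.
    by rewrite /p realCM -mulrA.
  rewrite /p mulr_ge0// oppr_ge0; apply: B0.
  by rewrite normcM normc_omega mulr1 normc_real gtr0_norm; lra.
pose r (n : nat) : R := 1 - n.+2%:R^-1.
have rn n : 0 < (n.+2%:R^-1 : R) < 1.
  by rewrite invr_gt0 ltr0n /= invf_lt1 ?ltr0n// ltr1n.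
apply: (@HQ_lim (fun n w => B ((r n)%:C%C * w))).
  by move=> n; apply: step1; have := rn n; rewrite /r; move: (n.+2%:R^-1) => x; lra.
move=> w w1; have [l hl] := dB w w1.
apply: (ccvg_circ (f := fun n => (r n)%:C%C * w)); last exact: cder_cvg hl.
move=> e e0; exists (Num.bound (e^-1)) => // n /= nn.
rewrite (_ : _ - w = - ((n.+2%:R^-1)%:C%C * w)); last by rewrite /r realCB rmorph1; ring.
rewrite oppc_normc normcM normc_real gtr0_norm; last by case/andP: (rn n).
apply: (@le_trans _ _ (n.+2%:R^-1 * 1)).
  by rewrite ler_wpM2l ?invr_ge0// ltW.
rewrite mulr1 -[leRHS]invrK lef_pV2 ?posrE ?invr_gt0 ?ltr0n//.
apply: (@le_trans _ _ (Num.bound (e^-1))%:R); last by rewrite ler_nat ltnW// ltnS ltnW.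
by apply/ltW/archi_boundP; rewrite invr_ge0 ltW.
Qed.

(** The sign [s] is 1 for the Herglotz kernel and [-1] for eta-transforms, whose kernel involves
    [z zeta] instead of [z / zeta]. *)
Lemma qfun_measure Q (s : R) : qfun Q -> exists2 mu : PT R, onT mu & forall f : T2 -> C,
  contT f -> cint mu f = qintc (fun u => f (cos (s * Q u), sin (s * Q u))).
Proof.
move=> [mQ _ _]; have [|mu muT hmu] := image_measure (measurable_cis s mQ).
  by move=> u; exact: cis_circle.
exists mu => // f cf; apply: complex_ext; rewrite ?Re_cint ?Im_cint /=.
  by rewrite hmu//; exact: contT_Re.
by rewrite hmu//; exact: contT_Im.
Qed.

Lemma pt_neq (z : C) p : normc z < 1 -> circ p -> z - pt p != 0.
Proof.
by move=> z1 cp; rewrite -opprB oppr_eq0; apply: subc_neq0; rewrite circ_norm1.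
Qed.

Lemma contT_hker (z : C) : normc z < 1 -> contT (fun p => (z + pt p) / (z - pt p)).
Proof.
move=> z1; apply: contTM; first by apply: contTD; [exact: contT_cst|exact: contT_pt].
apply: contTV => [p cp|]; first exact: pt_neq.
by apply: contTB; [exact: contT_cst|exact: contT_pt].
Qed.

Lemma HQ_herglotz (B : C -> C) : HQ B ->
  exists (gamma : R) (tau : {finite_measure set T2 -> \bar R}), herglotz_rep B gamma tau.
Proof.
move=> [[[g m] Q] /= [m0 qQ hB]].
have [mu muT hmu] := qfun_measure 1 qQ.
exists g, (mscale (NngNum m0) mu : {finite_measure set T2 -> \bar R}); split.
  by rewrite /onT /= /mscale /= muT mule0.
move=> z /unitDE z1; rewrite hB//; congr (_ + _).
have cK := contT_hker z1.
have -> : qintc (fun u => hker z (Q u)) = cint mu (fun p => (z + pt p) / (z - pt p)).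
  rewrite hmu//; congr qintc; apply/funext => u; by rewrite mul1r pt_cis.
(* Scaling the measure is immediate for nonnegative integrands; a signed [f] is first shifted by its
   bound [M], and the constant is subtracted afterwards. *)
have sc (f : T2 -> R) : contT (fun p => (f p)%:C%C) ->
    Rintegral (mscale (NngNum m0) mu) circ f = m * Rintegral mu circ f.
  move=> cf; have [M hM] := contT_bounded cf.
  have mc := @measurable_circle R.
  have fin0 := prob_circle_fin mu.
  have fin1 : (mscale (NngNum m0) mu circ < +oo)%E.
    by rewrite -ge0_fin_numE// fin_num_measure.
  have cfM : contT (fun p => (f p + M)%:C%C).
    apply: (@contT_ext _ (fun p => (f p)%:C%C + M%:C%C)); first by move=> p _; rewrite realCD.
    by apply: contTD => //; exact: contT_cst.
  have fM0 p : circ p -> 0 <= f p + M.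
    by move=> cp; have := hM p cp; rewrite normc_real ler_norml; lra.
  have E : Rintegral (mscale (NngNum m0) mu) circ (fun p => f p + M) =
      m * Rintegral mu circ (fun p => f p + M).
    rewrite /Rintegral ge0_integral_mscale//=.
    - rewrite fineM//; apply: integrable_fin_num => //.
      exact: contT_integrable fin0 _ cfM.
    - by have mm := contT_measurable cfM; move/measurable_EFinP: mm.
  have cM : contT (fun=> (M%:C%C : C)) by exact: contT_cst.
  move: E; rewrite !RintegralD//; first last.
  - exact: (contT_integrable fin1 (f := fun=> M) cM).
  - exact: (contT_integrable fin1 cf).
  - exact: (contT_integrable fin0 (f := fun=> M) cM).
  - exact: (contT_integrable fin0 cf).
  rewrite !Rintegral_cst// /mscale /= fineM//; last by rewrite fin_num_measure.
  move=> E; apply: (@addIr _ (M * (m * fine (mu circ)))); apply: (etrans E).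
  by rewrite mulrDr; congr (_ + _); exact: mulrCA.
apply: complex_ext; rewrite !cReIm ?Re_cint ?Im_cint /=.
  by rewrite !sc; [ring|exact: contT_Im|exact: contT_Re].
by rewrite !sc; [ring|exact: contT_Im].
Qed.

End HerglotzClass.

(** * Characterization of eta-transforms *)

Section EtaClass.
Variable R : realType.
Local Notation C := R[i].
Local Notation T2 := (R * R)%type.
Local Notation circ := (@circleT R).

Definition SC (f : C -> C) := exists2 mu : PT R, onT mu &
  forall z, normc z < 1 -> Defs.eta mu z = f z.

Lemma eta_kint (mu : PT R) z : onT mu -> normc z < 1 -> Defs.eta mu z = (kint mu z - 1) / kint mu z.
Proof. by move=> muT z1; rewrite /Defs.eta psi_kint// (addrC 1) subrK. Qed.

Lemma one_sub_neq0 (f : C -> C) z : (forall z, normc z < 1 -> normc (f z) <= normc z) ->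
  normc z < 1 -> 1 - f z != 0.
Proof. by move=> fz z1; apply: subc_neq0; rewrite normc1E (le_lt_trans (fz z z1)). Qed.

(** If [f] is the eta-transform, then [kint = 1 / (1 - f)] and the Cayley transform of [f] is
    [1 - 2 kint]. Since [(z + zeta) / (z - zeta) = 1 - 2 / (1 - z / zeta)], the required measure is
    the reflection of the Herglotz measure, and [f 0 = 0] forces mass 1 and no rotation. *)
Lemma HQ_SC (f : C -> C) : (forall z, normc z < 1 -> normc (f z) <= normc z) ->
  HQ (fun z => - ((1 + f z) / (1 - f z))) -> SC f.
Proof.
move=> fz [[[g m] Q] /= [m0 qQ hB]].
have O1 : normc (0 : C) < 1 by rewrite normc0E.
have f0 : f 0 = 0.
  by apply/eqP; rewrite -normc_eq0 eq_le normc_ge0 andbT; have := fz 0 O1; rewrite normc0E.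
have [hm hg] := HQ0 hB.
have m1 : m = 1.
  by apply: oppr_inj; rewrite -hm f0 addr0 subr0 divr1.
have g0 : g = 0 by rewrite -hg f0 addr0 subr0 divr1 /= oppr0.
have [mu muT hmu] := qfun_measure (-1) qQ.
have fin0 := prob_circle_fin mu.
exists mu => // z z1.
have ck := contT_kernel z1.
have E : 1 - 2 * kint mu z = - ((1 + f z) / (1 - f z)).
  rewrite hB// m1 g0 rmorph0 rmorph1 mulr0 add0r mul1r.
  rewrite -[X in X - _](cint1 muT 1) /kint -(cintZ fin0 _ ck) -(cintB fin0); last 2 first.
  - exact: contT_cst.
  - by apply: contTM => //; exact: contT_cst.
  rewrite hmu; last first.
    by apply: contTB; [exact: contT_cst|apply: contTM => //; exact: contT_cst].
  congr qintc; apply/funext => u; rewrite pt_cis mulN1r.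
  have -> : cis (- Q u) = (cis (Q u))^-1.
    by apply: (mulfI (cis_neq0 (Q u))); rewrite -cisD subrr cis0 divff// cis_neq0.
  rewrite /hker; have h1 := hker_neq0 (Q u) z1; have h2 := cis_neq0 (Q u).
  have h3 : cis (Q u) - z != 0 by rewrite -opprB oppr_eq0.
  by field; rewrite ?h1 ?h2 ?h3.
have n0 := one_sub_neq0 fz z1.
have kE : kint mu z = (1 - f z)^-1.
  have two0 : (2 : C) != 0 by rewrite pnatr_eq0.
  apply: (mulfI two0); apply: (addrI (- 1)); rewrite -[LHS]opprK opprD opprK E opprK.
  by field.
by rewrite eta_kint// kE; field; rewrite ?n0.
Qed.

Lemma cayley_HQ (f : C -> C) : (forall z, normc z < 1 -> cdiff f z) ->
  (forall z, normc z < 1 -> normc (f z) <= normc z) ->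
  HQ (fun z => - ((1 + f z) / (1 - f z))).
Proof.
move=> df fz; apply: nonpos_HQ => z z1.
  have [l hl] := df z z1; have n0 := one_sub_neq0 fz z1.
  exists (- (((0 + l) * (1 - f z)^-1 + (1 + f z) * (- (0 - l) / (1 - f z) ^+ 2)))).
  apply: gderN; first exact: ccvg_id.
  apply: cderM; first by apply: cderD => //; exact: cder_cst.
  by apply: (cderV (f := fun w => 1 - f w)) => //; apply: cderB => //; exact: cder_cst.
have n0 := one_sub_neq0 fz z1.
have hV (u v : C) : v != 0 -> complex.Re (u / v) =
    (complex.Re u * complex.Re v + complex.Im u * complex.Im v) / normc v ^+ 2.
  move=> v0; rewrite sqr_normcE cReM; case: u v v0 => a b [c d] _ /=.
  by rewrite mulrN opprK !mulrA -mulrDl.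
rewrite cReN oppr_le0 hV// divr_ge0 ?sqr_ge0//.
have : normc (f z) ^+ 2 <= 1.
  by rewrite expr_le1 ?normc_ge0// (le_trans (fz z z1))// ltW.
rewrite sqr_normcE !cReD !cImD !cReN !cImN /=; nra.
Qed.

Lemma diff_SC (f : C -> C) : (forall z, normc z < 1 -> cdiff f z) ->
  (forall z, normc z < 1 -> normc (f z) <= normc z) -> SC f.
Proof. by move=> df fz; apply: HQ_SC => //; exact: cayley_HQ. Qed.

Lemma SC_diff (f : C -> C) : SC f -> (forall z, normc z < 1 -> cdiff f z) /\
  (forall z, normc z < 1 -> normc (f z) <= normc z).
Proof.
move=> [mu muT hf]; split=> z z1; last by rewrite -hf//; exact: normc_eta.
have [l hl] := cdiff_eta muT z1; exists l; apply: gder_ext hl; first exact: hf.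
by apply: filterS (cnbhs_ltnormc z1) => w w1; exact: hf.
Qed.

(** The Cayley transform passes to pointwise limits because [1 - g] stays away from zero, and
    [HQ_lim] does the rest; analyticity of [g] is a consequence. *)
Lemma SC_lim (f : nat -> C -> C) (g : C -> C) : (forall n, SC (f n)) ->
  (forall z, normc z < 1 -> ccvg \oo (fun n => f n z) (g z)) -> SC g.
Proof.
move=> hf fg.
have gz z : normc z < 1 -> normc (g z) <= normc z.
  move=> z1; apply/ler_addgt0Pr => e e0.
  have [N _ hN] := fg z z1 e e0.
  have := hN N (leqnn N); have := (SC_diff (hf N)).2 z z1.
  by have := normcB (f N z) (f N z - g z); rewrite (_ : _ - (f N z - g z) = g z); [lra|ring].
apply: HQ_SC => //.
apply: (@HQ_lim _ (fun n z => - ((1 + f n z) / (1 - f n z)))).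
  by move=> n; have [h1 h2] := SC_diff (hf n); exact: cayley_HQ.
move=> z z1; apply: ccvgN; apply: ccvgM.
  by apply: ccvgD; [exact: ccvg_cst|exact: fg].
apply: ccvgV; first exact: one_sub_neq0.
by apply: ccvgB; [exact: ccvg_cst|exact: fg].
Qed.

End EtaClass.

(** * Flows in the disc *)

Section TimeIntegral.
Variable R : realType.
Local Notation C := R[i].
Implicit Types (g h : R -> C).

Definition rcont g := forall x : R, ccvg (nbhs x) g (g x).

(* The integral of [g] over [0, t], frozen at its initial value for [t <= 0]. *)
Definition cI g (t : R) : C := prim g (Num.max t 0) - prim g 0.

Lemma cIE g t : 0 <= t -> cI g t = prim g t - prim g 0.
Proof. by move=> t0; rewrite /cI max_l. Qed.

Lemma cI0 g : cI g 0 = 0. Proof. by rewrite cIE// subrr. Qed.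

Lemma maxr0_lip (x y : R) : `|Num.max y 0 - Num.max x 0| <= `|y - x|.
Proof.
rewrite !maxElt; case: ltP => h1; case: ltP => h2; rewrite ?subrr ?normr0 ?normr_ge0//.
  by rewrite sub0r normrN (ger0_norm h2) ler0_norm; lra.
by rewrite subr0 (ger0_norm h1) ger0_norm; lra.
Qed.

Lemma rcont_max g : rcont g -> rcont (fun t => g (Num.max t 0)).
Proof.
move=> cg x e e0; have /nbhsRP[d d0 hd] := cg (Num.max x 0) e e0.
by apply/nbhsRP; exists d => // y yx; apply: hd; apply: le_lt_trans yx; exact: maxr0_lip.
Qed.

Lemma rcont_cI g : rcont g -> rcont (cI g).
Proof.
move=> cg; apply: (@rcont_max (fun t => prim g t - prim g 0)) => x.
by apply: ccvgB; [exact: (rder_cvg (rder_prim cg x))|exact: ccvg_cst].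
Qed.

Lemma cI_dist g h (k k' : R -> R) t : rcont g -> rcont h -> 0 <= t ->
  (forall x, 0 <= x <= t -> rder (fun y => (k y)%:C)%C x (k' x)%:C%C) ->
  (forall x, 0 <= x <= t -> normc (g x - h x) <= k' x) ->
  normc (cI g t - cI h t) <= k t - k 0.
Proof.
move=> cg ch t0 dk gh; rewrite !cIE//.
rewrite (_ : _ - _ - _ = (prim g t - prim h t) - (prim g 0 - prim h 0)); last by ring.
apply: (@mvi _ (fun s => prim g s - prim h s) (fun s => g s - h s) k k') => // x _.
by apply: rderB; exact: rder_prim.
Qed.

Lemma rder_scale (M x : R) : rder (fun y : R => (M * y)%:C)%C x (M%:C)%C.
Proof.
have := rderZ (M%:C)%C (rder_id x); rewrite mulr1; apply: gder_ext; first by rewrite realCM.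
by apply: filterE => y; rewrite realCM.
Qed.

Lemma cI_bound g M t : rcont g -> 0 <= t -> (forall x, 0 <= x <= t -> normc (g x) <= M) ->
  normc (cI g t) <= M * t.
Proof.
move=> cg t0 gM; rewrite cIE//.
have := @mvi_lip _ (prim g) g M 0 t t0; rewrite subr0; apply=> // x _.
exact: rder_prim.
Qed.

Lemma cI_ext g h t : rcont g -> rcont h -> (forall x, 0 <= x -> g x = h x) -> cI g t = cI h t.
Proof.
move=> cg ch gh; have [t0|/ltW t0] := leP 0 t; last by rewrite /cI !max_r// !subrr.
apply/eqP; rewrite -subr_eq0 -normc_eq0 eq_le normc_ge0 andbT.
have -> : 0 = 0 * t - 0 * 0 :> R by rewrite !mul0r subrr.
apply: (@cI_dist g h (fun y => 0 * y) (fun=> 0)) => // x /andP[x0 _].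
  exact: rder_scale.
by rewrite gh// subrr normc0E.
Qed.

Lemma cI_riemann g t : rcont g -> 0 <= t ->
  ccvg \oo (fun n => \sum_(i < n.+1) (t / n.+1%:R)%:C%C * g (i%:R * (t / n.+1%:R))) (cI g t).
Proof.
move=> cg t0; rewrite cIE//.
have := @riemann_sum _ (prim g) g 0 t t0; rewrite subr0 => h.
apply: ccvg_ext (h _ _) => [n|x _|x _].
- by apply: eq_bigr => i _; rewrite add0r.
- exact: rder_prim.
- exact: cg.
Qed.

Lemma Re_cI g t : rcont g -> (forall x, 0 <= x -> complex.Re (g x) <= 0) -> complex.Re (cI g t) <= 0.
Proof.
move=> cg g0; have [t0|/ltW t0] := leP 0 t; last by rewrite /cI max_r// subrr.
apply/ler_addgt0Pr => e e0; rewrite add0r.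
have [N _ hN] := cI_riemann cg t0 e0.
have := hN N (leqnn N); rewrite /= distcC => h.
apply: le_trans (Re_leD_normc _ (\sum_(i < N.+1) (t / N.+1%:R)%:C%C * g (i%:R * (t / N.+1%:R)))) _.
have : complex.Re (\sum_(i < N.+1) (t / N.+1%:R)%:C%C * g (i%:R * (t / N.+1%:R))) <= 0.
  rewrite Re_sum; apply: sumr_le0 => i _; rewrite cReM /= mul0r subr0.
  have tN : 0 <= t / N.+1%:R by rewrite divr_ge0.
  by apply: mulr_ge0_le0 => //; apply: g0; rewrite mulr_ge0.
lra.
Qed.

Lemma rcont_shift g t : rcont g -> rcont (fun s => g (t + s)).
Proof.
move=> cg x e e0; have /nbhsRP[d d0 hd] := cg (t + x) e e0.
apply/nbhsRP; exists d => // y yx; apply: hd.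
by rewrite (_ : t + y - (t + x) = y - x); last by ring.
Qed.

Lemma rder_shift (F : R -> C) t x l : rder F (t + x) l -> rder (fun s => F (t + s)) x l.
Proof.
move=> dF e e0; have /nbhsRP[d d0 hd] := dF e e0.
apply/nbhsRP; exists d => // y yx.
have E : t + y - (t + x) = y - x by ring.
have EC : (t + y)%:C%C - (t + x)%:C%C = y%:C%C - x%:C%C :> C by rewrite -!realCB E.
have := hd (t + y); rewrite E => /(_ yx); rewrite EC; exact.
Qed.

Lemma cI_add g s t : rcont g -> 0 <= s -> 0 <= t ->
  cI g (t + s) = cI g t + cI (fun r => g (t + r)) s.
Proof.
move=> cg s0 t0; rewrite !cIE ?addr_ge0//.
have csh := rcont_shift t cg.
have := @rder0_cst _ (fun r => prim g (t + r) - prim (fun r => g (t + r)) r) 0 s.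
move=> /(_ _ s 0); rewrite addr0 => H.
have {}H : prim g (t + s) - prim (fun r => g (t + r)) s = prim g t - prim (fun r => g (t + r)) 0.
  apply: H; rewrite ?lexx ?s0//.
  move=> x _; rewrite -(subrr (g (t + x))); apply: rderB; last exact: (rder_prim csh).
  exact/rder_shift/rder_prim.
by move/eqP: H; rewrite subr_eq => /eqP ->; ring.
Qed.

Lemma rder_exp_cI (z : C) g t : rcont g ->
  rder (fun s => z * cexp (prim g s - prim g 0)) t (z * cexp (prim g t - prim g 0) * g t).
Proof.
move=> cg; rewrite -mulrA; apply: rderZ.
apply: (rder_comp (f := fun s => prim g s - prim g 0)); last exact: cder_cexp.
by rewrite -[g t]subr0; apply: rderB; [exact: rder_prim|exact: rder_cst].
Qed.

(** The limit is taken along the ultrafilter; the Cauchy bound then passes to it. *)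
Lemma cauchy_limit (x : nat -> C) (c : R) : 0 <= c ->
  (forall n m, (n <= m)%N -> normc (x m - x n) <= c / 2 ^+ n) ->
  exists l, forall n, normc (l - x n) <= c / 2 ^+ n.
Proof.
move=> c0 hx; have [U [UP sU ul]] := ultra_limits R.
have bx n : normc (x n) <= normc (x 0%N) + c.
  have := hx 0%N n (leq0n n); rewrite expr0 divr1.
  by have := normcD (x n - x 0%N) (x 0%N); rewrite subrK; lra.
have [a ha] := ul _ _ (fun n => le_trans (Re_le_normc _) (bx n)).
have [b hb] := ul _ _ (fun n => le_trans (Im_le_normc _) (bx n)).
exists (Complex a b) => n; apply/ler_addgt0Pr => e e0.
have e2 : 0 < e / 2 by rewrite divr_gt0.
have Un : U (fun m => (n <= m)%N) by apply: sU; exists n.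
have [m [nm [h1 h2]]] := filter_ex (filterI Un (filterI (ha _ e2) (hb _ e2))).
apply: le_trans (distc_tri (x m) _ _) _; rewrite addrC; apply: lerD; first exact: hx.
rewrite distcC; apply: le_trans (normc_le_ReIm _) _; rewrite !cReIm /=; lra.
Qed.

End TimeIntegral.

(** * Picard iteration for the flow of a generator *)

Section Flow.
Variable R : realType.
Local Notation C := R[i].
Variable B : C -> C.
Hypothesis dB : forall w, normc w < 1 -> cdiff B w.
Hypothesis B0 : forall w, normc w < 1 -> complex.Re (B w) <= 0.
Hypothesis lipB : forall r : R, r < 1 -> exists2 L, 0 < L &
  forall w w', normc w <= r -> normc w' <= r -> normc (B w - B w') <= L * normc (w - w').

Lemma rcont_B (p : R -> C) r : r < 1 -> (forall t, normc (p t) <= r) -> rcont p ->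
  rcont (fun t => B (p t)).
Proof.
move=> r1 pr cp x; have [l hl] := dB (le_lt_trans (pr x) r1).
exact: ccvg_circ (cp x) (cder_cvg hl).
Qed.

(** The equation [phi' = phi B(phi)] integrated in logarithmic form. As [Re B <= 0], the exponential
    has modulus at most 1, so iterates never leave the disc of radius [|z|]. *)
Definition picard (z : C) (p : R -> C) (t : R) : C := z * cexp (cI (fun s => B (p s)) t).

Lemma picard_norm z p r : r < 1 -> (forall t, normc (p t) <= r) -> rcont p ->
  forall t, normc (picard z p t) <= normc z.
Proof.
move=> r1 pr cp t; rewrite /picard normcM -[leRHS]mulr1 ler_wpM2l ?normc_ge0//.
apply: normc_cexp_le1; apply: Re_cI; first exact: (rcont_B r1 pr cp).
by move=> x _; apply: B0; exact: le_lt_trans r1.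
Qed.

Lemma picard_cont z p r : r < 1 -> (forall t, normc (p t) <= r) -> rcont p -> rcont (picard z p).
Proof.
move=> r1 pr cp x; apply: ccvgM; first exact: ccvg_cst.
apply: ccvg_circ (rcont_cI (rcont_B r1 pr cp) x) _.
exact: cder_cvg (cder_cexp _).
Qed.

Lemma rder_expR (c L x : R) : L != 0 ->
  rder (fun y : R => (c / 2 * expR (2 * L * y))%:C)%C x (L * (c * expR (2 * L * x)))%:C%C.
Proof.
move=> L0.
have E (u : R) : (expR u)%:C%C = cexp u%:C%C :> C.
  by apply: complex_ext; rewrite /cexp /= ?cos0 ?sin0 ?mulr1 ?mulr0.
have h : rder (fun y : R => (c / 2)%:C%C * cexp ((2 * L * y)%:C)%C) x
    ((c / 2)%:C%C * (cexp ((2 * L * x)%:C)%C * (2 * L)%:C%C)).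
  apply: rderZ; apply: (rder_comp (f := fun y : R => ((2 * L * y)%:C)%C)); first exact: rder_scale.
  exact: cder_cexp.
rewrite (_ : (L * _)%:C%C = (c / 2)%:C%C * (cexp ((2 * L * x)%:C)%C * (2 * L)%:C%C)).
  apply: gder_ext h; first by rewrite (realCM (c / 2)) E.
  by apply: filterE => y; rewrite (realCM (c / 2)) E.
by rewrite -E -!realCM; congr (_%:C)%C; field.
Qed.

(** In the norm weighted by [expR (2 * L * t)] the Picard map halves distances, whatever the length
    of the time interval: integrating [L * c * expR (2 * L * s)] yields a factor [1 / 2]. *)
Lemma picard_step z p q r L c T : normc z <= 1 -> r < 1 -> 0 < L ->
  (forall w w', normc w <= r -> normc w' <= r -> normc (B w - B w') <= L * normc (w - w')) ->
  (forall t, normc (p t) <= r) -> (forall t, normc (q t) <= r) -> rcont p -> rcont q ->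
  0 <= c -> (forall s, 0 <= s <= T -> normc (p s - q s) <= c * expR (2 * L * s)) ->
  forall t, 0 <= t <= T -> normc (picard z p t - picard z q t) <= c / 2 * expR (2 * L * t).
Proof.
move=> z1 r1 L0 lip pr qr cp cq c0 pq t /andP[t0 tT].
rewrite /picard -mulrBr normcM.
have gp := rcont_B r1 pr cp; have gq := rcont_B r1 qr cq.
have Rp : complex.Re (cI (fun s => B (p s)) t) <= 0.
  by apply: Re_cI => // x _; apply: B0; exact: le_lt_trans r1.
have Rq : complex.Re (cI (fun s => B (q s)) t) <= 0.
  by apply: Re_cI => // x _; apply: B0; exact: le_lt_trans r1.
have H : normc (cI (fun s => B (p s)) t - cI (fun s => B (q s)) t) <=
    c / 2 * expR (2 * L * t) - c / 2 * expR (2 * L * 0).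
  apply: (@cI_dist _ _ _ (fun s => c / 2 * expR (2 * L * s)) (fun s => L * (c * expR (2 * L * s)))) => //.
    by move=> x _; apply: rder_expR; rewrite gt_eqF.
  move=> x /andP[x0 xt]; apply: le_trans (lip _ _ (pr x) (qr x)) _.
  by rewrite ler_pM2l//; apply: pq; rewrite x0 (le_trans xt).
apply: (@le_trans _ _ (1 * normc (cexp (cI (fun s => B (p s)) t) - cexp (cI (fun s => B (q s)) t)))).
  by rewrite ler_wpM2r ?normc_ge0.
rewrite mul1r; apply: le_trans (cexp_lip Rp Rq) _; apply: (le_trans H).
by rewrite gerBl mulr_ge0 ?divr_ge0// expR_ge0.
Qed.

Fixpoint W (n : nat) (z : C) : R -> C :=
  if n is k.+1 then picard z (W k z) else fun=> z.

Lemma W_props n z : normc z < 1 -> (forall t, normc (W n z t) <= normc z) /\ rcont (W n z).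
Proof.
move=> z1; elim: n => [|n [h1 h2]] /=; first by split=> // x; exact: ccvg_cst.
split; first by apply: picard_norm; [exact: z1|exact: h1|exact: h2].
by apply: picard_cont; [exact: z1|exact: h1|exact: h2].
Qed.

Lemma picard_max z p t : picard z p t = picard z p (Num.max t 0).
Proof.
have E : Num.max (Num.max t 0) 0 = Num.max t 0 by apply/max_idPl; rewrite le_max lexx orbT.
by rewrite /picard /cI E.
Qed.

Lemma flow_exists z : normc z < 1 -> exists phi : R -> C,
  [/\ forall t, normc (phi t) <= normc z, rcont phi, forall t, phi t = picard z phi t &
      forall t, 0 <= t -> ccvg \oo (fun n => W n z t) (phi t)].
Proof.
move=> z1; have [L L0 lip] := lipB z1.
have z1' := ltW z1.
(* The initial gap is at most 2 because both functions stay in the unit disc. *)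
have dW n t : 0 <= t -> normc (W n.+1 z t - W n z t) <= 2 / 2 ^+ n * expR (2 * L * t).
  elim: n t => [|n IH] t t0.
    rewrite expr0 divr1; apply: le_trans (normcB _ _) _.
    have [h1 _] := W_props 1 z1; have := h1 t => /= h1t.
    have : 1 <= expR (2 * L * t) by rewrite -expR0 ler_expR !mulr_ge0// ltW.
    lra.
  have [h1 h2] := W_props n.+1 z1; have [h3 h4] := W_props n z1.
  have := @picard_step z (W n.+1 z) (W n z) (normc z) L (2 / 2 ^+ n) t z1' z1 L0 lip h1 h3 h2 h4.
  move=> /(_ _ _ t); rewrite (_ : 2 / 2 ^+ n / 2 = 2 / 2 ^+ n.+1); last first.
    by rewrite exprSr invfM mulrA.
  apply; first by rewrite divr_ge0// exprn_ge0.
    by move=> s /andP[s0 _]; exact: IH.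
  by rewrite t0 lexx.
have cau t n m : 0 <= t -> (n <= m)%N ->
    normc (W m z t - W n z t) <= 4 * expR (2 * L * t) / 2 ^+ n.
  move=> t0 nm; pose E := expR (2 * L * t).
  have E0 : 0 <= E by exact: expR_ge0.
  (* Subtracting the tail lets the geometric sum of the gaps [2 / 2 ^+ k] telescope by induction on
     [m]. *)
  suff : normc (W m z t - W n z t) <= 4 * E / 2 ^+ n - 4 * E / 2 ^+ m.
    have : 0 <= 4 * E / 2 ^+ m by rewrite divr_ge0 ?mulr_ge0// exprn_ge0.
    rewrite -/E; lra.
  rewrite -(subnKC nm); elim: (m - n)%N => [|k IH]; first by rewrite addn0 !subrr normc0E.
  apply: le_trans (distc_tri (W (n + k)%N z t) _ _) _; rewrite addnS.
  have := dW (n + k)%N t t0; rewrite -/E => h.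
  have -> : 4 * E / 2 ^+ (n + k).+1 = 4 * E / 2 ^+ (n + k) - 2 / 2 ^+ (n + k) * E.
    by rewrite exprSr invfM; move: (2 ^+ (n + k))^-1 => X; field.
  lra.
have lim t : exists l, forall n, normc (l - W n z (Num.max t 0)) <=
    4 * expR (2 * L * Num.max t 0) / 2 ^+ n.
  have t0 : 0 <= Num.max t 0 by rewrite le_max lexx orbT.
  by apply: cauchy_limit => [|n m nm]; [rewrite mulr_ge0// expR_ge0|exact: cau].
have [phi hphi] := choice lim.
have cvg_phi t : 0 <= t -> ccvg \oo (fun n => W n z t) (phi t).
  move=> t0 e e0; have [N hN] := halving_lt (4 * expR (2 * L * t)) e0.
  exists N => // n /= Nn; have := hphi t n; rewrite max_l// distcC => h.
  apply: (le_trans h); apply: le_trans (ltW hN).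
  rewrite ler_wpM2l ?mulr_ge0 ?expR_ge0// lef_pV2 ?posrE ?exprn_gt0//.
  by rewrite ler_eXn2l// ltr1n.
have Wmax n t : W n z t = W n z (Num.max t 0) by case: n => //= n; exact: picard_max.
have phiz t : normc (phi t) <= normc z.
  apply/ler_addgt0Pr => e e0.
  have [n hn] := halving_lt (4 * expR (2 * L * Num.max t 0)) e0.
  have [h1 _] := W_props n z1.
  have := normcD (phi t - W n z (Num.max t 0)) (W n z (Num.max t 0)); rewrite subrK.
  have := hphi t n; have := h1 (Num.max t 0); lra.
have cphi : rcont phi.
  move=> t e e0; have e3 : 0 < e / 3 by rewrite divr_gt0.
  have [n hn] := halving_lt (4 * expR (2 * L * (`|t| + 1))) e3.
  have [_ h2] := W_props n z1.
  have close s : s <= `|t| + 1 -> normc (phi s - W n z s) <= e / 3.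
    move=> st; rewrite Wmax; apply: le_trans (hphi s n) _; apply: le_trans (ltW hn).
    rewrite ler_wpM2r ?invr_ge0 ?exprn_ge0// ler_pM2l// ler_expR ler_pM2l ?mulr_gt0//.
    by rewrite ge_max st /=; have := normr_ge0 t; lra.
  have /nbhsRP[d d0 hd] := h2 t _ e3.
  apply/nbhsRP; exists (Num.min d 1); first by rewrite lt_min d0 ltr01.
  move=> y; rewrite lt_min => /andP[yd y1].
  have yt : y <= `|t| + 1.
    by have := ler_norm t; move: y1; rewrite ltr_norml; lra.
  have tt : t <= `|t| + 1 by have := ler_norm t; lra.
  apply: le_trans (distc_tri (W n z y) _ _) _.
  apply: le_trans (lerD (close y yt) (distc_tri (W n z t) _ _)) _.
  have := hd y yd; have := close t tt; rewrite (distcC (phi t)); lra.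
exists phi; split=> //.
(* Both sides are limits of [W n.+1 z t]: the left one by shifting the index, the right one by the
   contraction estimate. *)
have fix0 t : 0 <= t -> phi t = picard z phi t.
  move=> t0; apply: (@ccvg_unique _ _ \oo _ (fun n => W n.+1 z t)).
    by move=> e /(cvg_phi t t0)[N _ hN]; exists N => // n Nn; apply: (hN n.+1); exact: leqW Nn.
  move=> e e0; have [N hN] := halving_lt (4 * expR (2 * L * t) * expR (2 * L * t)) e0.
  exists N => // n /= Nn.
  have [h1 h2] := W_props n z1.
  have c0 : 0 <= 4 * expR (2 * L * t) / 2 ^+ n by rewrite divr_ge0 ?mulr_ge0 ?expR_ge0// exprn_ge0.
  have hp s : 0 <= s <= t -> normc (W n z s - phi s) <= 4 * expR (2 * L * t) / 2 ^+ n * expR (2 * L * s).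
    move=> /andP[s0 st]; have := hphi s n; rewrite max_l// distcC => h; apply: (le_trans h).
    have E1 : 1 <= expR (2 * L * s) by rewrite -expR0 ler_expR !mulr_ge0// ltW.
    rewrite -[leLHS]mulr1; apply: ler_pM => //.
    by rewrite ler_wpM2r ?invr_ge0 ?exprn_ge0// ler_pM2l// ler_expR ler_pM2l ?mulr_gt0.
  have := picard_step z1' z1 L0 lip h1 phiz h2 cphi c0 hp.
  move=> /(_ t); rewrite t0 lexx => /(_ isT) h; apply: (le_trans h).
  apply: le_trans (ltW hN); set E := expR _.
  have E0 : 0 <= E by exact: expR_ge0.
  have i0 : 0 <= 4 * E * E by rewrite !mulr_ge0.
  have iN : (2 ^+ n)^-1 <= (2 ^+ N)^-1 :> R.
    by rewrite lef_pV2 ?posrE ?exprn_gt0// ler_eXn2l// ltr1n.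
  have in0 : 0 <= (2 ^+ n)^-1 :> R by rewrite invr_ge0 exprn_ge0.
  rewrite (_ : _ / _ / _ * E = 4 * E * E * ((2 ^+ n)^-1 / 2)); last by ring.
  by rewrite ler_wpM2l//; lra.
move=> t; have [t0|/ltW t0] := leP 0 t; first exact: fix0.
rewrite picard_max max_r// -fix0//.
apply: eq_of_small => e e0.
have [n hn] := halving_lt (8 * expR (2 * L * 0)) e0.
apply: le_trans (distc_tri (W n z 0) _ _) _.
have := hphi t n; have := hphi 0 n; rewrite !max_r// (distcC (W n z 0)).
move: hn; rewrite (_ : 8 = 4 + 4 :> R); last by lra.
by rewrite mulrDl mulrDl; lra.
Qed.

(** The weighted distance of two solutions is at most 2 and is halved by each use of
    [picard_step]. *)
Lemma flow_unique z p q : normc z < 1 ->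
  (forall t, normc (p t) <= normc z) -> (forall t, normc (q t) <= normc z) -> rcont p -> rcont q ->
  (forall t, 0 <= t -> p t = picard z p t) -> (forall t, 0 <= t -> q t = picard z q t) ->
  forall t, 0 <= t -> p t = q t.
Proof.
move=> z1 pz qz cp cq fp fq; have [L L0 lip] := lipB z1.
have H n t : 0 <= t -> normc (p t - q t) <= 2 / 2 ^+ n * expR (2 * L * t).
  elim: n t => [|n IH] t t0.
    rewrite expr0 divr1; apply: le_trans (normcB _ _) _.
    have : 1 <= expR (2 * L * t) by rewrite -expR0 ler_expR !mulr_ge0// ltW.
    by have := pz t; have := qz t; lra.
  have := @picard_step z p q (normc z) L (2 / 2 ^+ n) t (ltW z1) z1 L0 lip pz qz cp cq.
  move=> /(_ _ _ t); rewrite -fp// -fq// (_ : 2 / 2 ^+ n / 2 = 2 / 2 ^+ n.+1); last first.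
    by rewrite exprSr invfM mulrA.
  apply; first by rewrite divr_ge0// exprn_ge0.
    by move=> s /andP[s0 _]; exact: IH.
  by rewrite t0 lexx.
move=> t t0; apply: eq_of_small => e e0.
have [n hn] := halving_lt (2 * expR (2 * L * t)) e0.
by apply: le_trans (H n t t0) _; rewrite mulrAC ltW.
Qed.

End Flow.

(** * Weak continuity *)

Section WeakContinuity.
Variable R : realType.
Local Notation C := R[i].
Local Notation T2 := (R * R)%type.
Local Notation circ := (@circleT R).

Lemma within_circleP (f : T2 -> R) :
  {within circ, continuous f} <-> contT (fun p => (f p)%:C%C).
Proof.
have nbP (p : T2) (A : set T2) : within circ (nbhs p) A <-> tnbhs p A.
  rewrite /within /=; split=> [/nbhs_ballP[d d0 hd]|[d d0 hd]].
    exists d => // q cq h1 h2; apply: hd => //; rewrite /ball/= /prod_ball /ball /=.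
    by split; rewrite distrC.
  apply/nbhs_ballP; exists d => // q; rewrite /ball/= /prod_ball /ball /= => -[h1 h2] cq.
  by apply: hd => //; rewrite distrC.
split=> [/subspace_continuousP h p cp e e0|h].
  have /cvgRP/(_ e e0) := h p cp => /nbP; apply: filterS => q.
  by rewrite -realCB normc_real.
apply/subspace_continuousP => p cp; apply/cvgRP => e e0.
by apply/nbP; apply: filterS (h p cp e e0) => q; rewrite -realCB normc_real.
Qed.

Definition tnear (t : R) : set_system R := within [set s : R | 0 <= s] (nbhs t).

#[global] Instance tnear_filter t : Filter (tnear t).
Proof. exact: within_filter. Qed.

Lemma tnear_ge0 t : tnear t (fun s => 0 <= s).
Proof. by rewrite /tnear /within /=; exact: filterE. Qed.

Lemma within_timeP (g : R -> R) :
  {within [set t : R | 0 <= t], continuous g} <->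
  (forall t, 0 <= t -> ccvg (tnear t) (fun s => (g s)%:C%C) ((g t)%:C)%C).
Proof.
split=> [/subspace_continuousP h t t0 e e0|h].
  by have /cvgRP/(_ e e0) := h t t0; apply: filterS => s; rewrite -realCB normc_real.
apply/subspace_continuousP => t t0; apply/cvgRP => e e0.
by apply: filterS (h t t0 e e0) => s; rewrite -realCB normc_real.
Qed.

Definition opt n j : T2 := (cos (j%:R * (pi *+ 2 / n.+1%:R)), sin (j%:R * (pi *+ 2 / n.+1%:R))).

Lemma opt_circ n j : circ (opt n j). Proof. exact: cis_circle. Qed.

Lemma cis_neq1 (y : R) : 0 < y < pi *+ 2 -> cis y != 1.
Proof.
move=> y2; apply/eqP => /(congr1 (@complex.Re R)) /= h.
have hy : y = (y / 2) *+ 2 by rewrite -mulr_natr divfK.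
have s0 : 0 < sin (y / 2).
  by apply: sin_gt0_pi; move: y2; rewrite mulr2n; lra.
move: h; rewrite hy cos_mulr2n cos2sin2 => h.
have : sin (y / 2) ^+ 2 = 0 by move: h; rewrite mulr2n; lra.
by move/eqP; rewrite sqrf_eq0 gt_eqF.
Qed.

Lemma omegaX n j k : omega n j ^+ k = omega n k ^+ j :> C.
Proof. by rewrite /omega !cisX; congr cis; ring. Qed.

Lemma omega_full n j : omega n j ^+ n.+1 = 1 :> C.
Proof.
rewrite omegaX /omega (_ : n.+1%:R * _ = pi *+ 2) ?cis2pi ?expr1n//.
by rewrite mulrC divfK// pnatr_eq0.
Qed.

Lemma omega_sum n k : (0 < k < n.+1)%N -> \sum_(j < n.+1) (omega n j ^+ k)^-1 = 0 :> C.
Proof.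
move=> /andP[k0 kn].
have w0 : (omega n k : C)^-1 - 1 != 0.
  rewrite subr_eq0 -(inj_eq invr_inj) invrK invr1; apply: cis_neq1.
  have p0 : 0 < pi *+ 2 :> R by rewrite pmulrn_rgt0// pi_gt0.
  rewrite mulr_gt0 ?divr_gt0 ?ltr0n//= mulrCA -[ltRHS]mulr1 ltr_pM2l//.
  by rewrite ltr_pdivrMr// mul1r ltr_nat.
apply: (mulfI w0); rewrite mulr0.
under eq_bigr do rewrite omegaX -exprVn.
rewrite -subrX1 exprVn omega_full invr1 subrr//.
Qed.

(* The average of [1 / (1 - x / omega^j)] keeps only the powers of [x] divisible
   by the number of nodes. *)
Lemma omega_avg n (x : C) : normc x < 1 ->
  \sum_(j < n.+1) (1 - x / omega n j)^-1 = n.+1%:R / (1 - x ^+ n.+1).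
Proof.
move=> x1.
have xn0 : 1 - x ^+ n.+1 != 0.
  by apply: subc_neq0; rewrite normcX normc1E exprn_ilt1// normc_ge0.
have o0 j : omega n j != 0 :> C by rewrite -normc_gt0 normc_omega.
have xo j : 1 - x / omega n j != 0.
  by apply: subc_neq0; rewrite normcM normcV normc_omega invr1 mulr1 normc1E.
have E j : (1 - x / omega n j)^-1 = (1 - x ^+ n.+1)^-1 * \sum_(k < n.+1) x ^+ k * (omega n j ^+ k)^-1.
  apply: (mulfI (xo j)); rewrite divff// mulrCA.
  have -> : (1 - x / omega n j) * (\sum_(k < n.+1) x ^+ k * (omega n j ^+ k)^-1) = 1 - x ^+ n.+1.
    under eq_bigr do rewrite -exprVn -exprMn.
    rewrite -[LHS]opprK -mulNr opprB -subrX1 exprMn exprVn omega_full invr1 mulr1 opprB//.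
  by rewrite mulVf.
under eq_bigr do rewrite E.
rewrite -mulr_sumr exchange_big /= mulrC; congr (_ * _).
rewrite big_ord_recl [X in _ + X]big1 ?addr0.
  by rewrite (eq_bigr (fun=> 1)) ?sumr_const ?card_ord// => j _; rewrite !expr0 invr1 mulr1.
by move=> k _; rewrite -mulr_sumr omega_sum ?mulr0// lift0 /= ltnS ltn_ord.
Qed.

(** The Poisson kernel [Re ((1 + x) / (1 - x))], written through [1 / (1 - x)], whose integral
    against a measure is [kint]. *)
Definition poisson (x : C) : R := 2 * complex.Re (1 - x)^-1 - 1.

Lemma poissonE (x : C) : normc x < 1 -> poisson x = (1 - normc x ^+ 2) / normc (1 - x) ^+ 2.
Proof.
move=> x1.
have x0 : 1 - x != 0 by apply: subc_neq0; rewrite normc1E.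
have n0 : normc (1 - x) ^+ 2 != 0 by rewrite expf_neq0// normc_eq0.
have hV (u : C) : u != 0 -> complex.Re u^-1 = complex.Re u / normc u ^+ 2.
  by move=> u0; rewrite sqr_normcE; case: u u0 => a b _ /=.
rewrite /poisson hV//; apply: (mulIf n0); rewrite divfK//.
have -> (a w : R) : w != 0 -> (2 * (a / w) - 1) * w = 2 * a - w by move=> ?; field.
  by rewrite !sqr_normcE !cReD !cImD !cReN !cImN /=; ring.
by [].
Qed.

(** Nodes near [p] are handled by uniform continuity, the others by smallness of the kernel. The
    weights average to [poisson (x ^+ n.+1)], which is close to 1 once [r ^+ n.+1] is small; hence
    [r] is fixed first and [n] after it. *)
Lemma poisson_approx (f : T2 -> R) : contT (fun p => (f p)%:C%C) -> forall e, 0 < e ->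
  exists r n, 0 < r < 1 /\ forall p, circ p ->
    `|f p - n.+1%:R^-1 * \sum_(j < n.+1) f (opt n j) * poisson (r%:C%C * pt p / omega n j)| <= e.
Proof.
move=> cf e e0.
have [M0 hM0] := contT_bounded cf.
pose M := `|M0| + 1.
have M_gt0 : 0 < M by rewrite ltr_wpDl.
have hM p : circ p -> `|f p| <= M.
  by move=> /hM0; rewrite normc_real /M; have := ler_norm M0; lra.
have e8 : 0 < e / 8 by rewrite divr_gt0.
have [d0 d00 hd0] := contT_unif cf e8.
pose d := Num.min d0 1.
have d_gt0 : 0 < d by rewrite lt_min d00 ltr01.
have dd0 : d <= d0 by rewrite ge_min lexx.
(* The first bound keeps nodes far from [p] at distance at least [d / 2] from [x]; the second brings
   their contribution [2 * M * (8 * s / d ^+ 2)] below [e / 8]. *)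
pose s := Num.min (d / 2) (e * d ^+ 2 / (128 * M)).
have s_gt0 : 0 < s by rewrite lt_min !divr_gt0 ?mulr_gt0 ?exprn_gt0.
have sd : s <= d / 2 by rewrite ge_min lexx.
have se : s <= e * d ^+ 2 / (128 * M) by rewrite ge_min lexx orbT.
have d1 : d <= 1 by rewrite ge_min lexx orbT.
pose r := 1 - s.
have r01 : 0 < r < 1 by rewrite /r; lra.
have /andP[r0 r1] := r01.
(* For [q = r ^+ n.+1], the bound [1 / 2] keeps [1 - x ^+ n.+1] away from zero and the other one
   makes [4 * q * M] at most [e / 4]. *)
have q0 : 0 < Num.min (1 / 2) (e / (16 * M)) by rewrite lt_min !divr_gt0 ?mulr_gt0.
have [n hn] : exists n : nat, r ^+ n.+1 <= Num.min (1 / 2) (e / (16 * M)).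
  have rn : `|r| < 1 by rewrite ger0_norm// ltW.
  have /cvgRP/(_ _ q0)[N _ hN] := cvg_expr rn.
  exists N; have := hN N.+1 (leqnSn N); rewrite /= subr0; apply: le_trans.
  by rewrite ger0_norm// exprn_ge0// ltW.
exists r, n; split=> // p cp.
move: hn; rewrite le_min => /andP[q2 qe].
pose x := r%:C%C * pt p.
have nx : normc x = r by rewrite normcM circ_norm1// mulr1 normc_real gtr0_norm.
have nxo j : normc (x / omega n j) = r by rewrite normcM normcV normc_omega invr1 mulr1.
pose P j := poisson (x / omega n j).
have P0 j : 0 <= P j.
  rewrite /P poissonE nxo// divr_ge0 ?exprn_ge0 ?normc_ge0// subr_ge0.
  by rewrite -[leRHS](expr1n _ 2) ler_pXn2r ?nnegrE//; move: r0 r1; clear; lra.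
pose A := n.+1%:R^-1 * \sum_(j < n.+1) P j.
have n0 : n.+1%:R != 0 :> R by rewrite pnatr_eq0.
have AE : A = poisson (x ^+ n.+1).
  have -> : A = n.+1%:R^-1 * (2 * complex.Re (\sum_(j < n.+1) (1 - x / omega n j)^-1) - n.+1%:R).
    rewrite /A; congr (_ * _); rewrite Re_sum mulr_sumr.
    have -> : n.+1%:R = \sum_(j < n.+1) 1 :> R by rewrite sumr_const card_ord.
    by rewrite -sumrB.
  rewrite omega_avg ?nx// /poisson.
  have -> : n.+1%:R / (1 - x ^+ n.+1) = (n.+1%:R)%:C%C / (1 - x ^+ n.+1) by rewrite rmorph_nat.
  rewrite cReM /=; set u := complex.Re _; set N := n.+1%:R.
  by rewrite mul0r subr0; field.
pose q := r ^+ n.+1.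
have q_ge0 : 0 <= q by rewrite exprn_ge0// ltW.
have nq : normc (x ^+ n.+1) = q by rewrite normcX nx.
have A1 : `|A - 1| <= 4 * q.
  have x10 : 1 - x ^+ n.+1 != 0 by apply: subc_neq0; rewrite nq normc1E; rewrite -/q in q2; move: q2; clear; lra.
  rewrite AE /poisson (_ : _ - 1 - 1 = 2 * complex.Re ((1 - x ^+ n.+1)^-1 - 1)); last first.
    by rewrite !cReIm /=; ring.
  rewrite normrM ger0_norm// (_ : 4 * q = 2 * (2 * q)); last by ring.
  rewrite ler_pM2l//; apply: le_trans (Re_le_normc _) _.
  have -> : (1 - x ^+ n.+1)^-1 - 1 = x ^+ n.+1 / (1 - x ^+ n.+1) by field.
  rewrite normcM normcV nq mulrC ler_wpM2r//.
  have : 1 / 2 <= normc (1 - x ^+ n.+1).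
    have := normcD (1 - x ^+ n.+1) (x ^+ n.+1); rewrite subrK normc1E nq.
    by rewrite -/q in q2; move: q2; clear; lra.
  by move=> h; rewrite invf_ple ?posrE//; move: h; clear; lra.
have q_M : 4 * q * M <= e / 4.
  have : q * (16 * M) <= e by rewrite -ler_pdivlMr ?mulr_gt0.
  clear; lra.
have A3 : A <= 3.
  by move: A1; rewrite ler_norml; rewrite -/q in q2; move: q2; clear; lra.
have far j : d <= `|p.1 - (opt n j).1| \/ d <= `|p.2 - (opt n j).2| -> P j <= 8 * s / d ^+ 2.
  move=> hj.
  have o1 : d <= normc (pt p - omega n j).
    case: hj => h; apply: (le_trans h).
      by have := Re_le_normc (pt p - omega n j); rewrite !cReIm.
    by have := Im_le_normc (pt p - omega n j); rewrite !cReIm.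
  have o2 : d / 2 <= normc (1 - x / omega n j).
    have -> : 1 - x / omega n j = (omega n j - x) / omega n j.
      by rewrite mulrBl divff// -normc_eq0 normc_omega oner_eq0.
    rewrite normcM normcV normc_omega invr1 mulr1.
    have := distc_tri x (pt p) (omega n j); rewrite (distcC x (omega n j)).
    have -> : pt p - x = s%:C%C * pt p by rewrite /x /r realCB; ring.
    rewrite normcM circ_norm1// normc_real mulr1 gtr0_norm//; move: sd o1; clear; lra.
  rewrite /P poissonE ?nxo// ler_pdivrMr; last by rewrite exprn_gt0//; move: o2 d_gt0; clear; lra.
  have o3 : (d / 2) ^+ 2 <= normc (1 - x / omega n j) ^+ 2.
    by rewrite ler_pXn2r ?nnegrE ?normc_ge0//; move: o2 d_gt0; clear; lra.
  apply: (@le_trans _ _ (8 * s / d ^+ 2 * (d / 2) ^+ 2)); last first.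
    by rewrite ler_wpM2l// divr_ge0 ?exprn_ge0 ?mulr_ge0// ltW.
  rewrite (_ : 8 * s / d ^+ 2 * (d / 2) ^+ 2 = 2 * s); last by field; rewrite gt_eqF.
  by rewrite /r; have := sqr_ge0 s; rewrite !expr2; clear; lra.
have sM : 2 * M * (8 * s / d ^+ 2) <= e / 8.
  have : s * (128 * M) <= e * d ^+ 2 by rewrite -ler_pdivlMr ?mulr_gt0.
  move=> h; rewrite mulrA ler_pdivrMr ?exprn_gt0//; move: h; clear; lra.
have each j : `|f p - f (opt n j)| * P j <= e / 8 * P j + e / 8.
  have hfar : P j <= 8 * s / d ^+ 2 -> `|f p - f (opt n j)| * P j <= e / 8 * P j + e / 8.
    move=> hP; apply: (@le_trans _ _ (2 * M * (8 * s / d ^+ 2))).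
      apply: ler_pM => //; apply: le_trans (ler_normB _ _) _.
      by have := hM p cp; have := hM _ (opt_circ n j); clear; lra.
    by have := mulr_ge0 (ltW e8) (P0 j); move: sM; clear; lra.
  have [h1|h1] := leP d `|p.1 - (opt n j).1|; first by apply/hfar/far; left.
  have [h2|h2] := leP d `|p.2 - (opt n j).2|; first by apply/hfar/far; right.
  have := hd0 (opt n j) p (opt_circ n j) cp (lt_le_trans h1 dd0) (lt_le_trans h2 dd0).
  rewrite -realCB normc_real => h3.
  by have := ler_wpM2r (P0 j) h3; move: e8; clear; lra.
have -> : f p - n.+1%:R^-1 * \sum_(j < n.+1) f (opt n j) * poisson (r%:C%C * pt p / omega n j) =
    f p * (1 - A) + n.+1%:R^-1 * \sum_(j < n.+1) (f p - f (opt n j)) * P j.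
  have -> : \sum_(j < n.+1) (f p - f (opt n j)) * P j =
      f p * (\sum_(j < n.+1) P j) - \sum_(j < n.+1) f (opt n j) * poisson (r%:C%C * pt p / omega n j).
    by rewrite mulr_sumr -sumrB; apply: eq_bigr => j _; rewrite mulrBl.
  by rewrite /A; move: (n.+1%:R^-1) (\sum_(j < n.+1) P j) (\sum_(j < n.+1) f (opt n j) * _) => u v y; ring.
apply: le_trans (ler_normD _ _) _.
have b1 : `|f p * (1 - A)| <= e / 4.
  rewrite normrM distrC; apply: le_trans q_M; rewrite mulrC.
  by apply: ler_pM => //; exact: hM.
have b2 : `|n.+1%:R^-1 * \sum_(j < n.+1) (f p - f (opt n j)) * P j| <= e / 8 * A + e / 8.
  rewrite normrM ger0_norm ?invr_ge0//.
  apply: (@le_trans _ _ (n.+1%:R^-1 * \sum_(j < n.+1) (e / 8 * P j + e / 8))).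
    rewrite ler_wpM2l ?invr_ge0//; apply: le_trans (ler_norm_sum _ _ _) _.
    by apply: ler_sum => j _; rewrite normrM (ger0_norm (P0 j)).
  rewrite big_split /= -mulr_sumr sumr_const card_ord /A -(mulr_natr (e / 8)).
  have fld (N S : R) : N != 0 -> N^-1 * (e / 8 * S + e / 8 * N) = e / 8 * (N^-1 * S) + e / 8.
    by move=> ?; field.
  by rewrite fld.
have := ler_wpM2l (ltW e8) A3; move: b1 b2 e0; clear; lra.
Qed.

(** The approximation holds uniformly over all measures and involves each of them only through
    finitely many values of [kint]. Continuity in time of these values then gives weak
    continuity. *)
Lemma weak_approx (f : T2 -> R) : contT (fun p => (f p)%:C%C) -> forall e, 0 < e ->
  exists n (c z : nat -> C), (forall j, normc (z j) < 1) /\ forall m : PT R, onT m ->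
    `|Rintegral m circ f - complex.Re (\sum_(j < n.+1) c j * (2 * kint m (z j) - 1))| <= e.
Proof.
move=> cf e e0; have [r [n [/andP[r0 r1] h]]] := poisson_approx cf e0.
pose c j := (n.+1%:R^-1 * f (opt n j))%:C%C; pose z j := r%:C%C / omega n j.
have z1 j : normc (z j) < 1.
  by rewrite normcM normcV normc_omega invr1 mulr1 normc_real gtr0_norm.
exists n, c, z; split=> // m mT.
have mfin := prob_circle_fin m.
pose k j (p : T2) := c j * (2 * (1 - z j * pt p)^-1 - 1).
have ck j : contT (k j).
  apply: contTM; first exact: contT_cst.
  by apply: contTB; [apply: contTM; [exact: contT_cst|exact: contT_kernel]|exact: contT_cst].
have kE j : cint m (k j) = c j * (2 * kint m (z j) - 1).
  rewrite cintZ//; last first.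
    by apply: contTB; [apply: contTM; [exact: contT_cst|exact: contT_kernel]|exact: contT_cst].
  congr (_ * _); rewrite (cintB mfin); [|by apply: contTM; [exact: contT_cst|exact: contT_kernel]|exact: contT_cst].
  by rewrite cint1// (cintZ mfin)//; exact: contT_kernel.
pose G p := \sum_(j < n.+1) k j p.
have cG : contT G by apply: contT_sum => j; exact: ck.
have <- : cint m G = \sum_(j < n.+1) c j * (2 * kint m (z j) - 1).
  by rewrite (cint_sum mfin)//; apply: eq_bigr => j _; exact: kE.
have -> : Rintegral m circ f - complex.Re (cint m G) = Rintegral m circ (fun p => complex.Re ((f p)%:C%C - G p)).
  rewrite -Re_cint (cintB mfin)// (cReD (cint m _)) cReN; congr (_ - _).
  by rewrite Re_cint.
have -> : e = e * fine (m circ).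
  by rewrite (congr1 fine (prob_circle mT)) mulr1.
apply: Rint_le => //; first by apply: contT_Re; exact: contTB.
move=> p cp; apply: le_trans (h p cp); rewrite (cReD (f p)%:C%C) cReN /= /G Re_sum mulr_sumr.
rewrite le_eqVlt; apply/orP; left; apply/eqP; congr (`| _ - _ |); apply: eq_bigr => j _.
have H (a : R) (u : C) : complex.Re (a%:C%C * (2 * u - 1)) = a * (2 * complex.Re u - 1).
  by rewrite (_ : 2 * u - 1 = u + u - 1); [rewrite !cReIm /=; ring|ring].
rewrite /k /c H [RHS]mulrA; congr (_ * _).
rewrite /poisson /z (_ : r%:C%C * pt p / omega n j = r%:C%C / omega n j * pt p); last by rewrite mulrAC.
by [].
Qed.

Lemma kint_eta (m : PT R) z : onT m -> normc z < 1 -> kint m z = (1 - Defs.eta m z)^-1.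
Proof.
move=> mT z1; have k0 := kint_neq0 mT z1; rewrite eta_kint//.
have -> : 1 - (kint m z - 1) / kint m z = (kint m z)^-1 by field.
by rewrite invrK.
Qed.

Lemma weak_cont (m : R -> PT R) : (forall t, 0 <= t -> onT (m t)) ->
  (forall z t, normc z < 1 -> 0 <= t -> ccvg (tnear t) (fun s => Defs.eta (m s) z) (Defs.eta (m t) z)) ->
  weakly_continuous m.
Proof.
move=> mT ce f /within_circleP cf; apply/within_timeP => t t0 e e0.
have e3 : 0 < e / 3 by rewrite divr_gt0.
have [n [c [z [z1 h]]]] := weak_approx cf e3.
have ck j : ccvg (tnear t) (fun s => kint (m s) (z j)) (kint (m t) (z j)).
  apply: (@ccvg_near _ _ _ _ (fun s => (1 - Defs.eta (m s) (z j))^-1)).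
    by apply: filterS (tnear_ge0 t) => s s0; rewrite kint_eta//; exact: mT.
  rewrite kint_eta//; last exact: mT.
  apply: ccvgV; last by apply: ccvgB; [exact: ccvg_cst|exact: ce].
  apply: subc_neq0; rewrite normc1E; apply: le_lt_trans (z1 j).
  by apply: normc_eta => //; exact: mT.
have cS : ccvg (tnear t) (fun s => \sum_(j < n.+1) c j * (2 * kint (m s) (z j) - 1))
    (\sum_(j < n.+1) c j * (2 * kint (m t) (z j) - 1)).
  apply: ccvg_sum => j; apply: ccvgM; first exact: ccvg_cst.
  by apply: ccvgB; [apply: ccvgM => //; exact: ccvg_cst|exact: ccvg_cst].
apply: filterS2 (tnear_ge0 t) (cS _ e3) => s s0 hs.
have := h _ (mT t t0); have := h _ (mT s s0).
have := le_trans (Re_le_normc _) hs; rewrite cReD cReN.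
rewrite -realCB normc_real; move: (Rintegral _ _ _) (Rintegral _ _ _) => a b.
move: (complex.Re _) (complex.Re _) => u v; rewrite !ler_norml; lra.
Qed.

End WeakContinuity.

(** * From generators to semigroups *)

Section Delta.
Variable R : realType.
Local Notation C := R[i].
Local Notation T2 := (R * R)%type.
Local Notation circ := (@circleT R).
Local Notation e1 := ((1 : R), (0 : R)).

Lemma circ_e1 : circ e1. Proof. by rewrite /circleT /= expr1n expr0n /= addr0. Qed.

Lemma pt_e1 : pt e1 = 1 :> C. Proof. by []. Qed.

Definition is_delta (m : PT R) := forall A, measurable A -> m A = @dirac _ T2 e1 R A.

Lemma delta_onT m : is_delta m -> onT m.
Proof.
move=> hm; rewrite /onT hm; last by apply: measurableC; exact: measurable_circle.
by rewrite diracE memNset//= => h; apply: h; exact: circ_e1.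
Qed.

Lemma delta_Rint m (f : T2 -> R) : is_delta m -> contT (fun p => (f p)%:C%C) ->
  Rintegral m circ f = f e1.
Proof.
move=> hm cf; have mc := @measurable_circle R; rewrite /Rintegral.
rewrite (@eq_measure_integral _ _ _ _ (@dirac _ T2 e1 R)); last by move=> A mA _; exact: hm.
rewrite integral_dirac//; last by apply/measurable_EFinP; exact: contT_measurable.
by rewrite diracE mem_set ?mul1e//; exact: circ_e1.
Qed.

Lemma delta_cint m (f : T2 -> C) : is_delta m -> contT f -> cint m f = f e1.
Proof.
move=> hm cf; apply: complex_ext; rewrite ?Re_cint ?Im_cint.
  by rewrite (delta_Rint hm)//; exact: contT_Re.
by rewrite (delta_Rint hm)//; exact: contT_Im.
Qed.

Lemma delta_hh m z : is_delta m -> normc z < 1 -> hh m z = 1.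
Proof.
move=> hm z1; rewrite /hh /chi /kint !(delta_cint hm); first last.
- by apply: contTM; [exact: contT_pt|exact: contT_kernel].
- exact: contT_kernel.
by rewrite !pt_e1 mulr1 mul1r divff// invr_eq0; apply: subc_neq0; rewrite normc1E.
Qed.

Lemma delta_eta m z : is_delta m -> normc z < 1 -> Defs.eta m z = z.
Proof. by move=> hm z1; rewrite eta_hh ?delta_hh ?mulr1//; exact: delta_onT. Qed.

Lemma delta_exists : exists m : PT R, is_delta m.
Proof. by exists (@dirac _ T2 e1 R : probability T2 R). Qed.

End Delta.

(** * The semigroup generated by a pair of functions *)

Section Converse.
Variable R : realType.
Local Notation C := R[i].
Local Notation T2 := (R * R)%type.
Local Notation circ := (@circleT R).

(** The kernel is Lipschitz in [w] on [|w| <= r], uniformly over the circle, and this integrates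
    against the representing measure. The [+ 1] in the constant keeps it positive when the mass is
    zero. *)
Lemma HQ_lip (B : C -> C) : HQ B -> forall r : R, r < 1 -> exists2 L, 0 < L &
  forall w w', normc w <= r -> normc w' <= r -> normc (B w - B w') <= L * normc (w - w').
Proof.
move=> /HQ_herglotz[gamma [tau [tauT hB]]] r r1.
have mfin : (tau circ < +oo)%E.
  have : tau circ \is a fin_num by rewrite fin_num_measure//; exact: measurable_circle.
  by case: (tau circ) => // x _; rewrite ltry.
pose m := fine (tau circ).
have m0 : 0 <= m by rewrite /m fine_ge0.
have r0 : 0 < 1 - r by lra.
exists (4 / (1 - r) ^+ 2 * m + 1).
  by rewrite ltr_wpDl// mulr_ge0// divr_ge0// exprn_ge0// ltW.
move=> w w' wr wr'.
have w1 := le_lt_trans wr r1; have w1' := le_lt_trans wr' r1.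
rewrite !hB ?unitDE// [X in normc X](_ : _ = cint tau (fun p => (w + pt p) / (w - pt p)) -
  cint tau (fun p => (w' + pt p) / (w' - pt p))); last by ring.
rewrite -(cintB mfin); [|exact: contT_hker|exact: contT_hker].
have := @cint_norm _ tau mfin (fun p => (w + pt p) / (w - pt p) - (w' + pt p) / (w' - pt p))
  (2 * normc (w - w') / (1 - r) ^+ 2).
move=> /(_ _ _) h; apply: le_trans (h _ _) _.
- by apply: contTB; exact: contT_hker.
- move=> p cp; have n1 := pt_neq w1 cp; have n2 := pt_neq w1' cp.
  have -> : (w + pt p) / (w - pt p) - (w' + pt p) / (w' - pt p) =
      2 * pt p * (w' - w) / ((w - pt p) * (w' - pt p)).
    by field; rewrite n1 n2.
  have far v : normc v <= r -> 1 - r <= normc (v - pt p).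
    by move=> vr; have := normcB v (v - pt p); rewrite opprB addrC subrK circ_norm1//; lra.
  have n2E : normc (2 : C) = 2.
    by have := normc_real (2 : R); rewrite rmorph_nat ger0_norm.
  rewrite normcM normcV !normcM n2E circ_norm1// mulr1 (distcC w' w).
  rewrite ler_wpM2l ?mulr_ge0 ?normc_ge0// lef_pV2 ?posrE ?mulr_gt0 ?normc_gt0 ?exprn_gt0//.
  by rewrite expr2; apply: ler_pM; rewrite ?(ltW r0)// far.
- rewrite -/m [leRHS]mulrDl mul1r.
  have -> : 2 * (2 * normc (w - w') / (1 - r) ^+ 2 * m) = 4 / (1 - r) ^+ 2 * m * normc (w - w').
    by ring.
  by rewrite lerDl normc_ge0.
Qed.

(** For fixed [n] the exponent is replaced by a finite sum of functions analytic in [z], so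
    [diff_SC] applies; [SC_lim] transfers the result to the time integral. It serves both for the
    Picard iterates and for the left component. *)
Lemma expint_SC (A : C -> C) (P : C -> R -> C) t :
  (forall w, normc w < 1 -> cdiff A w) -> (forall w, normc w < 1 -> complex.Re (A w) <= 0) ->
  (forall s, 0 <= s -> SC (fun z => P z s)) ->
  (forall z, normc z < 1 -> rcont (fun s => A (P z s))) -> 0 <= t ->
  SC (fun z => z * cexp (cI (fun s => A (P z s)) t)).
Proof.
move=> dA A0 hP cP t0.
pose S n z : C := \sum_(i < n.+1) (t / n.+1%:R)%:C%C * A (P z (i%:R * (t / n.+1%:R))).
have tn0 n : 0 <= t / n.+1%:R by rewrite divr_ge0.
have P1 s z : 0 <= s -> normc z < 1 -> normc (P z s) < 1.
  by move=> s0 z1; have [_ h] := SC_diff (hP s s0); exact: (le_lt_trans (h z z1) z1).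
apply: (@SC_lim _ (fun n z => z * cexp (S n z))) => [n|z z1].
  apply: diff_SC => z z1.
    have ex (i : 'I_n.+1) : exists l,
        cder (fun z => (t / n.+1%:R)%:C%C * A (P z (i%:R * (t / n.+1%:R)))) z l.
      have s0 : 0 <= i%:R * (t / n.+1%:R) by rewrite mulr_ge0.
      have [h _] := SC_diff (hP _ s0); have [a ha] := h z z1.
      have [b hb] := dA _ (P1 _ _ s0 z1).
      by eexists; apply: cderZ; apply: (cder_comp (g := A)); [exact: ha|exact: hb].
    have [l hl] := choice ex.
    have dS : cder (S n) z (\sum_(i < n.+1) l i) by apply: cder_sum => i; exact: hl.
    have dE := cder_comp dS (cder_cexp (S n z)).
    by exists (1 * cexp (S n z) + z * (cexp (S n z) * \sum_(i < n.+1) l i)); apply: cderM;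
      [exact: cder_id|exact: dE].
  rewrite normcM -[leRHS]mulr1 ler_wpM2l ?normc_ge0//; apply: normc_cexp_le1.
  rewrite /S Re_sum; apply: sumr_le0 => i _; rewrite cReM mul0r subr0 mulr_ge0_le0//; first exact: tn0.
  by apply: A0; apply: P1 => //; rewrite mulr_ge0.
apply: ccvgM; first exact: ccvg_cst.
apply: ccvg_circ (cder_cvg (cder_cexp _)); apply: cI_riemann => //; exact: cP.
Qed.

Lemma tnear_ccvg (t : R) (f : R -> C) l : ccvg (nbhs t) f l -> ccvg (tnear t) f l.
Proof. by move=> h e /h; rewrite /tnear /within /=; apply: filterS. Qed.

(** [F] is an extension to negative times with a two-sided derivative; the measures only give [G] at
    nonnegative times. *)
Lemma rder_has_deriv_t (F G : R -> C) t l : 0 <= t -> (forall s, 0 <= s -> G s = F s) ->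
  rder F t l -> has_deriv_t G t l.
Proof.
move=> t0 GF dF; rewrite /has_deriv_t; apply/cvgrPdist_le => e e0.
have [eR0 eE] : 0 < complex.Re e /\ e = ((complex.Re e)%:C)%C.
  move: e0; rewrite /= ltcE /= => /andP[/eqP d1 d2]; split => //.
  by apply: complex_ext.
have /nbhsRP[d d0 hd] := dF _ eR0.
rewrite /within /= /dnbhs /within /=; apply/nbhsRP; exists d => // h.
rewrite subr0 => hh h0 th0.
have := hd (t + h); rewrite addrAC subrr add0r => /(_ hh); rewrite !GF//.
have h0c : (h%:C)%C != 0 by rewrite realC_eq0.
rewrite -realCB (addrAC t) subrr add0r => H.
rewrite eE -[`|_|]/((normc _)%:C)%C lecR distcC.
rewrite -(ler_pM2r (x := normc (h%:C)%C)) ?normc_gt0//.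
by rewrite -normcM mulrBl divfK.
Qed.

Variables B1 B2 : C -> C.
Hypothesis (d1 : forall w, normc w < 1 -> cdiff B1 w) (d2 : forall w, normc w < 1 -> cdiff B2 w).
Hypothesis (n1 : forall w, normc w < 1 -> complex.Re (B1 w) <= 0)
  (n2 : forall w, normc w < 1 -> complex.Re (B2 w) <= 0).

Let lip2 := HQ_lip (nonpos_HQ d2 n2).

Lemma W_SC n t : 0 <= t -> SC (fun z => W B2 n z t).
Proof.
elim: n t => [|n IH] t t0 /=.
  by apply: diff_SC => // z z1; exists 1; exact: cder_id.
apply: expint_SC => // z z1; have [h1 h2] := W_props d2 n2 n z1.
exact: (rcont_B d2 z1 h1 h2).
Qed.

(** Convergence of the iterates is kept among the data because it is what makes [Phi] an
    eta-transform at each time. *)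
Definition is_flow (Phi : C -> R -> C) := forall z, normc z < 1 ->
  [/\ forall t, normc (Phi z t) <= normc z, rcont (Phi z), forall t, Phi z t = picard B2 z (Phi z) t &
      forall t, 0 <= t -> ccvg \oo (fun n => W B2 n z t) (Phi z t)].

Lemma is_flow_exists : exists Phi, is_flow Phi.
Proof.
have [z|Phi h] := @choice _ _ (fun z phi => normc z < 1 -> [/\ forall t, normc (phi t) <= normc z,
   rcont phi, forall t, phi t = picard B2 z phi t &
   forall t, 0 <= t -> ccvg \oo (fun n => W B2 n z t) (phi t)]); last by exists Phi.
have [z1|z1] := ltP (normc z) 1; last by exists (fun=> 0).
by have [phi hphi] := flow_exists d2 n2 lip2 z1; exists phi.
Qed.

Section WithFlow.
Variable Phi : C -> R -> C.
Hypothesis hPhi : is_flow Phi.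

Lemma flow_rcont (B : C -> C) z : (forall w, normc w < 1 -> cdiff B w) -> normc z < 1 ->
  rcont (fun s => B (Phi z s)).
Proof. by move=> dB z1; have [h1 h2 _ _] := hPhi z1; exact: (rcont_B dB z1 h1 h2). Qed.

Lemma flow_SC t : 0 <= t -> SC (fun z => Phi z t).
Proof.
move=> t0; apply: (@SC_lim _ (fun n z => W B2 n z t)) => [n|z z1]; first exact: W_SC.
by have [_ _ _] := hPhi z1; exact.
Qed.

(** The path shifted by [t], frozen for negative times, solves the Picard equation started at
    [Phi z t]; uniqueness identifies it with the flow from there. *)
Lemma flow_add z s t : normc z < 1 -> 0 <= s -> 0 <= t -> Phi z (s + t) = Phi (Phi z t) s.
Proof.
move=> z1 s0 t0; have [h1 h2 h3 _] := hPhi z1.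
pose z' := Phi z t; have z1' : normc z' < 1 := le_lt_trans (h1 t) z1.
have [k1 k2 k3 _] := hPhi z1'.
pose p r := Phi z (t + Num.max r 0).
have cp : rcont p by exact: (rcont_max (rcont_shift t h2)).
have cg := flow_rcont d2 z1.
have pr r : normc (p r) <= normc z by exact: h1.
have cBp := rcont_B d2 z1 pr cp.
have fp r : p r = picard B2 z' p r.
  rewrite picard_max {1}/p h3 /picard cI_add//; last by rewrite le_max lexx orbT.
  rewrite cexpD mulrA -[X in X * _]/(picard B2 z (Phi z) t) -h3; congr (_ * cexp _).
  apply: cI_ext => //; first exact: (rcont_shift t cg).
  by move=> x x0; rewrite /p max_l.
rewrite addrC -[X in t + X](max_l s0) -/(p s).
apply: (@flow_unique _ B2 d2 n2 lip2 z' p (Phi z') z1') => //.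
by move=> r; rewrite fp; exact: (@picard_norm _ B2 d2 n2 z' p _ z1 pr cp r).
Qed.

Definition mufun t z := z * cexp (cI (fun s => B1 (Phi z s)) t).

Lemma mufun_SC t : 0 <= t -> SC (mufun t).
Proof.
by move=> t0; apply: expint_SC => //; [exact: flow_SC|move=> z z1; exact: flow_rcont].
Qed.

(** At time 0 the Dirac mass is selected by hand, because the initial condition is an equality of
    measures and not merely of transforms. *)
Lemma measure_path (f : R -> C -> C) : (forall t, 0 <= t -> SC (f t)) -> (forall z, f 0 z = z) ->
  exists m : R -> PT R, [/\ forall t, 0 <= t -> onT (m t),
    forall t z, 0 <= t -> normc z < 1 -> Defs.eta (m t) z = f t z & is_delta (m 0)].
Proof.
move=> fS f0.
have [t|m hm] := @choice _ _ (fun t (m : PT R) => 0 <= t -> [/\ onT m,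
   forall z, normc z < 1 -> Defs.eta m z = f t z & t = 0 -> is_delta m]).
  have [m0 hm0] := delta_exists R.
  have [->|tn0] := eqVneq t 0.
    exists m0 => _; split=> //; first exact: delta_onT.
    by move=> z z1; rewrite f0 delta_eta.
  have [t0|t0] := leP 0 t; last by exists m0.
  have [m mT hm] := fS t t0; exists m => _; split=> // h; by rewrite h eqxx in tn0.
exists m; split.
- by move=> t /hm[].
- by move=> t z /hm[_ h _]; exact: h.
- by have [_ _ h] := hm 0 (lexx 0); exact: h.
Qed.

End WithFlow.

Lemma converse : exists mu nu : R -> PT R,
  [/\ cmc_semigroup mu nu, starts_at_delta1 mu nu & cmc_ode mu nu B1 B2].
Proof.
have [Phi hPhi] := is_flow_exists.
have Phi0 z : normc z < 1 -> Phi z 0 = z.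
  by move=> z1; have [_ _ h _] := hPhi z z1; rewrite h /picard cI0 cexp0 mulr1.
(* Outside the disc the flow is arbitrary; replacing it by [z] there gives the initial condition at
   every [z], as [measure_path] asks. *)
pose Phi' t z := if normc z < 1 then Phi z t else z.
have [nu [nuT nuE nu0]] : exists m : R -> PT R, [/\ forall t, 0 <= t -> onT (m t),
    forall t z, 0 <= t -> normc z < 1 -> Defs.eta (m t) z = Phi' t z & is_delta (m 0)].
  apply: measure_path => [t t0|z]; last by rewrite /Phi'; case: ifP => // /Phi0.
  have [m mT hm] := flow_SC hPhi t0; exists m => // z z1.
  by rewrite hm// /Phi' z1.
have {}nuE t z : 0 <= t -> normc z < 1 -> Defs.eta (nu t) z = Phi z t.
  by move=> t0 z1; rewrite nuE// /Phi' z1.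
have mf0 z : mufun Phi 0 z = z by rewrite /mufun cI0 cexp0 mulr1.
have [mu [muT muE mu0]] := measure_path (mufun_SC hPhi) mf0.
exists mu, nu; split.
- split=> [t t0|s t s0 t0||]; first by split; [exact: muT|exact: nuT].
  + move=> z /unitDE z1; have [h1 h2 h3 _] := hPhi z z1.
    have st : 0 <= s + t by rewrite addr_ge0.
    have z1' : normc (Phi z t) < 1 := le_lt_trans (h1 t) z1.
    rewrite !nuE//; split; first exact: flow_add.
    rewrite hfunE//; last exact: muT.
    (* At the origin both sides vanish. Elsewhere [Phi z t] is [z] times an exponential, hence
       nonzero, and can be cancelled to extract [hh] from the eta-transform. *)
    have [z0|z0] := eqVneq z 0.
      by rewrite z0 !muE ?normc0E// /mufun !mul0r.
    have p0 : Phi z t != 0 by rewrite h3 /picard mulf_neq0// cexp_neq0.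
    have E := muE s (Phi z t) s0 z1'; rewrite eta_hh// in E; last exact: muT.
    have {E} -> : hh (mu s) (Phi z t) = cexp (cI (fun r => B1 (Phi (Phi z t) r)) s).
      by apply: (mulfI p0); rewrite E.
    rewrite !muE// /mufun (addrC s t) (cI_add (flow_rcont hPhi d1 z1))//.
    rewrite cexpD mulrA; congr (_ * cexp _).
    apply: cI_ext; [exact: (rcont_shift t (flow_rcont hPhi d1 z1))|
      exact: (flow_rcont hPhi d1 z1')|move=> x x0].
    by rewrite addrC flow_add.
  + apply: weak_cont => // z t z1 t0.
    apply: (@ccvg_near _ _ _ _ (fun s => mufun Phi s z)).
      by apply: filterS (tnear_ge0 t) => s s0; rewrite muE.
    rewrite muE//; apply: tnear_ccvg; apply: ccvgM; first exact: ccvg_cst.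
    apply: ccvg_circ (cder_cvg (cder_cexp _)); exact: (rcont_cI (flow_rcont hPhi d1 z1)).
  + apply: weak_cont => // z t z1 t0.
    apply: (@ccvg_near _ _ _ _ (fun s => Phi z s)).
      by apply: filterS (tnear_ge0 t) => s s0; rewrite nuE.
    by rewrite nuE//; apply: tnear_ccvg; have [_ h _ _] := hPhi z z1; exact: h.
- by move=> A mA; split; [exact: mu0|exact: nu0].
- move=> t z t0 /unitDE z1; have [h1 h2 h3 _] := hPhi z z1.
  rewrite muE// !nuE//; split.
    rewrite /mufun cIE//.
    apply: rder_has_deriv_t (rder_exp_cI z t (flow_rcont hPhi d1 z1)) => // s s0.
    by rewrite muE// /mufun cIE.
  rewrite {1}h3 /picard cIE//.
  apply: rder_has_deriv_t (rder_exp_cI z t (flow_rcont hPhi d2 z1)) => // s s0.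
  by rewrite nuE// h3 /picard cIE.
Qed.

End Converse.

(** * From semigroups to generators *)

Section Generator.
Variable R : realType.
Local Notation C := R[i].
Local Notation T2 := (R * R)%type.
Local Notation circ := (@circleT R).

(** On the circle [(v + zeta) / (v - zeta) = 1 - 2 / (1 - v * conj zeta)], so [B] is a constant
    minus twice a Cauchy transform, covered by [cder_cauchy]. *)
Lemma HQ_diff (B : C -> C) : HQ B -> forall w, normc w < 1 -> cdiff B w.
Proof.
move=> /HQ_herglotz[gamma [tau [tauT hB]]] w w1.
have mfin : (tau circ < +oo)%E.
  have : tau circ \is a fin_num by rewrite fin_num_measure//; exact: measurable_circle.
  by case: (tau circ) => // x _; rewrite ltry.
have ca : contT (fun p : T2 => ((pt p)^*)%C) by apply: contT_conj; exact: contT_pt.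
have na (p : T2) : circ p -> normc ((pt p)^*)%C = 1 by move=> cp; rewrite normc_conj circ_norm1.
have c1 : contT (fun _ : T2 => 1 : C) by exact: contT_cst.
pose u v := cint tau (fun p => 1 * (1 - v * ((pt p)^*)%C)^-1).
pose k := 'i%C * gamma%:C%C + (fine (tau circ))%:C%C.
have E v : normc v < 1 -> k - 2 * u v = B v.
  move=> v1; rewrite hB ?unitDE// /k /u -addrA; congr (_ + _).
  have cu : contT (fun p => 1 * (1 - v * ((pt p)^*)%C)^-1).
    apply: contTM => //; apply: contTV => [p cp|].
      by apply: subc_neq0; rewrite normcM na// mulr1 normc1E.
    by apply: contTB => //; apply: contTM => //; exact: contT_cst.
  rewrite -[X in X - _]mulr1 -cint_cst -(cintZ mfin)// -(cintB mfin)//; last first.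
    by apply: contTM => //; exact: contT_cst.
  apply: eq_cint => p cp; have p0 := pt_neq v1 cp.
  have pp : pt p * ((pt p)^*)%C = 1 by rewrite -normc_sqr_conj circ_norm1// expr1n.
  have q0 : pt p != 0 by rewrite -normc_eq0 circ_norm1// oner_eq0.
  have -> : ((pt p)^*)%C = (pt p)^-1 by apply: (mulfI q0); rewrite pp divff.
  by field; rewrite p0 q0 -opprB oppr_eq0 p0.
have [l hl] : cdiff (fun v => k - 2 * u v) w.
  eexists; apply: cderB; first exact: cder_cst.
  by apply: cderZ; apply: cder_cauchy.
exists l; apply: gder_ext hl; first exact: E.
by apply: filterS (cnbhs_ltnormc w1) => v; exact: E.
Qed.

(** The real part of the kernel is [(|w|^2 - 1) / |w - zeta|^2]. *)
Lemma HQ_nonpos (B : C -> C) : HQ B -> forall w, normc w < 1 -> complex.Re (B w) <= 0.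
Proof.
move=> /HQ_herglotz[gamma [tau [tauT hB]]] w w1.
have E (x : C) : complex.Re ('i%C * gamma%:C%C + x) = complex.Re x by rewrite !cReIm /=; ring.
rewrite hB ?unitDE// E -oppr_ge0 -cReN.
have mfin : (tau circ < +oo)%E.
  have : tau circ \is a fin_num by rewrite fin_num_measure//; exact: measurable_circle.
  by case: (tau circ) => // x _; rewrite ltry.
rewrite -mulN1r -(cintZ mfin); last exact: contT_hker.
apply: Re_cint_ge0 => p cp; have p0 := pt_neq w1 cp.
have n0 : 0 < normc (w - pt p) ^+ 2 by rewrite exprn_gt0// normc_gt0.
have pc := circ_norm1 cp.
have hV (u v : C) : v != 0 -> complex.Re (u / v) * normc v ^+ 2 =
    complex.Re u * complex.Re v + complex.Im u * complex.Im v.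
  move=> v0; have := normc_eq0 v; rewrite (negbTE v0) => /negbT.
  rewrite -sqrf_eq0 !sqr_normcE; case: u v {v0} => [a b] [c d] /= h; by field.
rewrite mulN1r cReN oppr_ge0 -(pmulr_lle0 _ n0) hV//.
have := congr1 (fun x => x ^+ 2) pc; rewrite sqr_normcE expr1n.
have : normc w ^+ 2 <= 1 by rewrite exprn_ile1 ?normc_ge0// ltW.
rewrite sqr_normcE !cReD !cImD !cReN !cImN.
move: (complex.Re w) (complex.Im w) (complex.Re (pt p)) (complex.Im (pt p)) => a b c d.
by rewrite !expr2; lra.
Qed.

Lemma cI_cst (c : C) t : 0 <= t -> cI (fun=> c) t = t%:C%C * c.
Proof.
move=> t0; have cc : rcont (fun=> c) by move=> x; exact: ccvg_cst.
have h := cI_riemann cc t0.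
apply: (@ccvg_unique _ _ \oo _ _ _ _ h).
apply: (@ccvg_ext _ _ _ _ (fun=> t%:C%C * c)); last exact: ccvg_cst.
move=> n; rewrite sumr_const card_ord -mulrnAl -rmorphMn /= -mulr_natr divfK// pnatr_eq0//.
Qed.

Variables phi h : R -> C -> C.
Hypothesis phi_le : forall t z, 0 <= t -> normc z < 1 -> normc (phi t z) <= normc z.
Hypothesis phi_cont : forall t z, 0 <= t -> normc z < 1 ->
  ccvg (tnear t) (fun s => phi s z) (phi t z).
Hypothesis h_diff : forall t z, 0 <= t -> normc z < 1 -> cdiff (h t) z.
Hypothesis h_le : forall t z, 0 <= t -> normc z < 1 -> normc (h t z) <= 1.
Hypothesis h0 : forall z, normc z < 1 -> h 0 z = 1.
Hypothesis h_cont : forall t z, 0 <= t -> normc z < 1 ->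
  ccvg (tnear t) (fun s => h s z) (h t z).
Hypothesis h_add : forall s t z, 0 <= s -> 0 <= t -> normc z < 1 ->
  h (s + t) z = h t z * h s (phi t z).

Let z01 : normc (0 : C) < 1. Proof. by rewrite normc0E. Qed.

Lemma phi0 t : 0 <= t -> phi t 0 = 0.
Proof.
by move=> t0; apply/eqP; rewrite -normc_eq0 eq_le normc_ge0 andbT; have := phi_le t0 z01; rewrite normc0E.
Qed.

(* [c s := h s 0] is multiplicative in [s]; the geometric sum of its powers, all of real part
   at least [1/2], turns [c t0 - 1] bounded into [c s - 1 = O(s)]. *)
Lemma h_origin : exists2 t0, 0 < t0 & forall n : nat,
  normc (h (t0 / n.+1%:R) 0 - 1) <= n.+1%:R^-1.
Proof.
have e2 : 0 < 1 / 2 :> R by lra.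
have := h_cont (lexx 0) z01 e2; rewrite h0// /tnear /within /= => /nbhsRP[d d_gt0 hd].
have d2 : 0 < d / 2 by rewrite divr_gt0.
exists (d / 2) => // n; set t0 := d / 2; pose s := t0 / n.+1%:R.
have s0 : 0 <= s by rewrite divr_ge0// ltW.
have n0 : 0 < n.+1%:R :> R by rewrite ltr0n.
have cX k : h (k%:R * s) 0 = h s 0 ^+ k.
  elim: k => [|k IH]; first by rewrite mul0r h0.
  have -> : k.+1%:R * s = s + k%:R * s by rewrite -natr1 mulrDl mul1r addrC.
  have ks0 : 0 <= k%:R * s by rewrite mulr_ge0.
  rewrite exprSr; apply: etrans (h_add s0 ks0 z01) _; congr (_ * _); first exact: IH.
  by congr (h s _); exact: phi0.
have near1 k : (k <= n.+1)%N -> normc (h s 0 ^+ k - 1) <= 1 / 2.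
  move=> kn; have ks0 : 0 <= k%:R * s by rewrite mulr_ge0.
  have kst : k%:R * s <= t0.
    by rewrite /s mulrCA -[leRHS]mulr1 ler_pM2l// ler_pdivrMr// mul1r ler_nat.
  rewrite -cX; apply: hd => //; rewrite subr0 (ger0_norm ks0).
  by apply: (le_lt_trans kst); rewrite /t0; lra.
have := near1 _ (leqnn _); rewrite subrX1 normcM => hn.
have S : n.+1%:R / 2 <= normc (\sum_(i < n.+1) h s 0 ^+ i).
  apply: le_trans (le_trans (ler_norm _) (Re_le_normc _)); rewrite Re_sum.
  have -> : n.+1%:R / 2 = \sum_(i < n.+1) (1 / 2 : R) by rewrite sumr_const card_ord -mulr_natr; lra.
  apply: ler_sum => i _; have := near1 i (ltnW (ltn_ord i)).
  move=> /(le_trans (Re_le_normc _)); rewrite cReD cReN /= ler_norml; lra.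
have := ler_wpM2l (normc_ge0 (h s 0 - 1)) S => hS.
rewrite -/s -[leRHS]mul1r ler_pdivlMr//; lra.
Qed.

Lemma inv_small (t0 d : R) : 0 < t0 -> 0 < d ->
  exists N : nat, forall n, (N <= n)%N -> t0 / n.+1%:R < d.
Proof.
move=> t00 d0; exists (Num.truncn (t0 / d)) => n hn.
rewrite ltr_pdivrMr ?ltr0n// mulrC -ltr_pdivrMr//.
apply: lt_le_trans (truncnS_gt _) _; by rewrite ler_nat ltnS.
Qed.

Lemma rcont_tnear (f : R -> C) : (forall t, 0 <= t -> ccvg (tnear t) f (f t)) ->
  rcont (fun t => f (Num.max t 0)).
Proof.
move=> cf t e e0; have t0 : 0 <= Num.max t 0 by rewrite le_max lexx orbT.
have := cf _ t0 _ e0; rewrite /tnear /within /= => /nbhsRP[d d0 hd].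
apply/nbhsRP; exists d => // y yt; apply: hd; last by rewrite le_max lexx orbT.
exact: le_lt_trans (maxr0_lip _ _) yt.
Qed.

(** Both sides are [1 + s B(a)] up to small errors: [s e] for [h], [s e] from replacing [g] by [B a]
    in the integral, and [(M s)^2] from the second-order term of the exponential. *)
Lemma cocycle_step (B : C -> C) (a : C) (g : R -> C) (s e M : R) (k : R) :
  0 <= s -> 0 <= e -> rcont g -> (forall r, complex.Re (g r) <= 0) ->
  (forall r, normc (g r) <= M) ->
  (forall r, 0 <= r <= s -> normc (g r - B a) <= e) ->
  normc (h s a - 1 - s%:C%C * B a) <= s * e ->
  normc (h s a - cexp (cI g s)) <= s * (2 * e + M ^+ 2 * s).
Proof.
move=> s0 e0 cg g0 gM gB hB.
have RJ : complex.Re (cI g s) <= 0 by apply: Re_cI.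
have J1 : normc (cI g s) <= M * s by apply: cI_bound.
have J2 : normc (cI g s - s%:C%C * B a) <= e * s.
  rewrite -cI_cst//.
  have := @cI_dist _ g (fun=> B a) (fun r => e * r) (fun=> e) s cg (fun x => @ccvg_cst _ _ _ _ _) s0.
  rewrite mulr0 subr0; apply; first by move=> x _; exact: rder_scale.
  exact: gB.
have J3 := cexp_taylor2 RJ.
have J4 : normc (cI g s) ^+ 2 <= (M * s) ^+ 2.
  by rewrite ler_pXn2r ?nnegrE ?normc_ge0//; apply: le_trans J1; exact: normc_ge0.
rewrite [X in normc X](_ : _ = (h s a - 1 - s%:C%C * B a) - ((cI g s - s%:C%C * B a) + (cexp (cI g s) - 1 - cI g s))); last by ring.
apply: le_trans (normcB _ _) _; have := normcD (cI g s - s%:C%C * B a) (cexp (cI g s) - 1 - cI g s).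
move: J4; rewrite exprMn; move: (normc _) (normc _) (normc _) (normc _) (normc _) J1 J2 J3 hB => *.
nra.
Qed.

(** The orbit stays in the disc of radius [|z|], where some late quotient [Bn] is uniformly close to
    [B]; this feeds [cocycle_step] at every grid point with the same tolerance. *)
Lemma cocycle_exp : exists2 B : C -> C, HQ B & forall t z, 0 <= t -> normc z < 1 ->
  rcont (fun r => B (phi (Num.max r 0) z)) /\
  h t z = cexp (cI (fun r => B (phi (Num.max r 0) z)) t).
Proof.
have [t0 t0_gt0 ho] := h_origin.
pose s n := t0 / n.+1%:R.
have s_gt0 n : 0 < s n by rewrite divr_gt0// ltr0n.
pose Bn n w := ((s n)^-1)%:C%C * (h (s n) w - 1).
have BnQ n : HQ (Bn n).
  apply: nonpos_HQ => w w1.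
    have [l hl] := h_diff (ltW (s_gt0 n)) w1.
    by eexists; apply: cderZ; apply: cderB; [exact: hl|exact: cder_cst].
  rewrite /Bn cReM mul0r subr0 cReD cReN mulr_ge0_le0 ?invr_ge0 ?(ltW (s_gt0 n))//.
  have := le_trans (Re_le_normc _) (h_le (ltW (s_gt0 n)) w1).
  by rewrite ler_norml /=; lra.
have Bn0 n : normc (Bn n 0) <= t0^-1.
  rewrite /Bn normcM normc_real gtr0_norm ?invr_gt0// invf_div.
  apply: (@le_trans _ _ (n.+1%:R / t0 * n.+1%:R^-1)).
    by rewrite ler_wpM2l ?divr_ge0 ?(ltW t0_gt0)// ho.
  by rewrite mulrAC divff ?mul1r// pnatr_eq0.
have [B BQ hB] := HQ_compact BnQ Bn0.
exists B => // T z T0 z1.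
pose g r := B (phi (Num.max r 0) z).
have m0 (r : R) : 0 <= Num.max r 0 by rewrite le_max lexx orbT.
have pz r : normc (phi (Num.max r 0) z) <= normc z by exact: phi_le.
have cphi : rcont (fun r => phi (Num.max r 0) z).
  by apply: (@rcont_tnear (fun r => phi r z)) => t ht; exact: phi_cont.
have cg : rcont g by exact: (rcont_B (HQ_diff BQ) z1 pz cphi).
have g0 r : complex.Re (g r) <= 0.
  by apply: HQ_nonpos BQ _ _; exact: le_lt_trans (pz r) z1.
split=> //; rewrite -/g.
have [L L0 lip] := HQ_lip BQ z1.
pose M := normc (B 0) + L.
have M0 : 0 <= M by rewrite addr_ge0 ?normc_ge0 ?ltW.
have gM r : normc (g r) <= M.
  have h1 := lip _ 0 (pz r); rewrite normc0E subr0 in h1.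
  have {}h1 := h1 (normc_ge0 _).
  have := normcD (g r - B 0) (B 0); rewrite subrK /M /g.
  have : L * normc (phi (Num.max r 0) z) <= L.
    by rewrite -[leRHS]mulr1 ler_pM2l//; apply: le_trans (pz r) (ltW z1).
  lra.
apply: eq_of_small => e0 e0_gt0.
(* The part [3 * T] pays for the steps up to the last grid point before [T], and the 2 for moving
   from there to [T], once in [h] and once in the exponential. *)
pose e := e0 / (3 * T + 2).
have den : 0 < 3 * T + 2 by lra.
have e_gt0 : 0 < e by rewrite divr_gt0.
have eE : 3 * T * e + 2 * e = e0 by rewrite -mulrDl /e mulrC divfK// gt_eqF.
have [d1 d1_gt0 hd1] := unif_continuous_segment (fun x (_ : 0 <= x <= T) => cg x) e_gt0.
have [d2 d2_gt0 hd2] : exists2 d, 0 < d & forall y, 0 <= y -> `|y - T| < d -> normc (h y z - h T z) <= e.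
  have := h_cont T0 z1 e_gt0; rewrite /tnear /within /= => /nbhsRP[d d0 hd].
  by exists d => // y y0 yT; exact: hd.
have cE : ccvg (nbhs T) (fun y => cexp (cI g y)) (cexp (cI g T)).
  by apply: ccvg_circ (cder_cvg (cder_cexp _)); exact: rcont_cI.
have /nbhsRP[d3 d3_gt0 hd3] := cE _ e_gt0.
pose d := Num.min (Num.min d1 d2) (Num.min d3 (e / (M ^+ 2 + 1))).
have M2 : 0 < M ^+ 2 + 1 by rewrite ltr_wpDl// sqr_ge0.
have d_gt0 : 0 < d by rewrite !lt_min d1_gt0 d2_gt0 d3_gt0 divr_gt0.
have [N hN] := inv_small t0_gt0 d_gt0.
have [n Nn hn] := hB (normc z) e N z1 e_gt0.
have := hN n Nn; rewrite -/(s n) !lt_min => /andP[/andP[sd1 sd2] /andP[sd3]].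
rewrite ltr_pdivlMr// => sd4.
pose sn := s n; have sn0 : 0 < sn by exact: s_gt0.
have Ms : M ^+ 2 * sn <= e by move: sd4; rewrite -/sn; nra.
(* Since both sides are products of factors of modulus at most 1, the one-step errors [sn * (3 * e)]
   simply add up. *)
have tele K : K%:R * sn <= T ->
    normc (h (K%:R * sn) z - cexp (cI g (K%:R * sn))) <= K%:R * sn * (3 * e).
  elim: K => [|K IH] KT.
    by rewrite !mul0r h0// cI0 cexp0 subrr normc0E.
  have Ks0 : 0 <= K%:R * sn by rewrite mulr_ge0// ltW.
  have KE : K.+1%:R * sn = sn + K%:R * sn by rewrite -natr1 mulrDl mul1r addrC.
  rewrite KE in KT.
  have {}IH := IH (ltac:(lra) : K%:R * sn <= T).
  rewrite KE h_add ?(ltW sn0)// (addrC sn) cI_add ?(ltW sn0)// cexpD.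
  set a := phi (K%:R * sn) z; set gk := fun r => g (K%:R * sn + r).
  have az : normc a <= normc z by exact: phi_le.
  have step : normc (h sn a - cexp (cI gk sn)) <= sn * (2 * e + M ^+ 2 * sn).
    apply: (@cocycle_step B) => //; try exact: ltW.
    - exact: rcont_shift.
    - by move=> r; exact: g0.
    - by move=> r; exact: gM.
    - move=> r /andP[r0 rs]; rewrite /gk /a.
      have -> : B (phi (K%:R * sn) z) = g (K%:R * sn) by rewrite /g max_l.
      apply: hd1; rewrite ?Ks0 ?addr_ge0//=; [lra|lra|].
      by rewrite addrAC subrr add0r ger0_norm//; exact: le_lt_trans rs sd1.
    - have := hn a az; rewrite /Bn -/sn => H.
      have -> : h sn a - 1 - sn%:C%C * B a = sn%:C%C * ((sn^-1)%:C%C * (h sn a - 1) - B a).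
        by rewrite mulrBr mulrA -realCM divff ?gt_eqF// mul1r.
      by rewrite normcM normc_real gtr0_norm// ler_pM2l.
  have R1 : normc (cexp (cI g (K%:R * sn))) <= 1.
    by apply: normc_cexp_le1; apply: Re_cI.
  have hs1 : normc (h sn a) <= 1 by apply: h_le; [exact: ltW|exact: le_lt_trans az z1].
  rewrite [X in normc X](_ : _ = (h (K%:R * sn) z - cexp (cI g (K%:R * sn))) * h sn a
    + cexp (cI g (K%:R * sn)) * (h sn a - cexp (cI gk sn))); last by ring.
  apply: le_trans (normcD _ _) _; rewrite !normcM.
  have b1 := ler_wpM2l (normc_ge0 (h (K%:R * sn) z - cexp (cI g (K%:R * sn)))) hs1.
  have b2 := ler_wpM2r (normc_ge0 (h sn a - cexp (cI gk sn))) R1.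
  have b3 : sn * (2 * e + M ^+ 2 * sn) <= sn * (3 * e) by rewrite ler_pM2l//; lra.
  move: b1 b2 step IH; rewrite mulr1 mul1r (mulrDl (K%:R * sn)); lra.
pose K := Num.truncn (T / sn).
have Ts0 : 0 <= T / sn by rewrite divr_ge0// ltW.
have KT : K%:R * sn <= T by rewrite -ler_pdivlMr//; have := truncn_itv Ts0 => /andP[].
have KT1 : T < K%:R * sn + sn.
  have := truncn_itv Ts0 => /andP[_]; rewrite -/K ltr_pdivrMr// -natr1 mulrDl mul1r//.
have Ks0 : 0 <= K%:R * sn by rewrite mulr_ge0// ltW.
have dist : `|K%:R * sn - T| < sn by rewrite ltr_norml; lra.
have e1 := hd2 _ Ks0 (lt_trans dist sd2).
have e2 := hd3 _ (lt_trans dist sd3).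
have e3 := tele K KT.
have e4 : K%:R * sn * (3 * e) <= T * (3 * e) by rewrite ler_wpM2r// mulr_ge0// ltW.
apply: le_trans (distc_tri (h (K%:R * sn) z) _ _) _; rewrite (distcC (h T z)).
apply: le_trans (lerD e1 (distc_tri (cexp (cI g (K%:R * sn))) _ _)) _.
move: e2 e3; lra.
Qed.

End Generator.

(** * The generators of a given semigroup *)

Section Forward.
Variable R : realType.
Local Notation C := R[i].
Local Notation T2 := (R * R)%type.

Lemma weak_cint (m : R -> PT R) (f : T2 -> C) : weakly_continuous m -> contT f ->
  forall t, 0 <= t -> ccvg (tnear t) (fun s => cint (m s) f) (cint (m t) f).
Proof.
move=> wm cf t t0; have cR := contT_Re cf; have cI := contT_Im cf.
move: cR cI => /within_circleP/wm/within_timeP/(_ t t0) h1 /within_circleP/wm/within_timeP/(_ t t0) h2.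
by apply: ccvgD => //; apply: ccvgM => //; exact: ccvg_cst.
Qed.

(** The cocycle for [hh] comes from an identity between eta-transforms by cancelling [z], which
    fails at the origin; continuity supplies the missing point. *)
Lemma eq_at0 (f g : C -> C) : ccvg (cnbhs 0) f (f 0) -> ccvg (cnbhs 0) g (g 0) ->
  (forall z, z != 0 -> normc z < 1 -> f z = g z) -> f 0 = g 0.
Proof.
move=> cf cg fg; apply: eq_of_small => e e0; have e2 : 0 < e / 2 by rewrite divr_gt0.
have [d d0 hd] := cf _ e2; have [d' d0' hd'] := cg _ e2.
pose r := Num.min (Num.min d d') 1 / 2.
have m0 : 0 < Num.min (Num.min d d') 1 by rewrite !lt_min d0 d0' ltr01.
have r0 : 0 < r by rewrite divr_gt0.
have : r < Num.min (Num.min d d') 1 by rewrite /r; lra.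
rewrite !lt_min => /andP[/andP[rd rd'] r1].
have nr : normc (r%:C)%C = r by rewrite normc_real gtr0_norm.
have := hd (r%:C)%C; have := hd' (r%:C)%C; rewrite subr0 nr => /(_ rd') h1 /(_ rd) h2.
apply: le_trans (distc_tri (f r%:C%C) _ _) _; rewrite (distcC (f 0)).
move: h1; rewrite -fg ?nr// ?realC_eq0 ?gt_eqF//; lra.
Qed.

Lemma component_ode (m nu : R -> PT R) : (forall t, 0 <= t -> onT (m t)) ->
  (forall t, 0 <= t -> onT (nu t)) -> weakly_continuous m -> weakly_continuous nu ->
  is_delta (m 0) ->
  (forall s t z, 0 <= s -> 0 <= t -> normc z < 1 ->
     Defs.eta (m (s + t)) z = Defs.eta (m t) z * hh (m s) (Defs.eta (nu t) z)) ->
  exists2 B : C -> C, analytic_nonpos B & forall t z, 0 <= t -> normc z < 1 ->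
    has_deriv_t (fun s => Defs.eta (m s) z) t (Defs.eta (m t) z * B (Defs.eta (nu t) z)).
Proof.
move=> mT nuT wm wnu d0 add.
have hcont (p : R -> PT R) t z : (forall t, 0 <= t -> onT (p t)) -> weakly_continuous p ->
    0 <= t -> normc z < 1 -> ccvg (tnear t) (fun s => hh (p s) z) (hh (p t) z).
  move=> pT wp t0 z1; apply: ccvgM.
    by apply: weak_cint => //; apply: contTM; [exact: contT_pt|exact: contT_kernel].
  apply: ccvgV; first by apply: kint_neq0 => //; exact: pT.
  by apply: weak_cint => //; exact: contT_kernel.
have econt (p : R -> PT R) t z : (forall t, 0 <= t -> onT (p t)) -> weakly_continuous p ->
    0 <= t -> normc z < 1 -> ccvg (tnear t) (fun s => Defs.eta (p s) z) (Defs.eta (p t) z).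
  move=> pT wp t0 z1; apply: (@ccvg_near _ _ _ _ (fun s => z * hh (p s) z)).
    by apply: filterS (tnear_ge0 t) => s s0; rewrite eta_hh//; exact: pT.
  rewrite eta_hh//; last exact: pT.
  by apply: ccvgM; [exact: ccvg_cst|exact: hcont].
have le1 t z : 0 <= t -> normc z < 1 -> normc (Defs.eta (nu t) z) <= normc z.
  by move=> t0 z1; apply: normc_eta => //; exact: nuT.
have hadd s t z : 0 <= s -> 0 <= t -> normc z < 1 ->
    hh (m (s + t)) z = hh (m t) z * hh (m s) (Defs.eta (nu t) z).
  move=> s0 t0; have st : 0 <= s + t by rewrite addr_ge0.
  have nz (w : C) : w != 0 -> normc w < 1 -> hh (m (s + t)) w = hh (m t) w * hh (m s) (Defs.eta (nu t) w).
    move=> w0 w1; have := add s t w s0 t0 w1.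
    by rewrite (eta_hh (mT _ st) w1) (eta_hh (mT _ t0) w1) -mulrA => /(mulfI w0).
  have [->|z0] := eqVneq z 0; last exact: nz.
  move=> O1; apply: (@eq_at0 (fun z => hh (m (s + t)) z) (fun z => hh (m t) z * hh (m s) (Defs.eta (nu t) z))) => //.
    by have [l hl] := cdiff_hh (mT _ st) O1; exact: cder_cvg hl.
  apply: ccvgM; first by have [l hl] := cdiff_hh (mT _ t0) O1; exact: cder_cvg hl.
  have [l hl] := cdiff_eta (nuT _ t0) O1.
  have [k hk] := cdiff_hh (mT _ s0) (le_lt_trans (le1 _ _ t0 O1) O1).
  exact: ccvg_circ (cder_cvg hl) (cder_cvg hk).
have [||||||B BQ hB] := @cocycle_exp R (fun t z => Defs.eta (nu t) z) (fun t z => hh (m t) z) le1.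
- by move=> t z t0 z1; exact: econt.
- by move=> t z t0 z1; apply: cdiff_hh => //; exact: mT.
- by move=> t z t0 z1; apply: normc_hh => //; exact: mT.
- by move=> z z1; exact: delta_hh.
- by move=> t z t0 z1; exact: hcont.
- exact: hadd.
exists B.
  split=> z /unitDE z1; last exact: HQ_nonpos.
  by have [l hl] := HQ_diff BQ z1; have [] := cder_derivable hl.
move=> t z t0 z1; pose g r := B (Defs.eta (nu (Num.max r 0)) z).
have eE s : 0 <= s -> Defs.eta (m s) z = z * cexp (prim g s - prim g 0).
  move=> s0; have [_ h] := hB s z s0 z1; rewrite eta_hh//; last exact: mT.
  by rewrite h cIE.
have [cg _] := hB t z t0 z1.
have -> : B (Defs.eta (nu t) z) = g t by rewrite /g max_l.
rewrite eE//; apply: rder_has_deriv_t (rder_exp_cI z t cg) => // s s0; exact: eE.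
Qed.

Lemma forward (mu nu : R -> PT R) : cmc_semigroup mu nu -> starts_at_delta1 mu nu ->
  exists B1 B2 : C -> C, [/\ analytic_nonpos B1, analytic_nonpos B2 & cmc_ode mu nu B1 B2].
Proof.
move=> [hT hconv wmu wnu] hd.
have muT t : 0 <= t -> onT (mu t) by move=> /hT[].
have nuT t : 0 <= t -> onT (nu t) by move=> /hT[].
have mu0 : is_delta (mu 0) by move=> A /hd[].
have nu0 : is_delta (nu 0) by move=> A /hd[].
have le1 t z : 0 <= t -> normc z < 1 -> normc (Defs.eta (nu t) z) < 1.
  by move=> t0 z1; exact: (le_lt_trans (normc_eta (nuT t t0) z1) z1).
have [|B1 aB1 h1] := component_ode muT nuT wmu wnu mu0.
  move=> s t z s0 t0 z1; have [|_ ->] := hconv s t s0 t0 z; first by rewrite unitDE.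
  by rewrite hfunE//; [exact: muT|exact: le1].
have [|B2 aB2 h2] := component_ode nuT nuT wnu wnu nu0.
  move=> s t z s0 t0 z1; have [|-> _] := hconv s t s0 t0 z; first by rewrite unitDE.
  by rewrite eta_hh//; [exact: nuT|exact: le1].
by exists B1, B2; split=> // t z t0 /unitDE z1; split; [exact: h1|exact: h2].
Qed.

Lemma analytic_nonposP (B : C -> C) : analytic_nonpos B ->
  (forall w, normc w < 1 -> cdiff B w) /\ (forall w, normc w < 1 -> complex.Re (B w) <= 0).
Proof.
move=> [dB B0]; split=> w /unitDE w1; last exact: B0.
by eexists; exact: derivable_cder (dB w w1).
Qed.

End Forward.

Theorem theorem4p5 (R : realType) :
  [/\ (forall mu nu : R -> PT R,
         cmc_semigroup mu nu -> starts_at_delta1 mu nu ->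
         exists B1 B2 : R[i] -> R[i],
           [/\ analytic_nonpos B1, analytic_nonpos B2 & cmc_ode mu nu B1 B2]),
      (forall B1 B2 : R[i] -> R[i],
         analytic_nonpos B1 -> analytic_nonpos B2 ->
         exists mu nu : R -> PT R,
           [/\ cmc_semigroup mu nu, starts_at_delta1 mu nu & cmc_ode mu nu B1 B2])
    & (forall B : R[i] -> R[i], analytic_nonpos B ->
         exists (gamma : R) (tau : {finite_measure set (R * R)%type -> \bar R}),
           herglotz_rep B gamma tau)].
Proof.
split=> [mu nu||B /analytic_nonposP[dB B0]]; first exact: forward.
  by move=> B1 B2 /analytic_nonposP[d1 n1] /analytic_nonposP[d2 n2]; exact: converse.
exact: HQ_herglotz (nonpos_HQ dB B0).
Qed.
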